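(* Let $n,m\ge 1$, $A\in\mathbb{R}^{n\times n}$, $B\in\mathbb{R}^{n\times m}$, and assume that $\operatorname{Re}\lambda\le 0$ for every $\lambda\in\sigma(A)$ and that $\operatorname{rank}(B,AB,\ldots,A^{n-1}B)=n$. Suppose that one of the following three conditions holds: (i) for every $x\in\mathbb{R}^n\setminus\{0\}$ there exists $\varepsilon_x\in(0,|x|)$ such that $u_{\varepsilon,x}^*(t)=u_{0,x}^*(t)$ for all $0<t\le T_\varepsilon^*(x)$ and all $0<\varepsilon<\varepsilon_x$; (ii) there exist constants $\beta'>0$ and $a'\le0$ such that $BB^\top=\beta' I_n$ and $A+A^\top=2a'I_n$; (iii) there exists $\Psi:[0,\infty)\to[0,\infty)$ with $\Psi(0)=0$ such that $V_0(x)=\Psi(|x|)$ for all $x\in\mathbb{R}^n$. Then, for every $x\ne0$ and every $0\le\varepsilon<|x|$, $$T_\varepsilon^*(x)=\int_\varepsilon^{|x|}\frac{d\xi}{\sqrt{\beta}-a\xi},$$ where $\beta=\frac1n\operatorname{tr}(BB^\top)>0$ and $a=\frac1n\operatorname{tr}A\le0$.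
   Context: $|\cdot|$ is the Euclidean norm. Consider the control system $\dot z(t)=Az(t)+Bu(t)$, $z(0)=x$, with controls in $\mathcal U_{ad}=\{u\in L^\infty(0,\infty;\mathbb{R}^m):\|u\|_{L^\infty(0,\infty;\mathbb{R}^m)}\le 1\}$ (pointwise Euclidean norm at most $1$ a.e.); $z(\cdot;x,u)$ denotes its solution. Let $\overline B_\varepsilon(0)=\{y\in\mathbb{R}^n:|y|\le\varepsilon\}$ for $\varepsilon\ge0$ (so $\overline B_0(0)=\{0\}$). For $x\ne0$ and $0\le\varepsilon<|x|$ the minimum-time problem $(P_{\varepsilon,x})$ has optimal time $$T_\varepsilon^*(x)=\inf\{T>0: z(T;x,u)\in\overline B_\varepsilon(0)\text{ for some }u\in\mathcal U_{ad}\},$$ and $u\in\mathcal U_{ad}$ is optimal for $(P_{\varepsilon,x})$ if $z(T_\varepsilon^*(x);x,u)\in\overline B_\varepsilon(0)$. Under the stated hypotheses on $(A,B)$, it is standard that $T_\varepsilon^*(x)$ is finite and that an optimal control exists and is unique up to a.e. equality on $(0,T_\varepsilon^*(x))$; it has a unique representative on $(0,T_\varepsilon^*(x)]$ that is piecewise continuous and left-continuous with finitely many discontinuities. $u_{\varepsilon,x}^*$ denotes this representative, extended by $0$ to $(T_\varepsilon^*(x),\infty)$. The point-target minimum-time function is $V_0(x)=T_0^*(x)$ for $x\ne0$ and $V_0(0)=0$. *)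

(* Defs.v *)
From HB Require Import structures.
From mathcomp Require Import all_boot all_order all_algebra.
From mathcomp Require Import all_classical all_reals all_analysis.
From mathcomp Require Import complex.

Set Implicit Arguments.
Unset Strict Implicit.
Unset Printing Implicit Defensive.

Import Order.TTheory GRing.Theory Num.Theory.
Import numFieldNormedType.Exports.

Local Open Scope classical_set_scope.
Local Open Scope ring_scope.

(* The norm that the library puts on matrices is the max norm, hence an
   explicit Euclidean norm. *)
Definition enorm (R : realType) (n : nat) (v : 'cV[R]_n) : R :=
  Num.sqrt (\sum_(i < n) v i 0 ^+ 2).

(* The spectrum is the set of complex eigenvalues. *)
Definition spectrum_re_le0 (R : realType) (n : nat) (A : 'M[R]_n) : Prop :=
  forall l : R[i], eigenvalue (map_mx (real_complex R) A) l ->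
    complex.Re l <= 0.

Definition controllability_mx (R : realType) (n m : nat)
    (A : 'M[R]_n) (B : 'M[R]_(n, m)) : 'M[R]_(n, \sum_(k < n) m) :=
  \mxrow_(k < n) (A ^+ k *m B).

(* Controls are functions on the whole of R; only their values on ]0, +oo[
   are relevant. *)
Definition admissible (R : realType) (m : nat) (u : R -> 'cV[R]_m) : Prop :=
  (forall i, measurable_fun (`]0%R, +oo[ : set R) (fun t : R => u t i 0)) /\
  {ae lebesgue_measure, forall t : R, 0 < t -> enorm (u t) <= 1}.

(* z is the (Caratheodory) solution of z' = A z + B u, z(0) = x on
   [0, +oo[, i.e., the continuous solution of the integral equation. *)
Definition trajectory (R : realType) (n m : nat)
    (A : 'M[R]_n) (B : 'M[R]_(n, m)) (x : 'cV[R]_n) (u : R -> 'cV[R]_m)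
    (z : R -> 'cV[R]_n) : Prop :=
  {within `[0, +oo[, continuous z} /\
  forall t, 0 <= t -> forall i,
    z t i 0 = x i 0
      + Rintegral lebesgue_measure `[0, t]
          (fun s => (A *m z s + B *m u s) i 0).

Definition reaches (R : realType) (n m : nat)
    (A : 'M[R]_n) (B : 'M[R]_(n, m)) (eps : R) (x : 'cV[R]_n)
    (u : R -> 'cV[R]_m) (T : R) : Prop :=
  exists z, trajectory A B x u z /\ enorm (z T) <= eps.

(* Extended-real valued: the infimum of the empty set is +oo. *)
Definition min_time (R : realType) (n m : nat)
    (A : 'M[R]_n) (B : 'M[R]_(n, m)) (eps : R) (x : 'cV[R]_n) : \bar R :=
  ereal_inf [set T%:E | T in
    [set T : R | 0 < T /\ exists u, admissible u /\ reaches A B eps x u T]].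

Definition value0 (R : realType) (n m : nat)
    (A : 'M[R]_n) (B : 'M[R]_(n, m)) (x : 'cV[R]_n) : \bar R :=
  if x == 0 then 0%E else min_time A B 0 x.

Definition left_piecewise_continuous (R : realType) (m : nat) (T : R)
    (u : R -> 'cV[R]_m) : Prop :=
  [/\ exists D : seq R, forall t, 0 < t < T -> t \notin D ->
        {for t, continuous u},
      forall t, 0 < t <= T -> u s @[s --> t^'-] --> u t
    & forall t, 0 < t < T -> cvg (u s @[s --> t^'+])].

(* The normalized optimal control. It vanishes also on ]-oo, 0], which is
   outside the domain of the controls, so that it is unique as a function on
   the whole of R. *)
Definition optimal_representative (R : realType) (n m : nat)
    (A : 'M[R]_n) (B : 'M[R]_(n, m)) (eps : R) (x : 'cV[R]_n)
    (u : R -> 'cV[R]_m) : Prop :=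
  exists T : R,
    [/\ min_time A B eps x = T%:E,
        admissible u /\ reaches A B eps x u T,
        left_piecewise_continuous T u
      & forall t, ~~ (0 < t <= T) -> u t = 0].

(* A definite description; the default value is irrelevant as soon as
   the normalized optimal control exists. *)
Definition optimal_control (R : realType) (n m : nat)
    (A : 'M[R]_n) (B : 'M[R]_(n, m)) (eps : R) (x : 'cV[R]_n) :
    R -> 'cV[R]_m :=
  xget (fun=> 0) [set u | optimal_representative A B eps x u].

(* Main.v *)
(** Variation of constants turns "u steers x into the ball of radius eps at time
T" into |exp(T A) (x + c(u))| <= eps, where c(u) is the integral of
exp(- s A) B u(s) over [0, T], and <p, c(u)> is the integral of <f_p, u> for the
switching function f_p(t) = B^T exp(- t A^T) p; it is at least - h_T(p), where
h_T(p) is the integral of |f_p|, with equality for u = - f_p / |f_p|.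

Under (ii), |f_x(t)| = sqrt beta e^(- a t) |x|; testing with p = x bounds the time
from below, and u = - f_x / |f_x| moves the state radially and attains the bound.
It remains to derive (ii) from (i) and from (iii).

Under (iii), reflections show that h_T(p) only depends on |p|, hence so does
|f_p(t)|: exp(- t A) B B^T exp(- t A^T) is a scalar matrix for every t >= 0, and
its value and its derivative at 0 give (ii).

Under (i), choose the final costate q, so that the optimal control of (P_0) is
- f_p / |f_p| with p = exp(A^T) q and optimal time 1. The optimal time T of (P_eps)
tends to 1 with eps, and the maximum principle, which is the variational inequality
of the projection on the convex reachable set, says that the same control comes
from the costate directed by z(T). As T tends to 1, z(T) is directed by B B^T q:
f_p is thus positively proportional to its analogue for B B^T q, which forces B^T
to be injective and B B^T to be scalar. Comparing then z(T) with the costate of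
(P_0) at time T at second order in 1 - T shows that q is an eigenvector of A + A^T.
Finally a is the real part of any eigenvalue of A. *)

Require Import Defs.
From mathcomp Require Import all_boot all_order all_algebra.
From mathcomp Require Import all_classical all_reals all_analysis.
From mathcomp Require Import measurable_realfun complex ring lra.

Set Implicit Arguments.
Unset Strict Implicit.
Unset Printing Implicit Defensive.

Import Order.TTheory GRing.Theory Num.Theory.
Import numFieldNormedType.Exports.

Local Open Scope classical_set_scope.
Local Open Scope ring_scope.

(** * Primitives of locally bounded functions *)

(** For f_p(S) nonzero, the point - c(u), where u = - f_p / |f_p| on [0, S], has optimal time S for
    (P_0) and an explicit optimal control. For (P_eps), existence comes from (i) itself: without an
    optimal control, [optimal_control] would be its default 0 and f_p would vanish on an initial
    interval, whereas the rank condition makes its zeros isolated.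

    The costate is prescribed at the final time because the limits T -> 1 need an extremal control
    that is continuous there, which B^T q nonzero ensures. Moreover (i) only speaks of optimal times
    T that accumulate at 1, so limits are compared along such times.

    First order gives nothing on A, since z(T) and the costate at time T have the same limit
    direction q. At second order, for r orthogonal to q, z(T) averages over [T, 1] a quantity that
    vanishes linearly at 1, which halves its r-component relative to that of the costate; equality
    then forces <r, (A + A^T) q> = 0.

    Controls jump, so trajectories are treated through integral equations with locally bounded
    integrands. *)

Section integral.
Context {R : realType}.
Notation mu := (@lebesgue_measure R).
Implicit Types (f g F G : R -> R) (s t : R).

(** Continuous functions and controls both belong to this class, which is closed under products and
    whose members are integrable on bounded intervals of [0, +oo[; integrability is thus settled
    once and for all. *)
Definition locally_bounded f :=
  measurable_fun (`[0, +oo[ : set R) f /\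
  forall T, exists C : R, forall t, 0 <= t <= T -> `|f t| <= C.

Definition primitive0 f t := Rintegral mu `[0, t] f.

Lemma measurable_0y : measurable (`[0%R, +oo[ : set R).
Proof. exact: measurable_itv. Qed.

Lemma eq_locally_bounded f g : (forall t, 0 <= t -> f t = g t) ->
  locally_bounded f -> locally_bounded g.
Proof.
move=> fg [mf bf]; split.
  apply: eq_measurable_fun mf => t /[!inE]/=.
  by rewrite in_itv/= andbT => /fg.
by move=> T; have [C CP] := bf T; exists C => t tT; rewrite -fg ?CP//; case/andP: tT.
Qed.

Lemma locally_bounded_cst c : locally_bounded (fun=> c).
Proof. by split=> // T; exists `|c|. Qed.

Lemma locally_boundedD f g : locally_bounded f -> locally_bounded g ->
  locally_bounded (fun t => f t + g t).
Proof.
move=> [mf bf] [mg bg]; split; first exact: measurable_funD.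
move=> T; have [C CP] := bf T; have [D DP] := bg T; exists (C + D) => t tT.
by rewrite (le_trans (ler_normD _ _))// lerD ?CP ?DP.
Qed.

Lemma locally_boundedM f g : locally_bounded f -> locally_bounded g ->
  locally_bounded (fun t => f t * g t).
Proof.
move=> [mf bf] [mg bg]; split; first exact: measurable_funM.
move=> T; have [C CP] := bf T; have [D DP] := bg T; exists (C * D) => t tT.
by rewrite normrM ler_pM ?CP ?DP.
Qed.

Lemma locally_boundedN f : locally_bounded f -> locally_bounded (fun t => - f t).
Proof.
move=> lf; apply: eq_locally_bounded (locally_boundedM (locally_bounded_cst (-1)) lf).
by move=> t _; rewrite mulN1r.
Qed.

Lemma locally_bounded_sum (I : finType) (h : I -> R -> R) :
  (forall i, locally_bounded (h i)) ->
  locally_bounded (fun t => \sum_i h i t).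
Proof.
move=> lh.
have -> : (fun t => \sum_i h i t) = \sum_i h i by apply/funext => t; rewrite fct_sumE.
apply: big_ind => //; first exact: locally_bounded_cst.
by move=> ? ?; exact: locally_boundedD.
Qed.

Lemma within_locally_bounded f : {within `[0, +oo[, continuous f} ->
  locally_bounded f.
Proof.
move=> cf; split.
  by apply: subspace_continuous_measurable_fun => //; exact: measurable_0y.
move=> T.
have cf' : {within `[0, T], continuous f}.
  apply: continuous_subspaceW cf => t/=.
  by rewrite !in_itv/= => /andP[-> _].
have := continuous_compact cf' (@segment_compact _ 0 T).
move=> /compact_bounded[M [_ MP]]; exists (M + 1) => t tT.
by apply: (MP (M + 1)); rewrite ?ltrDl//; exists t => //=; rewrite in_itv.
Qed.

Lemma continuous_locally_bounded f : continuous f -> locally_bounded f.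
Proof. by move=> cf; apply: within_locally_bounded; exact: continuous_subspaceT. Qed.

Lemma locally_bounded_integrable f s t : 0 <= s -> locally_bounded f ->
  mu.-integrable (`[s, t] : set R) (EFin \o f).
Proof.
move=> s0 [mf bf]; apply: measurable_bounded_integrable => //.
- rewrite /= lebesgue_measure_itv. by case: ifP => _; rewrite -?EFinB ltry.
- apply: (measurable_funS measurable_0y _ mf).
  by move=> x/=; rewrite !in_itv/= andbT => /andP[/(le_trans s0)].
- have [C CP] := bf t; exists C; split; first exact: num_real.
  move=> M CM x/=; rewrite in_itv/= => /andP[sx xt].
  by rewrite (le_trans _ (ltW CM))// CP// xt (le_trans s0).
Qed.

Lemma eq_primitive0 f g t : (forall s, 0 <= s <= t -> f s = g s) ->
  primitive0 f t = primitive0 g t.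
Proof. by move=> fg; apply: eq_Rintegral => s /[!inE]/=; rewrite in_itv => /fg. Qed.

Lemma primitive0_at0 f : primitive0 f 0 = 0.
Proof. by rewrite /primitive0 set_itv1 Rintegral_set1. Qed.

Lemma primitive0D f g t : locally_bounded f -> locally_bounded g ->
  primitive0 (fun s => f s + g s) t = primitive0 f t + primitive0 g t.
Proof.
move=> lf lg; rewrite /primitive0 RintegralD//; exact: locally_bounded_integrable.
Qed.

Lemma primitive0Z c f t : locally_bounded f ->
  primitive0 (fun s => c * f s) t = c * primitive0 f t.
Proof.
move=> lf; rewrite /primitive0 RintegralZl//; exact: locally_bounded_integrable.
Qed.

Lemma primitive0N f t : locally_bounded f ->
  primitive0 (fun s => - f s) t = - primitive0 f t.
Proof.
move=> lf; rewrite -mulN1r -primitive0Z//.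
by apply: eq_primitive0 => s _; rewrite mulN1r.
Qed.

Lemma primitive0B f g t : locally_bounded f -> locally_bounded g ->
  primitive0 (fun s => f s - g s) t = primitive0 f t - primitive0 g t.
Proof.
by move=> lf lg; rewrite primitive0D ?primitive0N//; exact: locally_boundedN.
Qed.

Lemma primitive0_cst c t : 0 <= t -> primitive0 (fun=> c) t = c * t.
Proof.
move=> t0; rewrite /primitive0 Rintegral_cst//= lebesgue_measure_itv/= lte_fin.
case: ltP => [_|t0']; first by rewrite -EFinB subr0.
by have -> : t = 0 by [apply/eqP; rewrite eq_le t0 t0'].
Qed.

Lemma primitive0_sum (I : finType) (h : I -> R -> R) t :
  (forall i, locally_bounded (h i)) ->
  primitive0 (fun s => \sum_i h i s) t = \sum_i primitive0 (h i) t.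
Proof.
move=> lh; rewrite -(big_enum _ _ _) /=.
rewrite (@eq_primitive0 _ (fun s => \sum_(i <- enum I) h i s)); last first.
  by move=> s _; rewrite big_enum.
elim: (enum I) => [|i r IH].
  rewrite big_nil (@eq_primitive0 _ (fun=> 0 * 0)); last by move=> s _; rewrite big_nil mul0r.
  by rewrite primitive0Z ?mul0r//; exact: locally_bounded_cst.
rewrite big_cons -IH -primitive0D//.
  by apply: eq_primitive0 => s _; rewrite big_cons.
have -> : (fun t => \sum_(i <- r) h i t) = \sum_(i <- r) h i.
  by apply/funext => x; rewrite fct_sumE.
apply: big_ind => //; first exact: locally_bounded_cst.
by move=> ? ?; exact: locally_boundedD.
Qed.

Lemma primitive0_ge f s t : locally_bounded f -> 0 <= s <= t ->
  (forall r, s < r <= t -> 0 <= f r) -> primitive0 f s <= primitive0 f t.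
Proof.
move=> lf /andP[s0 st] f0; rewrite -subr_ge0 /primitive0 Rintegral_itvB ?bnd_simp//.
  by apply: Rintegral_ge0 => r/=; rewrite in_itv => /f0.
exact: locally_bounded_integrable.
Qed.

Lemma primitive0_le f g s t : locally_bounded f -> locally_bounded g ->
  0 <= s <= t -> (forall r, s < r <= t -> f r <= g r) ->
  primitive0 f t - primitive0 f s <= primitive0 g t - primitive0 g s.
Proof.
move=> lf lg st fg.
have lgf : locally_bounded (fun r => g r - f r).
  by apply: locally_boundedD => //; exact: locally_boundedN.
have := @primitive0_ge _ s t lgf st.
rewrite !primitive0B// => H.
have {}H := H (fun r h => etrans (subr_ge0 _ _) (fg r h)); lra.
Qed.

Lemma primitive0_dist f C s t : locally_bounded f -> 0 <= s <= t ->
  (forall r, s < r <= t -> `|f r| <= C) ->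
  `|primitive0 f t - primitive0 f s| <= C * (t - s).
Proof.
move=> lf st fC; have [s0 st'] := andP st; have t0 := le_trans s0 st'.
have lC := locally_bounded_cst C; have lNC := locally_bounded_cst (- C).
have H r : s < r <= t -> - C <= f r <= C by move=> /fC; rewrite ler_norml.
have h1 := @primitive0_le _ _ _ _ lf lC st (fun r h => proj2 (andP (H r h))).
have h2 := @primitive0_le _ _ _ _ lNC lf st (fun r h => proj1 (andP (H r h))).
rewrite !primitive0_cst// in h1 h2; rewrite ler_norml; apply/andP; split; lra.
Qed.

End integral.

(** * Integral functions and the product rule *)

Section absolutely_continuous.
Context {R : realType}.
Notation mu := (@lebesgue_measure R).
Implicit Types (f g F G : R -> R) (s t T : R).

(** Over N + 1 equal pieces of [0, T] the bounds add up to C T^2 / (N + 1), and N is arbitrary. The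
    product rule [is_primitiveM] rests on this estimate, as its factors need not be
    differentiable. *)
Lemma quadratic_increment_cst F C T : 0 <= T ->
  (forall s t, 0 <= s <= t -> t <= T -> `|F t - F s| <= C * (t - s) ^+ 2) ->
  F T = F 0.
Proof.
move=> T0 FC; apply/eqP; rewrite -subr_eq0 -normr_le0.
have step N : `|F T - F 0| <= C * T ^+ 2 / N.+1%:R.
  pose h := T / N.+1%:R.
  have h0 : 0 <= h by rewrite divr_ge0.
  have H k : (k <= N.+1)%N -> `|F (k%:R * h) - F 0| <= k%:R * (C * h ^+ 2).
    elim: k => [|k IH] kN; first by rewrite !mul0r subrr normr0.
    have {}IH := IH (ltnW kN).
    have := FC (k%:R * h) (k.+1%:R * h).
    rewrite mulr_ge0// ler_wpM2r ?ler_nat// => /(_ isT).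
    have -> : k.+1%:R * h <= T.
      rewrite /h mulrA ler_pdivrMr// mulrC ler_wpM2l// ler_nat//.
    move=> /(_ isT); rewrite -mulrBl -natrB// subSnn mul1r => H1.
    have -> : F (k.+1%:R * h) - F 0 =
        (F (k.+1%:R * h) - F (k%:R * h)) + (F (k%:R * h) - F 0) by ring.
    rewrite (le_trans (ler_normD _ _))// (le_trans (lerD H1 IH))//.
    by rewrite -[in leRHS]addn1 natrD mulrDl mul1r addrC.
  have := H N.+1 (leqnn _).
  have -> : N.+1%:R * h = T by rewrite /h mulrC divfK.
  suff -> : N.+1%:R * (C * h ^+ 2) = C * T ^+ 2 / N.+1%:R by [].
  have := @pnatr_eq0 R N.+1; rewrite /h; move: (N.+1%:R : R) => c /negbT c0; by field.
rewrite leNgt; apply/negP => d0.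
set d := `|F T - F 0| in step d0.
have C0 : 0 <= `|C| * T ^+ 2 by rewrite mulr_ge0// exprn_ge0.
have /andP[_ hN] := truncn_itv (divr_ge0 C0 (ltW d0)).
have := step (Num.truncn (`|C| * T ^+ 2 / d)).
apply/negP; rewrite -ltNge.
rewrite ltr_pdivrMr ?ltr0n//.
rewrite ltr_pdivrMr// [ltRHS]mulrC in hN; apply: le_lt_trans hN.
by rewrite ler_wpM2r ?exprn_ge0// ler_norm.
Qed.

(** This stands for a locally Lipschitz F with derivative f almost everywhere. The integral form
    suits trajectories, which may fail to be differentiable where the control jumps. *)
Definition is_primitive F f :=
  locally_bounded f /\ forall t, 0 <= t -> F t = F 0 + primitive0 f t.

Lemma is_primitive_dist F f C s t : is_primitive F f -> 0 <= s <= t ->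
  (forall r, s < r <= t -> `|f r| <= C) -> `|F t - F s| <= C * (t - s).
Proof.
move=> [lf Ff] /[dup] st /andP[s0 st'] fC.
rewrite (Ff t) ?(le_trans s0)// (Ff s)// opprD addrACA subrr add0r.
exact: primitive0_dist.
Qed.

Lemma is_primitive_Lipschitz F f T : is_primitive F f ->
  exists2 C, 0 <= C & forall s t, 0 <= s <= T -> 0 <= t <= T ->
    `|F t - F s| <= C * `|t - s|.
Proof.
move=> Ff; have [C CP] := Ff.1.2 T.
exists `|C| => // s t /andP[s0 sT] /andP[t0 tT].
have H a b : 0 <= a <= b -> b <= T -> `|F b - F a| <= `|C| * (b - a).
  move=> ab bT; apply: (is_primitive_dist Ff) => // r /andP[ar rb].
  rewrite (le_trans (CP _ _)) ?ler_norm// (le_trans rb)// andbT ltW//.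
  by rewrite (le_lt_trans _ ar)//; case/andP: ab.
have [st|ts] := leP s t.
  by rewrite (ger0_norm (_ : 0 <= t - s)) ?subr_ge0// H// s0.
rewrite distrC (distrC t) (gtr0_norm (_ : 0 < s - t)) ?subr_gt0// H//.
by rewrite t0 ltW.
Qed.

Lemma is_primitive_continuous F f : is_primitive F f ->
  {within `[0, +oo[, continuous F}.
Proof.
move=> Ff; apply/subspace_continuousP => x/=; rewrite in_itv/= andbT => x0.
have [C C0 H] := is_primitive_Lipschitz (x + 1) Ff.
apply/cvgrPdist_lt => e e0; rewrite near_withinE.
have d0 : 0 < Num.min 1 (e / (C + 1)).
  by rewrite lt_min ltr01 divr_gt0// ltr_wpDl.
apply/nbhs_ballP; exists (Num.min 1 (e / (C + 1))) => //= t xt.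
rewrite in_itv/= andbT => t0.
move: xt; rewrite /ball/= lt_min => /andP[xt1 xt2].
apply: (le_lt_trans (H _ _ _ _)).
- by rewrite t0/=; move: xt1; rewrite ltr_norml => /andP[]; lra.
- by rewrite x0 lerDl ler01.
- move: xt2; rewrite ltr_pdivlMr ?ltr_wpDl// => xt2; apply: le_lt_trans xt2.
  by rewrite mulrC ler_wpM2l// lerDl.
Qed.

Lemma is_primitive_locally_bounded F f : is_primitive F f -> locally_bounded F.
Proof. by move=> /is_primitive_continuous/within_locally_bounded. Qed.

Lemma eq_is_primitive F G f g : (forall t, 0 <= t -> F t = G t) ->
  (forall t, 0 <= t -> f t = g t) -> is_primitive F f -> is_primitive G g.
Proof.
move=> FG fg [lf Ff]; split; first exact: eq_locally_bounded lf.
move=> t t0; rewrite -!FG// Ff//; congr (_ + _).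
by apply: eq_primitive0 => s /andP[s0 _]; rewrite fg.
Qed.

Lemma primitive0_is_primitive f : locally_bounded f -> is_primitive (primitive0 f) f.
Proof. by move=> lf; split=> // t _; rewrite primitive0_at0 add0r. Qed.

Lemma is_primitive_cst c : is_primitive (fun=> c) (fun=> 0).
Proof.
split; first exact: locally_bounded_cst.
by move=> t t0; rewrite primitive0_cst// mul0r addr0.
Qed.

Lemma is_primitiveD F G f g : is_primitive F f -> is_primitive G g ->
  is_primitive (fun t => F t + G t) (fun t => f t + g t).
Proof.
move=> [lf Ff] [lg Gg]; split; first exact: locally_boundedD.
by move=> t t0; rewrite primitive0D// addrACA -Ff// -Gg.
Qed.

Lemma is_primitive_sum (I : finType) (H h : I -> R -> R) :
  (forall i, is_primitive (H i) (h i)) ->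
  is_primitive (fun t => \sum_i H i t) (fun t => \sum_i h i t).
Proof.
move=> Hh; split; first by apply: locally_bounded_sum => i; case: (Hh i).
move=> t t0; rewrite primitive0_sum; last by move=> i; case: (Hh i).
by rewrite -big_split/=; apply: eq_bigr => i _; case: (Hh i) => _ ->.
Qed.

Lemma is_primitiveM F G f g : is_primitive F f -> is_primitive G g ->
  is_primitive (fun t => F t * G t) (fun t => f t * G t + F t * g t).
Proof.
move=> Ff Gg; have lF := is_primitive_locally_bounded Ff.
have lG := is_primitive_locally_bounded Gg; have [lf _] := Ff; have [lg _] := Gg.
have lfG := locally_boundedM lf lG; have lFg := locally_boundedM lF lg.
have lfgG := locally_boundedD lfG lFg.
split=> // T T0; set h := fun t => _.
suff : F T * G T - primitive0 h T = F 0 * G 0 - primitive0 h 0.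
  by rewrite primitive0_at0 subr0 => <-; rewrite subrK.
have [A AP] := lf.2 T; have [B BP] := lg.2 T.
(* [A] bounds [f] and [B] bounds [g] on [0, T]; each of the two error terms contributes [A * B]. *)
apply: (@quadratic_increment_cst (fun t => F t * G t - primitive0 h t)
  (A * B + A * B) T T0) => s t st tT.
have [s0 st'] := andP st; have t0 := le_trans s0 st'.
have bnd r : s < r <= t -> 0 <= r <= T.
  by case/andP => sr rt; rewrite (le_trans rt)// andbT (le_trans s0)// ltW.
(* the increment is the integral over [s, t] of
   f r * (G t - G r) + (F s - F r) * g r, which is of order t - s *)
pose k r := (f r * G t + F s * g r) - h r.
have lk1 : locally_bounded (fun r => f r * G t).
  by apply: locally_boundedM => //; exact: locally_bounded_cst.
have lk2 : locally_bounded (fun r => F s * g r).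
  by apply: locally_boundedM => //; exact: locally_bounded_cst.
have lk12 := locally_boundedD lk1 lk2.
have lk : locally_bounded k by apply: locally_boundedD => //; exact: locally_boundedN.
have -> : F t * G t - primitive0 h t - (F s * G s - primitive0 h s) =
    primitive0 k t - primitive0 k s.
  rewrite !primitive0B// !primitive0D// !primitive0Z//.
  have E r : primitive0 (fun x => f x * G t) r = G t * primitive0 f r.
    by rewrite -primitive0Z//; apply: eq_primitive0 => x _; rewrite mulrC.
  rewrite !E (Ff.2 t)// (Ff.2 s)// (Gg.2 t)// (Gg.2 s)//; ring.
rewrite (_ : _ * _ ^+ 2 = (A * B + A * B) * (t - s) * (t - s)); last by ring.
apply: (primitive0_dist lk st) => r srt; have [sr rt] := andP srt.
have -> : k r = f r * (G t - G r) - (F r - F s) * g r by rewrite /k /h; ring.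
rewrite (le_trans (ler_normB _ _))// [leRHS]mulrDl lerD//.
- rewrite normrM -mulrA ler_pM//; first by rewrite AP ?bnd.
  have H : `|G t - G r| <= B * (t - r).
    apply: (is_primitive_dist Gg).
      by rewrite rt (le_trans s0)// ltW.
    by move=> x /andP[rx xt]; rewrite BP// bnd// xt (lt_trans sr).
  rewrite (le_trans H)// ler_wpM2l//; last by rewrite lerB// ltW.
  by rewrite (le_trans _ (BP 0 _))// lexx.
- rewrite normrM (mulrC A) -mulrA mulrC ler_pM//; first by rewrite BP ?bnd.
  have H : `|F r - F s| <= A * (r - s).
    apply: (is_primitive_dist Ff).
      by rewrite s0 ltW.
    by move=> x /andP[sx xr]; rewrite AP// bnd// sx (le_trans xr).
  rewrite (le_trans H)// ler_wpM2l//; last by rewrite lerB.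
  by rewrite (le_trans _ (AP 0 _))// lexx.
Qed.

Lemma derive_is_primitive F f : continuous f ->
  (forall t, is_derive t 1 F (f t)) -> is_primitive F f.
Proof.
move=> cf Ff; split; first exact: continuous_locally_bounded.
move=> t; rewrite le_eqVlt => /predU1P[<-|t0]; first by rewrite primitive0_at0 addr0.
have dF x : derivable F x 1 by [].
have cF x : {for x, continuous F}.
  by apply: differentiable_continuous; apply/derivable1_diffP.
rewrite /primitive0 /Rintegral (@continuous_FTC2 _ f F)//.
- by rewrite -EFinB/=; ring.
- exact: continuous_subspaceT.
- split => //.
  + by apply: cvg_at_right_filter; exact: cF.
  + by apply: cvg_at_left_filter; exact: cF.
- by move=> x _; rewrite derive1E; apply: derive_val.
Qed.

(** Equality in an integrated inequality becomes equality at almost every time; [ae_extremal] is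
    drawn from it. *)
Lemma primitive0_eq0 f t : locally_bounded f -> 0 <= t ->
  (forall s, 0 <= s <= t -> 0 <= f s) -> primitive0 f t <= 0 ->
  {ae mu, forall s, 0 <= s <= t -> f s = 0}.
Proof.
move=> lf t0 f0 ft0.
have mf : measurable_fun (`[0, t] : set R) (EFin \o f).
  by have /integrableP[] := locally_bounded_integrable t (lexx 0) lf.
have H : (\int[mu]_(x in `[0%R, t]) `|(EFin \o f) x| = 0)%E.
  have -> : (\int[mu]_(x in `[0%R, t]) `|(EFin \o f) x| =
      \int[mu]_(x in `[0%R, t]) (EFin \o f) x)%E.
    apply: eq_integral => x /[!inE]/=; rewrite in_itv/= => x0t.
    by rewrite ger0_norm ?f0.
  have if0 := locally_bounded_integrable t (lexx 0) lf.
  have /fineK <- : (\int[mu]_(x in `[0%R, t]) (EFin \o f) x)%E \is a fin_num.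
    exact: integrable_fin_num if0.
   congr EFin; apply/eqP; rewrite eq_le ft0/=.
  apply: Rintegral_ge0 => x/=; rewrite in_itv/=; exact: f0.
have /(ae_eq_integral_abs mu (measurable_itv _) mf) := H.
apply: filterS => s /= h st; have := h _; rewrite in_itv/= => /(_ st) [].
by [].
Qed.

End absolutely_continuous.

(** * Matrix exponential *)

Section entire_series.
Context {R : realType}.
Implicit Types (c : R^nat) (x a : R).

(** Such coefficients are dominated by those of an exponential series, so the radius of convergence
    is infinite; the bound passes at once to shifts and to termwise derivatives. *)
Definition factorially_bounded c :=
  exists C K : R, forall k, `|c k| <= C * (K ^+ k / k`!%:R).

Lemma factorially_bounded_shift c : factorially_bounded c ->
  factorially_bounded (fun k => c k.+1).
Proof.
move=> [C [K cP]]; exists (`|C| * `|K|), `|K| => k.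
rewrite (le_trans (cP _))// (le_trans (ler_norm _))// !normrM normfV normrX.
rewrite -mulrA ler_wpM2l// mulrA -exprS ler_wpM2l ?exprn_ge0//.
by rewrite ger0_norm// lef_pV2 ?posrE ?ltr0n ?fact_gt0// ler_nat factS leq_pmull.
Qed.

Lemma factorially_bounded_diffs c : factorially_bounded c ->
  factorially_bounded (pseries_diffs c).
Proof.
move=> [C [K cP]]; exists (C * K), K => k.
rewrite /pseries_diffs normrM ger0_norm// mulrC -ler_pdivlMr ?ltr0n//.
rewrite (le_trans (cP _))// factS natrM exprS.
have := @pnatr_eq0 R k.+1; have := @pnatr_eq0 R k`!; rewrite (gtn_eqF (fact_gt0 k)).
move: (k.+1%:R : R) (k`!%:R : R) => u v /negbT v0 /negbT u0.
by rewrite le_eqVlt; apply/orP; left; apply/eqP; field; rewrite u0.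
Qed.

Lemma factorially_boundedD c d a : factorially_bounded c -> factorially_bounded d ->
  factorially_bounded (fun k => a * c k + d k).
Proof.
move=> [C [K cP]] [D [L dP]]; exists (`|a| * `|C| + `|D|), (Num.max `|K| `|L|) => k.
rewrite (le_trans (ler_normD _ _))// mulrDl lerD//.
- rewrite normrM -mulrA ler_wpM2l// (le_trans (cP k))// (le_trans (ler_norm _))//.
  rewrite !normrM ler_wpM2l// normfV [X in _ / X]ger0_norm// ler_wpM2r ?invr_ge0//.
  by rewrite normrX lerXn2r// ?nnegrE// ?le_max ?normr_ge0 ?lexx.
- rewrite (le_trans (dP k))// (le_trans (ler_norm _))//.
  rewrite !normrM ler_wpM2l// normfV [X in _ / X]ger0_norm// ler_wpM2r ?invr_ge0//.
  by rewrite normrX lerXn2r// ?nnegrE// ?le_max ?normr_ge0 ?lexx ?orbT.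
Qed.

Lemma factorially_bounded_cvg c x : factorially_bounded c -> cvgn (pseries c x).
Proof.
move=> [C [K cP]]; apply: normed_cvg.
apply: (@series_le_cvg _ _ (fun k => `|C| * exp_coeff (`|K| * `|x|) k)).
- by move=> k /=.
- by move=> k; rewrite mulr_ge0// divr_ge0// exprn_ge0// mulr_ge0.
- move=> k; rewrite /exp_coeff/= normrM normrX exprMn mulrAC mulrA ler_wpM2r ?exprn_ge0//.
  rewrite (le_trans (cP k))// (le_trans (ler_norm _))// normrM mulrA.
  by rewrite !normrM normfV normrX mulrA [X in _ / X]ger0_norm.
- exact/is_cvg_seriesZ/is_cvg_series_exp_coeff.
Qed.

Definition entire c x : R := limn (pseries c x).

Lemma entire_derive c x : factorially_bounded c ->
  is_derive x 1 (entire c) (entire (pseries_diffs c) x).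
Proof.
move=> fc; have fdc := factorially_bounded_diffs fc.
have fddc := factorially_bounded_diffs fdc.
apply: (@pseries_snd_diffs _ c (`|x| + 1)); try exact: factorially_bounded_cvg.
by rewrite [ltRHS]ger0_norm ?ltrDl// addr_ge0.
Qed.

Lemma entire_continuous c : factorially_bounded c -> continuous (entire c).
Proof.
move=> fc x; have ? := @entire_derive c x fc.
by apply: differentiable_continuous; apply/derivable1_diffP.
Qed.

Lemma entireD c d a x : factorially_bounded c -> factorially_bounded d ->
  entire (fun k => a * c k + d k) x = a * entire c x + entire d x.
Proof.
move=> fc fd; rewrite /entire.
have cc := @factorially_bounded_cvg c x fc; have cd := @factorially_bounded_cvg d x fd.
rewrite /pseries -[X in _ = X + _]lim_seriesZ// -lim_seriesD//; last exact: is_cvg_seriesZ.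
congr (limn (series _)); apply/funext => k /=.
by rewrite mulrDl -mulrA.
Qed.

Lemma factorially_bounded0 : factorially_bounded (fun=> 0).
Proof. by exists 0, 0 => k; rewrite normr0 mul0r. Qed.

Lemma entire0 x : entire (fun=> 0) x = 0.
Proof.
rewrite /entire /pseries (_ : series _ = fun=> 0) ?lim_cst//.
by apply/funext => n; rewrite /series /= big1// => i _; rewrite mul0r.
Qed.

Lemma entire_sum (I : finType) (a : I -> R) (h : I -> R^nat) x :
  (forall i, factorially_bounded (h i)) ->
  entire (fun k => \sum_i a i * h i k) x = \sum_i a i * entire (h i) x.
Proof.
move=> fh.
have -> : (fun k => \sum_i a i * h i k) = (fun k => \sum_(i <- enum I) a i * h i k).
  by apply/funext => k; rewrite big_enum.
rewrite -[RHS](big_enum _ _ _ _)/=.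
suff : factorially_bounded (fun k => \sum_(i <- enum I) a i * h i k) /\
    entire (fun k => \sum_(i <- enum I) a i * h i k) x =
    \sum_(i <- enum I) a i * entire (h i) x by case.
elim: (enum I) => [|i r [fr IH]].
  have -> : (fun k : nat => \sum_(i <- [::]) a i * h i k) = (fun=> 0).
    by apply/funext => k; rewrite big_nil.
  by rewrite entire0 big_nil; split=> //; exact: factorially_bounded0.
have -> : (fun k => \sum_(j <- i :: r) a j * h j k) =
    (fun k => a i * h i k + \sum_(j <- r) a j * h j k).
  by apply/funext => k; rewrite big_cons.
by split; [exact: factorially_boundedD | rewrite entireD// IH big_cons].
Qed.

Lemma entire_recl c x : factorially_bounded c ->
  entire c x = c 0%N + x * entire (fun k => c k.+1) x.
Proof.
move=> fc; have fc' := factorially_bounded_shift fc.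
have cc := @factorially_bounded_cvg _ x fc'.
apply/cvg_lim => //; rewrite -cvg_shiftS.
have -> : (fun n => pseries c x n.+1) =
    (fun n => c 0%N + x * pseries (fun k => c k.+1) x n).
  apply/funext => n; rewrite /pseries /series /= big_nat_recl//= expr0 mulr1.
  congr (_ + _); rewrite mulr_sumr; apply: eq_bigr => k _; rewrite exprS; ring.
by apply: cvgD; [exact: cvg_cst|apply: cvgM; [exact: cvg_cst|exact: cc]].
Qed.

End entire_series.

(** * Matrix-valued primitives *)

Section matrix_primitive.
Context {R : realType}.
Implicit Types (s t T : R).

Definition mx_locally_bounded m n (W : R -> 'M[R]_(m, n)) :=
  forall i j, locally_bounded (fun t => W t i j).

Definition mx_primitive0 m n (W : R -> 'M[R]_(m, n)) t : 'M[R]_(m, n) :=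
  \matrix_(i, j) primitive0 (fun s => W s i j) t.

Definition mx_is_primitive m n (Z W : R -> 'M[R]_(m, n)) :=
  forall i j, is_primitive (fun t => Z t i j) (fun t => W t i j).

Lemma mx_is_primitiveE m n (Z W : R -> 'M[R]_(m, n)) t :
  mx_is_primitive Z W -> 0 <= t -> Z t = Z 0 + mx_primitive0 W t.
Proof. by move=> ZW t0; apply/matrixP => i j; rewrite !mxE (ZW i j).2. Qed.

Lemma mx_primitive0_is_primitive m n (W : R -> 'M[R]_(m, n)) :
  mx_locally_bounded W -> mx_is_primitive (mx_primitive0 W) W.
Proof.
move=> lW i j; apply: eq_is_primitive (primitive0_is_primitive (lW i j)) => // t _.
by rewrite mxE.
Qed.

Lemma eq_mx_is_primitive m n (Z W Z' W' : R -> 'M[R]_(m, n)) :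
  (forall t, 0 <= t -> Z t = Z' t) -> (forall t, 0 <= t -> W t = W' t) ->
  mx_is_primitive Z W -> mx_is_primitive Z' W'.
Proof.
move=> ZZ' WW' ZW i j.
by apply: eq_is_primitive (ZW i j) => t t0; rewrite ?ZZ' ?WW'.
Qed.

Lemma mx_is_primitive_cst m n (C : 'M[R]_(m, n)) :
  mx_is_primitive (fun=> C) (fun=> 0).
Proof.
by move=> i j; apply: eq_is_primitive (is_primitive_cst (C i j)) => // t _; rewrite mxE.
Qed.

(** Identities between exponentials are obtained by differentiating a suitable product, finding 0,
    and evaluating at time 0. *)
Lemma mx_is_primitive0 m n (Z : R -> 'M[R]_(m, n)) t :
  mx_is_primitive Z (fun=> 0) -> 0 <= t -> Z t = Z 0.
Proof.
move=> Z0 t0; rewrite (mx_is_primitiveE Z0)// [X in _ + X](_ : _ = 0) ?addr0//.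
apply/matrixP => i j; rewrite !mxE -[RHS](mul0r t) -primitive0_cst//.
Qed.

Lemma mx_is_primitiveD m n (Z W Z' W' : R -> 'M[R]_(m, n)) :
  mx_is_primitive Z W -> mx_is_primitive Z' W' ->
  mx_is_primitive (fun t => Z t + Z' t) (fun t => W t + W' t).
Proof.
move=> ZW ZW' i j.
by apply: eq_is_primitive (is_primitiveD (ZW i j) (ZW' i j)) => t _; rewrite mxE.
Qed.

Lemma mx_is_primitiveM m n p (Z W : R -> 'M[R]_(m, n)) (Z' W' : R -> 'M[R]_(n, p)) :
  mx_is_primitive Z W -> mx_is_primitive Z' W' ->
  mx_is_primitive (fun t => Z t *m Z' t) (fun t => W t *m Z' t + Z t *m W' t).
Proof.
move=> ZW ZW' i j.
apply: eq_is_primitive (is_primitive_sum (fun k => is_primitiveM (ZW i k) (ZW' k j))).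
  by move=> t _; rewrite mxE.
by move=> t _; rewrite !mxE big_split.
Qed.

Lemma mx_locally_boundedM m n p (Z : R -> 'M[R]_(m, n)) (W : R -> 'M[R]_(n, p)) :
  mx_locally_bounded Z -> mx_locally_bounded W ->
  mx_locally_bounded (fun t => Z t *m W t).
Proof.
move=> lZ lW i j.
apply: eq_locally_bounded
  (locally_bounded_sum (fun k => locally_boundedM (lZ i k) (lW k j))) => t _.
by rewrite mxE.
Qed.

Lemma mx_locally_boundedD m n (Z W : R -> 'M[R]_(m, n)) :
  mx_locally_bounded Z -> mx_locally_bounded W ->
  mx_locally_bounded (fun t => Z t + W t).
Proof.
move=> lZ lW i j.
by apply: eq_locally_bounded (locally_boundedD (lZ i j) (lW i j)) => t _; rewrite mxE.
Qed.

Lemma mx_locally_bounded_cst m n (C : 'M[R]_(m, n)) : mx_locally_bounded (fun=> C).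
Proof. by move=> i j; exact: locally_bounded_cst. Qed.

Lemma mx_locally_bounded_tr m n (Z : R -> 'M[R]_(m, n)) :
  mx_locally_bounded Z -> mx_locally_bounded (fun t => (Z t)^T).
Proof. by move=> lZ i j; apply: eq_locally_bounded (lZ j i) => t _; rewrite mxE. Qed.

Lemma mx_is_primitive_locally_bounded m n (Z W : R -> 'M[R]_(m, n)) :
  mx_is_primitive Z W -> mx_locally_bounded Z.
Proof. by move=> ZW i j; exact: is_primitive_locally_bounded (ZW i j). Qed.

Lemma mx_primitive0Ml m n p (C : 'M[R]_(m, n)) (W : R -> 'M[R]_(n, p)) t :
  mx_locally_bounded W ->
  C *m mx_primitive0 W t = mx_primitive0 (fun s => C *m W s) t.
Proof.
move=> lW; apply/matrixP => i j; rewrite !mxE.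
have l k : locally_bounded (fun s => C i k * W s k j).
  by apply: locally_boundedM => //; exact: locally_bounded_cst.
rewrite (@eq_primitive0 _ _ (fun s => \sum_k C i k * W s k j)); last first.
  by move=> s _; rewrite mxE.
by rewrite primitive0_sum//; apply: eq_bigr => k _; rewrite mxE -primitive0Z.
Qed.

Lemma eq_mx_primitive0 m n (Z W : R -> 'M[R]_(m, n)) t :
  (forall s, 0 <= s <= t -> Z s = W s) -> mx_primitive0 Z t = mx_primitive0 W t.
Proof.
by move=> ZW; apply/matrixP => i j; rewrite !mxE; apply: eq_primitive0 => s /ZW ->.
Qed.

End matrix_primitive.

(** * The exponential and its Taylor remainders *)

Section matrix_exponential.
Context {R : realType} {n : nat}.
Variable A : 'M[R]_n.
Implicit Types (s t : R).

(* expmx_tail k t is the sum of A^(l + k) t^l / (l + k)! over l, i.e., the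
   remainder of order k of exp(t A) divided by t^k. *)
Definition expmx_coef k (i j : 'I_n) : R^nat := fun l => (A ^+ (l + k)) i j / (l + k)`!%:R.

Definition expmx_tail k t : 'M[R]_n := \matrix_(i, j) entire (expmx_coef k i j) t.

Definition expmx t := expmx_tail 0 t.

(** The sum of all absolute entries dominates every row sum, which carries the induction. *)
Lemma exprmx_bound k i j : `|(A ^+ k) i j| <= (\sum_i \sum_j `|A i j|) ^+ k.
Proof.
have S0 : 0 <= \sum_i \sum_j `|A i j| by apply: sumr_ge0 => ? _; exact: sumr_ge0.
elim: k i j => [|k IH] i j.
  by rewrite !expr0 mxE; case: eqP => _; rewrite ?normr1 ?normr0.
rewrite !exprS mxE (le_trans (ler_norm_sum _ _ _))//.
apply: (@le_trans _ _ (\sum_l `|A i l| * (\sum_i \sum_j `|A i j|) ^+ k)).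
  by apply: ler_sum => l _; rewrite normrM ler_wpM2l.
rewrite -mulr_suml ler_wpM2r ?exprn_ge0//.
by rewrite [leRHS](bigD1 i)//= lerDl; apply: sumr_ge0 => ? _; exact: sumr_ge0.
Qed.

Lemma expmx_coef_bounded k i j : factorially_bounded (expmx_coef k i j).
Proof.
elim: k => [|k [C [K IH]]].
  exists 1, (\sum_i \sum_j `|A i j|) => l; rewrite mul1r /expmx_coef addn0.
  by rewrite normrM normfV [X in _ / X]ger0_norm// ler_wpM2r ?invr_ge0// exprmx_bound.
have := factorially_bounded_shift (ex_intro _ C (ex_intro _ K IH)).
by congr factorially_bounded; apply/funext => l; rewrite /expmx_coef addSnnS.
Qed.

Lemma expmx_tail_continuous k i j : continuous (fun t => expmx_tail k t i j).
Proof.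
have -> : (fun t => expmx_tail k t i j) = entire (expmx_coef k i j).
  by apply/funext => t; rewrite mxE.
exact/entire_continuous/expmx_coef_bounded.
Qed.

Lemma expmx_tail0 k : expmx_tail k 0 = (k`!%:R)^-1 *: A ^+ k.
Proof.
apply/matrixP => i j; rewrite !mxE entire_recl; last exact: expmx_coef_bounded.
by rewrite mul0r addr0 /expmx_coef add0n mulrC.
Qed.

Lemma expmx_tail_recl k t :
  expmx_tail k t = (k`!%:R)^-1 *: A ^+ k + t *: expmx_tail k.+1 t.
Proof.
apply/matrixP => i j; rewrite !mxE entire_recl; last exact: expmx_coef_bounded.
congr (_ + t * entire _ _); first by rewrite /expmx_coef add0n mulrC.
by apply/funext => l; rewrite /expmx_coef addSnnS.
Qed.

Lemma expmx0 : expmx 0 = 1%:M.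
Proof. by rewrite /expmx expmx_tail0 fact0 invr1 scale1r expr0. Qed.

Lemma diffs_expmx_coef i j :
  pseries_diffs (expmx_coef 0 i j) = fun l => (A ^+ l.+1) i j / l`!%:R.
Proof.
apply/funext => l; rewrite /pseries_diffs /expmx_coef !addn0 factS natrM.
have := @pnatr_eq0 R l.+1; have := @pnatr_eq0 R l`!; rewrite (gtn_eqF (fact_gt0 l)).
move: (l.+1%:R : R) (l`!%:R : R) => u v /negbT v0 /negbT u0.
by field; rewrite u0 v0.
Qed.

Lemma mulmx_expmxE t i j :
  (A *m expmx t) i j = entire (pseries_diffs (expmx_coef 0 i j)) t.
Proof.
rewrite mxE; under eq_bigr do rewrite mxE.
rewrite -(entire_sum (A i)); last by move=> l; exact: expmx_coef_bounded.
rewrite diffs_expmx_coef; congr entire; apply/funext => l.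
rewrite exprS mxE mulr_suml; apply: eq_bigr => k _.
by rewrite /expmx_coef !addn0 mulrA.
Qed.

Lemma expmx_comm t : A *m expmx t = expmx t *m A.
Proof.
apply/matrixP => i j; rewrite mulmx_expmxE mxE.
under eq_bigr do rewrite mxE mulrC.
rewrite -(entire_sum (A ^~ j)); last by move=> l; exact: expmx_coef_bounded.
rewrite diffs_expmx_coef; congr entire; apply/funext => l.
rewrite exprSr mxE mulr_suml; apply: eq_bigr => k _.
by rewrite /expmx_coef !addn0 mulrA [A k j * _]mulrC.
Qed.

Lemma expmx_derive t i j : is_derive t 1 (fun t => expmx t i j) ((A *m expmx t) i j).
Proof.
have -> : (fun t => expmx t i j) = entire (expmx_coef 0 i j).
  by apply/funext => s; rewrite mxE.
rewrite mulmx_expmxE; exact/entire_derive/expmx_coef_bounded.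
Qed.

Lemma expmx_continuous i j : continuous (fun t => expmx t i j).
Proof. exact: expmx_tail_continuous. Qed.

(** The affine argument covers at once the flows exp(t A), exp(- t A), exp((s + t) A) and exp((1 -
    t) A). *)
Lemma expmx_is_primitive c s : mx_is_primitive (fun t => expmx (c * t + s))
  (fun t => c *: (A *m expmx (c * t + s))).
Proof.
move=> i j.
have H t : is_derive t 1 (fun t => expmx (c * t + s) i j)
    ((c *: (A *m expmx (c * t + s))) i j).
  have H1 := expmx_derive (c * t + s) i j.
  have H2 : is_derive t 1 (fun t => c * t + s) c.
    by apply: is_derive_eq; rewrite addr0 [LHS]mulr1.
  have := is_derive1_comp (f := fun t => expmx t i j) (g := fun t => c * t + s) H1 H2.
  by move=> H3; rewrite [X in is_derive _ _ _ X]mxE mulrC.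
apply: derive_is_primitive => //.
have -> : (fun t => (c *: (A *m expmx (c * t + s))) i j) =
    (\sum_k (fun t => c * A i k * expmx (c * t + s) k j)).
  apply/funext => t; rewrite fct_sumE !mxE mulr_sumr.
  by apply: eq_bigr => k _; rewrite mulrA.
have cE k : continuous (fun t => c * A i k * expmx (c * t + s) k j).
  move=> t; apply: cvgM; first exact: cvg_cst.
  apply: (@continuous_comp _ _ _ (fun t => c * t + s) (fun t => expmx t k j)).
    apply: cvgD; last exact: cvg_cst.
    by apply: cvgM; [exact: cvg_cst|exact: cvg_id].
  exact: expmx_continuous.
elim/big_ind : _ => [t|f g cf cg t|k _]; first exact: cvg_cst.
- by apply: cvgD; [exact: cf|exact: cg].
- exact: cE.
Qed.

Lemma expmxN_is_primitive : mx_is_primitive (fun t => expmx (- t))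
  (fun t => - (A *m expmx (- t))).
Proof.
by apply: eq_mx_is_primitive (expmx_is_primitive (-1) 0) => t _;
  rewrite mulN1r addr0 ?scaleN1r.
Qed.

Let expmxD_is_primitive s : mx_is_primitive (fun t => expmx (s + t))
  (fun t => A *m expmx (s + t)).
Proof.
by apply: eq_mx_is_primitive (expmx_is_primitive 1 s) => t _;
  rewrite mul1r addrC ?scale1r.
Qed.

(** The product has derivative 0 in t because [A] commutes with its exponential. Primitives only see
    t >= 0; [expmxN] and [expmxD] remove the sign condition. *)
Let expmx_addK s t : 0 <= t -> expmx (s + t) *m expmx (- t) = expmx s.
Proof.
move=> t0.
have H : mx_is_primitive (fun t => expmx (s + t) *m expmx (- t)) (fun=> 0).
  apply: eq_mx_is_primitive
    (mx_is_primitiveM (expmxD_is_primitive s) expmxN_is_primitive) => // r _.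
  by rewrite mulmxN mulmxA -expmx_comm subrr.
by rewrite (mx_is_primitive0 H t0) oppr0 addr0 expmx0 mulmx1.
Qed.

Lemma expmxN t : expmx t *m expmx (- t) = 1%:M.
Proof.
have H s : 0 <= s -> expmx s *m expmx (- s) = 1%:M.
  by move=> s0; rewrite -{1}(add0r s) expmx_addK// expmx0.
have [/H//|t0] := leP 0 t.
by apply: mulmx1C; rewrite -{2}(opprK t) H// oppr_ge0 ltW.
Qed.

Lemma expmxD s t : expmx (s + t) = expmx s *m expmx t.
Proof.
have [t0|t0] := leP 0 t.
  by rewrite -(expmx_addK s t0) -mulmxA (mulmx1C (expmxN t)) mulmx1.
have nt0 : 0 <= - t by rewrite oppr_ge0 ltW.
by have := expmx_addK (s + t) nt0; rewrite opprK addrK => <-.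
Qed.

End matrix_exponential.

(** * Euclidean norm *)

Section euclidean.
Context {R : realType}.

Definition dotmx n (u v : 'cV[R]_n) : R := \sum_i u i 0 * v i 0.

Lemma dotmxE n (u v : 'cV[R]_n) : dotmx u v = (u^T *m v) 0 0.
Proof. by rewrite mxE; apply: eq_bigr => i _; rewrite mxE. Qed.

Lemma dotmxC n (u v : 'cV[R]_n) : dotmx u v = dotmx v u.
Proof. by apply: eq_bigr => i _; rewrite mulrC. Qed.

Lemma dotmxDr n (u v w : 'cV[R]_n) : dotmx u (v + w) = dotmx u v + dotmx u w.
Proof. by rewrite /dotmx -big_split; apply: eq_bigr => i _; rewrite mxE mulrDr. Qed.

Lemma dotmxDl n (u v w : 'cV[R]_n) : dotmx (v + w) u = dotmx v u + dotmx w u.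
Proof. by rewrite dotmxC dotmxDr !(dotmxC u). Qed.

Lemma dotmxZr n c (u v : 'cV[R]_n) : dotmx u (c *: v) = c * dotmx u v.
Proof. by rewrite /dotmx mulr_sumr; apply: eq_bigr => i _; rewrite mxE mulrCA. Qed.

Lemma dotmxZl n c (u v : 'cV[R]_n) : dotmx (c *: u) v = c * dotmx u v.
Proof. by rewrite dotmxC dotmxZr dotmxC. Qed.

Lemma dotmxNr n (u v : 'cV[R]_n) : dotmx u (- v) = - dotmx u v.
Proof. by rewrite -scaleN1r dotmxZr mulN1r. Qed.

Lemma dotmxNl n (u v : 'cV[R]_n) : dotmx (- u) v = - dotmx u v.
Proof. by rewrite dotmxC dotmxNr dotmxC. Qed.

Lemma dotmxBr n (u v w : 'cV[R]_n) : dotmx u (v - w) = dotmx u v - dotmx u w.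
Proof. by rewrite dotmxDr dotmxNr. Qed.

Lemma dotmxBl n (u v w : 'cV[R]_n) : dotmx (v - w) u = dotmx v u - dotmx w u.
Proof. by rewrite dotmxDl dotmxNl. Qed.

Lemma dotmx0r n (u : 'cV[R]_n) : dotmx u 0 = 0.
Proof. by rewrite -(scale0r 0) dotmxZr mul0r. Qed.

Lemma dotmx0l n (u : 'cV[R]_n) : dotmx 0 u = 0.
Proof. by rewrite dotmxC dotmx0r. Qed.

Lemma dotmx_mulr n m (M : 'M[R]_(n, m)) (u : 'cV[R]_n) (v : 'cV[R]_m) :
  dotmx u (M *m v) = dotmx (M^T *m u) v.
Proof. by rewrite !dotmxE trmx_mul trmxK mulmxA. Qed.

Lemma dotmx_delta n (u : 'cV[R]_n) i : dotmx u (delta_mx i 0) = u i 0.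
Proof.
rewrite /dotmx (bigD1 i)//= big1 => [|j ji]; rewrite mxE ?eqxx ?mulr1 ?addr0//.
by rewrite (negbTE ji) mulr0.
Qed.

Lemma enorm_ge0 n (u : 'cV[R]_n) : 0 <= enorm u.
Proof. exact: sqrtr_ge0. Qed.

Lemma sqr_enorm n (u : 'cV[R]_n) : enorm u ^+ 2 = dotmx u u.
Proof.
rewrite sqr_sqrtr; first by apply: eq_bigr => i _; rewrite expr2.
by apply: sumr_ge0 => i _; exact: sqr_ge0.
Qed.

Lemma dotmx_ge0 n (u : 'cV[R]_n) : 0 <= dotmx u u.
Proof. by rewrite -sqr_enorm sqr_ge0. Qed.

Lemma enormE n (u : 'cV[R]_n) : enorm u = Num.sqrt (dotmx u u).
Proof. by rewrite -sqr_enorm sqrtr_sqr ger0_norm// enorm_ge0. Qed.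

Lemma dotmx_eq0 n (u : 'cV[R]_n) : (dotmx u u == 0) = (u == 0).
Proof.
apply/eqP/eqP => [|->]; last by rewrite dotmx0l.
move/eqP; rewrite psumr_eq0 => [/allP H|i _]; last by rewrite -expr2 sqr_ge0.
apply/matrixP => i j; rewrite (ord1 j) mxE; apply/eqP.
by have := H i (mem_index_enum _); rewrite mulf_eq0 orbb.
Qed.

Lemma enorm_eq0 n (u : 'cV[R]_n) : (enorm u == 0) = (u == 0).
Proof. by rewrite -dotmx_eq0 -sqr_enorm sqrf_eq0. Qed.

Lemma enorm_gt0 n (u : 'cV[R]_n) : (0 < enorm u) = (u != 0).
Proof. by rewrite lt_def enorm_eq0 enorm_ge0 andbT. Qed.

Lemma enorm0 n : enorm (0 : 'cV[R]_n) = 0.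
Proof. by apply/eqP; rewrite enorm_eq0. Qed.

Lemma enormZ n c (u : 'cV[R]_n) : enorm (c *: u) = `|c| * enorm u.
Proof.
by rewrite !enormE dotmxZl dotmxZr mulrA -expr2 sqrtrM ?sqr_ge0// sqrtr_sqr.
Qed.

Lemma enormN n (u : 'cV[R]_n) : enorm (- u) = enorm u.
Proof. by rewrite -scaleN1r enormZ normrN1 mul1r. Qed.

Lemma dotmx_le n (u v : 'cV[R]_n) : dotmx u v <= enorm u * enorm v.
Proof.
have [->|u0] := eqVneq u 0; first by rewrite dotmx0l enorm0 mul0r.
have [->|v0] := eqVneq v 0; first by rewrite dotmx0r enorm0 mulr0.
have a0 : 0 < enorm u by rewrite enorm_gt0.
have b0 : 0 < enorm v by rewrite enorm_gt0.
have := dotmx_ge0 (enorm v *: u - enorm u *: v).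
rewrite dotmxBl !dotmxBr !dotmxZl !dotmxZr -!sqr_enorm (dotmxC v u).
move: (enorm u) (enorm v) (dotmx u v) a0 b0 => a b d a0 b0.
have -> : b * (b * a ^+ 2) - b * (a * d) - (a * (b * d) - a * (a * b ^+ 2)) =
  (2 * (a * b)) * (a * b - d) by ring.
by rewrite pmulr_rge0 ?subr_ge0// !mulr_gt0.
Qed.

Lemma normr_dotmx_le n (u v : 'cV[R]_n) : `|dotmx u v| <= enorm u * enorm v.
Proof.
by rewrite ler_norml dotmx_le andbT lerNl -dotmxNl (le_trans (dotmx_le _ _))// enormN.
Qed.

Lemma ler_enormD n (u v : 'cV[R]_n) : enorm (u + v) <= enorm u + enorm v.
Proof.
rewrite -(@ler_pXn2r _ 2)// ?nnegrE ?addr_ge0 ?enorm_ge0//.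
rewrite sqr_enorm dotmxDl !dotmxDr (dotmxC v u) -!sqr_enorm sqrrD.
have := dotmx_le u v; lra.
Qed.

Lemma ler_entry_enorm n (u : 'cV[R]_n) i : `|u i 0| <= enorm u.
Proof.
rewrite -dotmx_delta (le_trans (normr_dotmx_le _ _))//.
rewrite [X in _ * X](_ : _ = 1) ?mulr1// enormE dotmx_delta.
by rewrite mxE !eqxx sqrtr1.
Qed.

(** The inverse of 0 being 0, the zero vector is sent to 0; hence the norm never exceeds 1, even at
    the zeros of a switching function. *)
Definition normalize n (u : 'cV[R]_n) : 'cV[R]_n := (enorm u)^-1 *: u.

Lemma dotmx_normalize n (u : 'cV[R]_n) : dotmx u (normalize u) = enorm u.
Proof.
rewrite dotmxZr -sqr_enorm; have [->|] := eqVneq (enorm u) 0.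
  by rewrite invr0 mul0r.
by move=> u0; rewrite expr2 mulKf.
Qed.

Lemma enorm_normalize n (u : 'cV[R]_n) : u != 0 -> enorm (normalize u) = 1.
Proof.
rewrite -enorm_eq0 => u0; rewrite enormZ ger0_norm ?invr_ge0 ?enorm_ge0//.
by rewrite mulVf.
Qed.

Lemma enorm_normalize_le1 n (u : 'cV[R]_n) : enorm (normalize u) <= 1.
Proof.
have [->|/enorm_normalize->//] := eqVneq u 0.
by rewrite /normalize scaler0 enorm0.
Qed.

Lemma normalizeZ n c (u : 'cV[R]_n) : 0 < c -> normalize (c *: u) = normalize u.
Proof.
move=> c0; rewrite /normalize enormZ gtr0_norm// invfM scalerA mulrAC.
by rewrite mulVf ?mul1r// gt_eqF.
Qed.

(** Equality case of Cauchy-Schwarz: the squared norm of v + |v| u is - |v|^2 (1 - |u|^2), hence 0.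
    The form without division covers v = 0. *)
Lemma dotmx_eq_oppr n (u v : 'cV[R]_n) : enorm u <= 1 -> dotmx v u = - enorm v ->
  v = - enorm v *: u.
Proof.
move=> u1 vu; apply/eqP; rewrite -subr_eq0 -dotmx_eq0 eq_le dotmx_ge0 andbT.
rewrite scaleNr opprK dotmxDl !dotmxDr !dotmxZl !dotmxZr (dotmxC u v) vu -!sqr_enorm.
have := enorm_ge0 u; have := enorm_ge0 v.
move: (enorm u) (enorm v) u1 => a b a1 b0 a0.
have -> : b ^+ 2 + b * - b + (b * - b + b * (b * a ^+ 2)) = - (b ^+ 2 * (1 - a ^+ 2)) by ring.
by rewrite oppr_le0 mulr_ge0 ?sqr_ge0// subr_ge0 expr_le1.
Qed.

End euclidean.

(** * Limits and measurability of Euclidean quantities *)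

Section euclidean_functions.
Context {R : realType}.

Lemma cvg_mx T (F : set_system T) {FF : Filter F} m n (f : T -> 'M[R]_(m, n)) (l : 'M[R]_(m, n)) :
  (forall i j, f t i j @[t --> F] --> l i j) -> f t @[t --> F] --> l.
Proof.
move=> fl; apply/cvg_ballP => e e0.
have H : \forall t \near F, forall ij, ball (l ij.1 ij.2) e (f t ij.1 ij.2).
  by apply: filter_forall => -[i j]/=; have /cvg_ballP := fl i j; apply.
by apply: filterS H => t Ht; split=> // i j; exact: (Ht (i, j)).
Qed.

Lemma cvg_mx_entry T (F : set_system T) {FF : Filter F} m n
    (f : T -> 'M[R]_(m, n)) (l : 'M[R]_(m, n)) i j :
  f t @[t --> F] --> l -> f t i j @[t --> F] --> l i j.
Proof.
move=> fl; apply: (cvg_comp _ (fun M : 'M[R]_(m, n) => M i j) fl).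
exact: coord_continuous.
Qed.

Lemma cvg_sumr T (F : set_system T) {FF : Filter F} (I : finType) (f : I -> T -> R)
    (l : I -> R) : (forall i, f i t @[t --> F] --> l i) ->
  \sum_i f i t @[t --> F] --> \sum_i l i.
Proof. by move=> fl; apply: cvg_big => //; exact: add_continuous. Qed.

Lemma cvg_mulmx T (F : set_system T) {FF : Filter F} m n p
    (f : T -> 'M[R]_(m, n)) (g : T -> 'M[R]_(n, p))
    (a : 'M[R]_(m, n)) (b : 'M[R]_(n, p)) :
  f t @[t --> F] --> a -> g t @[t --> F] --> b -> f t *m g t @[t --> F] --> a *m b.
Proof.
move=> fa gb; apply: cvg_mx => i j; rewrite mxE.
under eq_cvg do rewrite mxE.
by apply: cvg_sumr => k; apply: cvgM; exact: cvg_mx_entry.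
Qed.

Lemma cvg_trmx T (F : set_system T) {FF : Filter F} m n
    (f : T -> 'M[R]_(m, n)) (a : 'M[R]_(m, n)) :
  f t @[t --> F] --> a -> (f t)^T @[t --> F] --> a^T.
Proof.
move=> fa; apply: cvg_mx => i j; rewrite mxE.
by under eq_cvg do rewrite mxE; exact: cvg_mx_entry.
Qed.

Lemma cvg_dotmx T (F : set_system T) {FF : Filter F} n (f g : T -> 'cV[R]_n)
    (a b : 'cV[R]_n) :
  f t @[t --> F] --> a -> g t @[t --> F] --> b ->
  dotmx (f t) (g t) @[t --> F] --> dotmx a b.
Proof. by move=> fa gb; apply: cvg_sumr => k; apply: cvgM; exact: cvg_mx_entry. Qed.

Lemma cvg_enorm T (F : set_system T) {FF : Filter F} n (f : T -> 'cV[R]_n)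
    (l : 'cV[R]_n) :
  f t @[t --> F] --> l -> enorm (f t) @[t --> F] --> enorm l.
Proof.
move=> fl; rewrite enormE; under eq_cvg do rewrite enormE.
apply: (cvg_comp _ (@Num.sqrt R) (cvg_dotmx fl fl)).
exact: sqrt_continuous.
Qed.

Lemma cvg_normalize T (F : set_system T) {FF : Filter F} n (f : T -> 'cV[R]_n)
    (l : 'cV[R]_n) : l != 0 ->
  f t @[t --> F] --> l -> normalize (f t) @[t --> F] --> normalize l.
Proof.
move=> l0 fl; apply: cvgZ => //; apply: cvgV; first by rewrite enorm_eq0.
exact: cvg_enorm.
Qed.

Lemma locally_bounded_dotmx n (Z W : R -> 'cV[R]_n) :
  mx_locally_bounded Z -> mx_locally_bounded W ->
  locally_bounded (fun t => dotmx (Z t) (W t)).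
Proof.
by move=> lZ lW; apply: locally_bounded_sum => i; exact: locally_boundedM.
Qed.

Lemma locally_bounded_enorm n (W : R -> 'cV[R]_n) :
  mx_locally_bounded W -> locally_bounded (fun t => enorm (W t)).
Proof.
move=> lW; have [mW bW] := locally_bounded_dotmx lW lW.
have -> : (fun t => enorm (W t)) = Num.sqrt \o (fun t => dotmx (W t) (W t)).
  by apply/funext => t; rewrite enormE.
split.
  apply: measurableT_comp mW; apply: continuous_measurable_fun.
  exact: sqrt_continuous.
move=> T; have [C CP] := bW T; exists (Num.sqrt C) => t tT /=.
by rewrite ger0_norm ?sqrtr_ge0// ler_wsqrtr// (le_trans (ler_norm _))// CP.
Qed.

Lemma mx_locally_bounded_normalize n (W : R -> 'cV[R]_n) :
  mx_locally_bounded W -> mx_locally_bounded (fun t => normalize (W t)).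
Proof.
move=> lW i j; have [mW _] := locally_bounded_enorm lW; have [mWi _] := lW i j.
split.
  (* The power with exponent -1 is measurable and agrees with the inverse on nonnegative reals, 0
     included. *)
  have -> : (fun t => normalize (W t) i j) = (fun t => enorm (W t) `^ (-1) * W t i j).
    by apply/funext => t; rewrite mxE powR_inv1 ?enorm_ge0.
  apply: measurable_funM => //.
  by apply: (measurableT_comp (f := fun x : R => x `^ (-1))) => //; exact: measurable_powR.
move=> T; exists 1 => t _; rewrite (ord1 j).
by rewrite (le_trans (ler_entry_enorm _ _))// enorm_normalize_le1.
Qed.

End euclidean_functions.

(** * Steering and minimum time *)

Section control.
Context {R : realType} {n m : nat}.
Notation mu := (@lebesgue_measure R).
Variables (A : 'M[R]_n) (B : 'M[R]_(n, m)).
Implicit Types (u v : R -> 'cV[R]_m) (x : 'cV[R]_n) (T t eps : R).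

(** A pointwise version of admissibility: the bound holds at every t >= 0 and measurability includes
    the point 0, which makes controls locally bounded. By [admissible_reaches] the same balls are
    reached. *)
Definition control u :=
  (forall i, measurable_fun (`[0, +oo[ : set R) (fun t => u t i 0)) /\
  forall t, 0 <= t -> enorm (u t) <= 1.

Lemma control_admissible u : control u -> admissible u.
Proof.
move=> [mu1 u1]; split; last by apply: aeW => t /ltW/u1.
move=> i; apply: (measurable_funS measurable_0y _ (mu1 i)) => t/=.
by rewrite !in_itv/= !andbT => /ltW.
Qed.

Lemma control_locally_bounded u : control u -> mx_locally_bounded u.
Proof.
move=> [mu1 u1] i j; rewrite (ord1 j); split=> // T; exists 1 => t /andP[t0 _].
by rewrite (le_trans (ler_entry_enorm _ _))// u1.
Qed.

Lemma controlP u : mx_locally_bounded u -> (forall t, 0 <= t -> enorm (u t) <= 1) ->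
  control u.
Proof. by move=> lu u1; split=> // i; case: (lu i 0). Qed.

Lemma admissible_control u : admissible u ->
  exists2 v, control v & forall t, 0 < t -> enorm (u t) <= 1 -> v t = u t.
Proof.
move=> [mu1 u1].
(* At positive times only values on a null set are changed, so trajectories stay the same. *)
pose v t := if (0 < t) && (enorm (u t) <= 1) then u t else 0.
exists v; last by move=> t t0 ut1; rewrite /v t0 ut1.
split; last by move=> t _; rewrite /v; case: ifPn => [/andP[]//|_]; rewrite enorm0.
move=> i; rewrite -(@measurable_fun_itv_obnd_cbndP _ 0 +oo%O).
have mS : measurable_fun (`]0, +oo[ : set R) (fun t => \sum_j u t j 0 ^+ 2).
  by apply: measurable_sum => j; exact: measurable_funX.
have mE : measurable_fun (`]0, +oo[ : set R) (fun t => enorm (u t)).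
  apply: measurableT_comp mS; apply: continuous_measurable_fun.
  exact: sqrt_continuous.
apply: (@eq_measurable_fun _ _ _ _ _
  (fun t => if enorm (u t) <= 1 then u t i 0 else 0)).
  move=> t /[!inE]/=; rewrite in_itv/= andbT /v => ->/=.
  by case: ifP => // _; rewrite mxE.
apply: measurable_fun_if => //.
- by apply: measurable_fun_ler => //; exact: measurable_cst.
- by apply: measurable_funS (mu1 i) => // t [].
Qed.

Lemma primitive0_ae_eq (f g : R -> R) t :
  measurable_fun (`]0, +oo[ : set R) f -> measurable_fun (`]0, +oo[ : set R) g ->
  {ae mu, forall s, 0 < s <= t -> f s = g s} -> primitive0 f t = primitive0 g t.
Proof.
move=> mf mg fg.
have mcc (h : R -> R) : measurable_fun (`]0, +oo[ : set R) h ->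
    measurable_fun (`[0, t] : set R) (EFin \o h).
  move=> mh; apply/measurable_EFinP.
  apply: (@measurable_funS _ _ _ _ (`[0, +oo[ : set R)).
  - exact: measurable_0y.
  - by move=> s/=; rewrite !in_itv/= andbT => /andP[].
  - by rewrite -measurable_fun_itv_obnd_cbndP.
congr fine; apply: ae_eq_integral => //; [exact: mcc|exact: mcc|].
have ae0 : {ae mu, forall t, t != 0}.
  exists [set 0]; split => //; first exact: lebesgue_measure_set1.
  by move=> s/= /negP; rewrite negbK => /eqP.
have Fmu := ae_filter_ringOfSetsType mu.
apply: (filterS2 _ _ fg ae0) => s fgs s0; rewrite /= in_itv/= => /andP[s0' st].
by rewrite fgs// lt_def s0 s0'.
Qed.

Lemma trajectory_ae_eq x u v z :
  (forall i, measurable_fun (`]0, +oo[ : set R) (fun t => u t i 0)) ->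
  (forall i, measurable_fun (`]0, +oo[ : set R) (fun t => v t i 0)) ->
  {ae mu, forall t, 0 < t -> u t = v t} ->
  trajectory A B x u z -> trajectory A B x v z.
Proof.
move=> mu1 mv uv [cz zE]; split=> // t t0 i; rewrite zE//; congr (_ + _).
have mz j : measurable_fun (`]0, +oo[ : set R) (fun s => z s j 0).
  have [mz _] : locally_bounded (fun s => z s j 0).
    apply: within_locally_bounded => s.
    by apply: cvg_mx_entry; exact: cz.
  apply: (measurable_funS measurable_0y _ mz) => s/=.
  by rewrite !in_itv/= !andbT => /ltW.
have mi (w : R -> 'cV[R]_m) :
    (forall i, measurable_fun (`]0, +oo[ : set R) (fun t => w t i 0)) ->
    measurable_fun (`]0, +oo[ : set R) (fun s => (A *m z s + B *m w s) i 0).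
  move=> mw; apply: (@eq_measurable_fun _ _ _ _ _
    (fun s => \sum_j A i j * z s j 0 + \sum_j B i j * w s j 0)).
    by move=> s _; rewrite !mxE.
  by apply: measurable_funD; apply: measurable_sum => j; apply: measurable_funM.
apply: primitive0_ae_eq; [exact: mi|exact: mi|].
have Fmu := ae_filter_ringOfSetsType mu.
by apply: filterS uv => s uvs /andP[s0 _]; rewrite uvs.
Qed.

Definition steering u T : 'cV[R]_n :=
  mx_primitive0 (fun s => expmx A (- s) *m (B *m u s)) T.

Lemma expmx_is_primitive1 : mx_is_primitive (expmx A) (fun t => A *m expmx A t).
Proof.
by apply: eq_mx_is_primitive (expmx_is_primitive A 1 0) => t _;
  rewrite mul1r addr0 ?scale1r.
Qed.

Lemma mx_locally_bounded_steering u : control u ->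
  mx_locally_bounded (fun s => expmx A (- s) *m (B *m u s)).
Proof.
move=> cu; apply: mx_locally_boundedM.
  exact: mx_is_primitive_locally_bounded (expmxN_is_primitive A).
apply: mx_locally_boundedM; first exact: mx_locally_bounded_cst.
exact: control_locally_bounded.
Qed.

(** The function exp(- t A) z(t) has derivative exp(- t A) B u(t); integrating it also shows that a
    control determines its trajectory on [0, +oo[. *)
Lemma trajectory_steering x u z T : control u -> trajectory A B x u z -> 0 <= T ->
  z T = expmx A T *m (x + steering u T).
Proof.
move=> cu [cz zE] T0.
have lz : mx_locally_bounded z.
  move=> i j; apply: within_locally_bounded => s.
  by apply: cvg_mx_entry; exact: cz.
have lw : mx_locally_bounded (fun s => A *m z s + B *m u s).
  apply: mx_locally_boundedD; apply: mx_locally_boundedM => //;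
    by [exact: mx_locally_bounded_cst|exact: control_locally_bounded].
have z0 : z 0 = x.
  apply/matrixP => i j; rewrite (ord1 j) zE// -[Rintegral _ _ _]/(primitive0 _ _).
  by rewrite primitive0_at0 addr0.
have zP : mx_is_primitive z (fun s => A *m z s + B *m u s).
  move=> i j; rewrite (ord1 j); split; first exact: lw.
  by move=> t t0; rewrite zE// z0.
have := mx_is_primitiveE (mx_is_primitiveM (expmxN_is_primitive A) zP) T0.
rewrite oppr0 expmx0 mul1mx z0 => H.
rewrite -[LHS]mul1mx -(expmxN A T) -mulmxA H; congr (_ *m (_ + _)).
apply: eq_mx_primitive0 => s _.
by rewrite mulmxDr mulNmx expmx_comm mulmxA addrA addNr add0r.
Qed.

Lemma steering_trajectory x u : control u ->
  trajectory A B x u (fun t => expmx A t *m (x + steering u t)).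
Proof.
move=> cu; set z := fun t => _.
have zP : mx_is_primitive z (fun t => A *m z t + B *m u t).
  have H1 := mx_is_primitiveD (mx_is_primitive_cst x)
    (mx_primitive0_is_primitive (mx_locally_bounded_steering cu)).
  apply: eq_mx_is_primitive (mx_is_primitiveM expmx_is_primitive1 H1) => // t _.
  by rewrite add0r (mulmxA (expmx A t)) expmxN mul1mx /z mulmxA.
split.
  by move=> s; apply: cvg_mx => i j; exact: (is_primitive_continuous (zP i j)).
move=> t t0 i; rewrite (zP i 0).2//; congr (_ + _).
rewrite /z expmx0 mul1mx /steering [X in _ + X](_ : _ = 0) ?addr0//.
by apply/matrixP => k l; rewrite !mxE primitive0_at0.
Qed.

Lemma reachesE eps x u T : control u -> 0 <= T ->
  reaches A B eps x u T <-> enorm (expmx A T *m (x + steering u T)) <= eps.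
Proof.
move=> cu T0; split=> [[z [zu ze]]|H].
  by rewrite -(trajectory_steering cu zu).
by exists (fun t => expmx A t *m (x + steering u t)); split=> //; exact: steering_trajectory.
Qed.

Lemma admissible_reaches eps x u T : admissible u -> reaches A B eps x u T ->
  exists v, [/\ control v, reaches A B eps x v T &
    forall t, 0 < t -> enorm (u t) <= 1 -> v t = u t].
Proof.
move=> au [z [zu ze]]; have [v cv vu] := admissible_control au.
exists v; split=> //; exists z; split=> //.
apply: trajectory_ae_eq zu; [by case: au|by case: (control_admissible cv)|].
have Fmu := ae_filter_ringOfSetsType mu.
by case: au => _; apply: filterS => t ut t0; rewrite vu// ut.
Qed.

End control.

(** * Switching functions and bounds on the minimum time *)

Section minimum_time.
Context {R : realType} {n m : nat}.
Notation mu := (@lebesgue_measure R).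
Variables (A : 'M[R]_n) (B : 'M[R]_(n, m)).
Implicit Types (u v : R -> 'cV[R]_m) (x p q : 'cV[R]_n) (T t s eps : R).

(* The switching function: B^T applied to the solution exp(- t A^T) p of the
   adjoint equation p' = - A^T p. *)
Definition adjoint p t : 'cV[R]_m := B^T *m ((expmx A (- t))^T *m p).

(* The support function, at p, of the set of the states that can be steered
   to the origin in time T. *)
Definition support p T : R := primitive0 (fun s => enorm (adjoint p s)) T.

Lemma expmx_cvg (T : Type) (F : set_system T) (FF : Filter F) (f : T -> R) t :
  f s @[s --> F] --> t -> expmx A (f s) @[s --> F] --> expmx A t.
Proof.
move=> ft; apply: cvg_mx => i j.
by apply: (cvg_comp _ (fun t => expmx A t i j) ft); exact: expmx_continuous.
Qed.

Lemma adjoint_cvg (T : Type) (F : set_system T) (FF : Filter F)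
    (f : T -> R) (g : T -> 'cV[R]_n) t p :
  f s @[s --> F] --> t -> g s @[s --> F] --> p ->
  adjoint (g s) (f s) @[s --> F] --> adjoint p t.
Proof.
move=> ft gp; apply: cvg_mulmx; first exact: cvg_cst.
by apply: cvg_mulmx => //; apply: cvg_trmx; apply: expmx_cvg; exact: cvgN.
Qed.

Lemma adjoint_continuous p : continuous (adjoint p).
Proof. by move=> t; apply: adjoint_cvg; [exact: cvg_id|exact: cvg_cst]. Qed.

Lemma mx_locally_bounded_adjoint p : mx_locally_bounded (adjoint p).
Proof.
move=> i j; apply: continuous_locally_bounded => t.
by apply: cvg_mx_entry; exact: adjoint_continuous.
Qed.

Lemma locally_bounded_enorm_adjoint p : locally_bounded (fun s => enorm (adjoint p s)).
Proof. exact/locally_bounded_enorm/mx_locally_bounded_adjoint. Qed.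

Lemma adjointD p q t : adjoint (p + q) t = adjoint p t + adjoint q t.
Proof. by rewrite /adjoint !mulmxDr. Qed.

Lemma adjointZ c p t : adjoint (c *: p) t = c *: adjoint p t.
Proof. by rewrite /adjoint -!scalemxAr. Qed.

Lemma dotmx_steering p u T : control u ->
  dotmx p (steering A B u T) = primitive0 (fun s => dotmx (adjoint p s) (u s)) T.
Proof.
move=> cu; rewrite dotmxE mx_primitive0Ml; last exact: mx_locally_bounded_steering.
rewrite mxE; apply: eq_primitive0 => s _.
by rewrite -dotmxE 2!dotmx_mulr.
Qed.

Lemma locally_bounded_dotmx_adjoint p u : control u ->
  locally_bounded (fun s => dotmx (adjoint p s) (u s)).
Proof.
move=> cu; apply: locally_bounded_dotmx; first exact: mx_locally_bounded_adjoint.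
exact: control_locally_bounded cu.
Qed.

Lemma dotmx_adjoint_ge p u t : control u -> 0 <= t ->
  - enorm (adjoint p t) <= dotmx (adjoint p t) (u t).
Proof.
move=> [_ u1] t0; rewrite lerNl -dotmxNr (le_trans (dotmx_le _ _))// enormN.
by rewrite ler_piMr ?enorm_ge0// u1.
Qed.

Lemma dotmx_steering_ge p u T : control u -> 0 <= T ->
  - support p T <= dotmx p (steering A B u T).
Proof.
move=> cu T0; rewrite dotmx_steering// /support -primitive0N; last first.
  exact: locally_bounded_enorm_adjoint.
have := @primitive0_le _ _ _ 0 T
  (locally_boundedN (locally_bounded_enorm_adjoint p))
  (locally_bounded_dotmx_adjoint p cu).
rewrite !primitive0_at0 !subr0 lexx T0; apply=> // r /andP[/ltW r0 _].
exact: dotmx_adjoint_ge.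
Qed.

(** This control minimizes <f_p, u> at every time, whence the sign. *)
Definition bang p t : 'cV[R]_m := - normalize (adjoint p t).

Lemma bang_control p : control (bang p).
Proof.
apply: controlP; last by move=> t _; rewrite enormN enorm_normalize_le1.
move=> i j; have := mx_locally_bounded_normalize (mx_locally_bounded_adjoint p) i j.
by move=> /locally_boundedN; apply: eq_locally_bounded => t _; rewrite !mxE.
Qed.

Lemma dotmx_steering_bang p T : dotmx p (steering A B (bang p) T) = - support p T.
Proof.
rewrite dotmx_steering; last exact: bang_control.
rewrite /support -primitive0N; last exact: locally_bounded_enorm_adjoint.
by apply: eq_primitive0 => s _; rewrite dotmxNr dotmx_normalize.
Qed.

Lemma support_le p s t : 0 <= s <= t -> support p s <= support p t.
Proof.
move=> st; apply: primitive0_ge => //; first exact: locally_bounded_enorm_adjoint.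
by move=> r _; exact: enorm_ge0.
Qed.

Lemma min_time_le eps x u T : control u -> 0 < T ->
  enorm (expmx A T *m (x + steering A B u T)) <= eps ->
  (min_time A B eps x <= T%:E)%E.
Proof.
move=> cu T0 H; apply: ereal_inf_lbound; exists T => //; split => //.
exists u; split; first exact: control_admissible.
by apply/reachesE => //; exact: ltW.
Qed.

Lemma min_time_ge eps x (S : \bar R) :
  (forall T u, 0 < T -> control u ->
    enorm (expmx A T *m (x + steering A B u T)) <= eps -> (S <= T%:E)%E) ->
  (S <= min_time A B eps x)%E.
Proof.
move=> H; apply: le_ereal_inf_tmp => _ [T [T0 [u [au ru]]] <-].
have [v [cv rv _]] := admissible_reaches au ru.
by apply: (H T v) => //; apply/reachesE => //; exact: ltW.
Qed.

Lemma min_time_lt eps x T : (min_time A B eps x < T%:E)%E ->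
  exists S u, [/\ 0 < S < T, control u &
    enorm (expmx A S *m (x + steering A B u S)) <= eps].
Proof.
move=> /ereal_inf_lt[_ [S [S0 [u [au ru]]] <-]]; rewrite lte_fin => ST.
have [v [cv rv _]] := admissible_reaches au ru.
by exists S, v; rewrite S0 ST; split=> //; apply/reachesE => //; exact: ltW.
Qed.

End minimum_time.

(** * The isotropic case *)

Section isotropic.
Context {R : realType}.
Notation mu := (@lebesgue_measure R).

Lemma expR_is_primitive (c : R) : is_primitive (fun t => expR (c * t))
  (fun t => c * expR (c * t)).
Proof.
have H (t : R) : is_derive t 1 (fun t => expR (c * t)) (c * expR (c * t)).
  have H2 : is_derive t 1 (fun t => c * t) c.
    by apply: is_derive_eq; rewrite [LHS]mulr1.
  have := is_derive1_comp (f := expR) (is_derive_expR (c * t)) H2.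
  by rewrite [expR _ * c]mulrC.
have cE : continuous (fun t => expR (c * t)).
  move=> t; apply: (@continuous_comp _ _ _ (fun t => c * t) expR).
    by apply: cvgM; [exact: cvg_cst|exact: cvg_id].
  exact: continuous_expR.
apply: derive_is_primitive => // t.
by apply: cvgM; [exact: cvg_cst|exact: cE].
Qed.

(** T is the time that rho' = a rho - b takes from r down to eps, by separation of variables; the
    second conjunct is the variation of constants formula for rho(T) = eps, solved for r. *)
Lemma descent_time (a b eps r : R) : a <= 0 -> 0 < b -> 0 <= eps < r ->
  let T := Rintegral mu `[eps, r] (fun xi => (b - a * xi)^-1) in
  0 < T /\ r = eps * expR (- a * T) + b * primitive0 (fun s => expR (- a * s)) T.
Proof.
move=> a0 b0 /andP[e0 er] T.
have pos (xi : R) : 0 <= xi -> 0 < b - a * xi.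
  by move=> xi0; rewrite subr_gt0 (le_lt_trans _ b0)// mulr_le0_ge0.
have cint : {within `[eps, r], continuous (fun xi => (b - a * xi)^-1)}.
  apply: continuous_in_subspaceT => xi; rewrite inE/= in_itv/= => /andP[exi _].
  apply: cvgV; first by rewrite gt_eqF// pos// (le_trans e0).
  by apply: cvgB; [exact: cvg_cst|apply: cvgM; [exact: cvg_cst|exact: cvg_id]].
(* The logarithmic primitive of the other case divides by a. *)
have [a0'|an0] := eqVneq a 0.
  have TE : T = (r - eps) / b.
    rewrite /T a0'; under eq_Rintegral do rewrite mul0r subr0.
    rewrite Rintegral_cst//= lebesgue_measure_itv/= lte_fin er -EFinB/=.
    by rewrite mulrC.
  have T0 : 0 < T by rewrite TE divr_gt0// subr_gt0.
  split=> //; rewrite a0' oppr0 mul0r expR0 mulr1.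
  rewrite (@eq_primitive0 _ _ (fun=> 1)); last by move=> s _; rewrite mul0r expR0.
  by rewrite primitive0_cst ?ltW// mul1r TE mulrC divfK ?gt_eqF// addrC subrK.
have TE : T = (ln (b - a * r) - ln (b - a * eps)) / - a.
  pose F (xi : R) : R := - a^-1 * ln (b - a * xi).
  have dF (xi : R) : 0 <= xi -> is_derive xi 1 F (b - a * xi)^-1.
    move=> xi0.
    have H1 : is_derive xi 1 (fun xi : R => b - a * xi) (- a).
      by apply: is_derive_eq; rewrite add0r mul1r [_ *: _]mulr1.
    have H2 := is_derive1_comp (f := @ln R) (g := fun xi : R => b - a * xi)
      (is_derive1_ln (pos _ xi0)) H1.
    have H3 := is_deriveZ (- a^-1) H2.
    apply: is_derive_eq.
    rewrite [LHS]mulrCA mulrNN mulVf// mulr1//.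
  rewrite /T /Rintegral (@continuous_FTC2 _ _ F)//.
  - by rewrite -EFinB/= /F invrN; ring.
  - split.
    + by move=> xi; rewrite in_itv/= => /andP[exi _]; have [] := dF xi (le_trans e0 (ltW exi)).
    + apply: cvg_at_right_filter; apply: differentiable_continuous.
      by apply/derivable1_diffP; have [] := dF eps e0.
    + apply: cvg_at_left_filter; apply: differentiable_continuous.
      by apply/derivable1_diffP; have [] := dF r (le_trans e0 (ltW er)).
  - move=> xi; rewrite in_itv/= => /andP[exi _]; rewrite derive1E.
    by have [] := dF xi (le_trans e0 (ltW exi)).
have r0 : 0 <= r by rewrite (le_trans e0)// ltW.
have Na0 : 0 < - a by rewrite oppr_gt0 lt_def eq_sym an0.
have T0 : 0 < T.
  rewrite TE divr_gt0// subr_gt0 ltr_ln ?posrE ?pos//.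
  by rewrite ltrD2l ltrN2 ltr_nM2l// -oppr_gt0.
split=> //.
have eE : expR (- a * T) = (b - a * r) / (b - a * eps).
  rewrite TE mulrC divfK ?gt_eqF// expRD expRN !lnK ?posrE ?pos//.
have [lE PE] := expR_is_primitive (- a).
have := PE T (ltW T0); rewrite primitive0Z; last first.
  exact: is_primitive_locally_bounded (expR_is_primitive (- a)).
rewrite mulr0 expR0 eE => H.
have -> : primitive0 (fun s => expR (- a * s)) T = ((b - a * r) / (b - a * eps) - 1) / - a.
  by rewrite H [1 + _]addrC addrK mulrAC divff ?mul1r// gt_eqF.
have := pos _ e0 => /lt0r_neq0 n0.
by field; rewrite an0 n0.
Qed.


Lemma mx_is_primitiveZ p q (F f : R -> R) (Z W : R -> 'M[R]_(p, q)) :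
  is_primitive F f -> mx_is_primitive Z W ->
  mx_is_primitive (fun t => F t *: Z t) (fun t => f t *: Z t + F t *: W t).
Proof.
move=> Ff ZW i j; apply: eq_is_primitive (is_primitiveM Ff (ZW i j)) => t _;
  by rewrite !mxE.
Qed.

Context {n m : nat}.
Variables (A : 'M[R]_n) (B : 'M[R]_(n, m)) (a b : R).
Hypothesis A_skew : A + A^T = (2 * a)%:M.
Hypothesis B_iso : B *m B^T = (b ^+ 2)%:M.
Hypothesis (a_le0 : a <= 0) (b_gt0 : 0 < b).

(** With E = exp(t A), the derivative of E^T E is E^T (A^T + A) E = 2 a E^T E; so E is e^(a t) times
    an orthogonal matrix. *)
Lemma expmx_tr_mul t : 0 <= t -> (expmx A t)^T *m expmx A t = (expR (2 * a * t))%:M.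
Proof.
move=> t0.
have HE := expmx_is_primitive1 A.
have HET : mx_is_primitive (fun t => (expmx A t)^T) (fun t => (expmx A t)^T *m A^T).
  by move=> i j; apply: eq_is_primitive (HE j i) => s _; rewrite -?trmx_mul [RHS]mxE.
have H : mx_is_primitive
    (fun t => expR (- (2 * a) * t) *: ((expmx A t)^T *m expmx A t)) (fun=> 0).
  apply: eq_mx_is_primitive (mx_is_primitiveZ (expR_is_primitive (- (2 * a)))
    (mx_is_primitiveM HET HE)) => // s _.
  rewrite -mulmxA (mulmxA _ A) -mulmxA -mulmxDr -mulmxDl [A^T + A]addrC A_skew.
  rewrite mul_scalar_mx -scalemxAr scalerA -scalerDl.
  by rewrite mulNr [expR _ * _]mulrC addNr scale0r.
have := mx_is_primitive0 H t0.
rewrite mulr0 expR0 scale1r expmx0 trmx1 mul1mx => /(congr1 (fun M => expR (2 * a * t) *: M)).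
by rewrite scalerA -expRD mulNr subrr expR0 scale1r scalemx1.
Qed.

Lemma expmxN_tr t : 0 <= t -> (expmx A (- t))^T = expR (- (2 * a) * t) *: expmx A t.
Proof.
move=> /expmx_tr_mul/(congr1 (fun M => expR (- (2 * a) * t) *: ((expmx A (- t))^T *m M))).
rewrite mulmxA -trmx_mul expmxN trmx1 mul1mx => ->.
rewrite -scalemx1 -scalemxAr mulmx1 scalerA -expRD mulNr addNr expR0 scale1r//.
Qed.

Lemma enorm_expmx t x : 0 <= t -> enorm (expmx A t *m x) = expR (a * t) * enorm x.
Proof.
move=> t0; rewrite !enormE dotmx_mulr mulmxA expmx_tr_mul// mul_scalar_mx dotmxZl.
rewrite sqrtrM ?expR_ge0//; congr (_ * _).
rewrite -mulrA -[X in expR (X * _)]/(2%:R) mulr_natl mulr2n expRD -expr2 sqrtr_sqr.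
by rewrite ger0_norm ?expR_ge0.
Qed.

Lemma adjoint_isotropic x t : 0 <= t ->
  adjoint A B x t = expR (- (2 * a) * t) *: (B^T *m (expmx A t *m x)).
Proof. by move=> t0; rewrite /adjoint expmxN_tr// -scalemxAl -scalemxAr. Qed.

Lemma enorm_mulmx_tr (x : 'cV[R]_n) : enorm (B^T *m x) = b * enorm x.
Proof.
rewrite !enormE dotmx_mulr trmxK mulmxA B_iso mul_scalar_mx dotmxZl.
by rewrite sqrtrM ?sqr_ge0// sqrtr_sqr gtr0_norm.
Qed.

Lemma enorm_adjoint_isotropic x t : 0 <= t ->
  enorm (adjoint A B x t) = b * enorm x * expR (- a * t).
Proof.
move=> t0; rewrite adjoint_isotropic// enormZ ger0_norm ?expR_ge0//.
rewrite enorm_mulmx_tr enorm_expmx//.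
have -> : - a * t = - (2 * a) * t + a * t by ring.
by rewrite expRD; ring.
Qed.

Let P T := primitive0 (fun s => expR (- a * s)) T.

Lemma support_isotropic x T : support A B x T = b * enorm x * P T.
Proof.
rewrite /P -primitive0Z; last exact: is_primitive_locally_bounded (expR_is_primitive _).
by apply: eq_primitive0 => s /andP[s0 _]; rewrite enorm_adjoint_isotropic.
Qed.

(** As exp(- s A) B B^T exp(- s A^T) is the scalar b^2 e^(- 2 a s), the integrand exp(- s A) B u(s)
    equals - (b / |x|) e^(- a s) x. *)
Lemma steering_isotropic x T : x != 0 ->
  steering A B (bang A B x) T = - (b / enorm x * P T) *: x.
Proof.
rewrite -enorm_gt0 => x0; apply/matrixP => i j; rewrite !mxE /P -mulNr.
rewrite [X in _ = X * _]mulNr mulNr -mulrA -mulrN.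
rewrite [primitive0 _ _ * _]mulrC.
have lE := is_primitive_locally_bounded (expR_is_primitive (- a)).
rewrite mulrN -mulNr mulrA -primitive0Z//.
apply: eq_primitive0 => s /andP[s0 _].
rewrite /bang /normalize enorm_adjoint_isotropic// adjoint_isotropic//.
rewrite !mulmxN -!scalemxAr (mulmxA B) B_iso mul_scalar_mx -!scalemxAr.
rewrite (mulmxA (expmx A (- s))) (mulmx1C (expmxN A s)) mul1mx !mxE.
have -> : - (2 * a) * s = - a * s + - a * s by ring.
rewrite expRD.
have := expR_gt0 (- a * s) => /lt0r_neq0.
move: x0 => /lt0r_neq0; have := lt0r_neq0 b_gt0.
move: (expR _) (enorm x) (x i j) => e c y b0 c0 e0.
by field; rewrite c0 b0 e0.
Qed.

Lemma min_time_isotropic x eps : x != 0 -> 0 <= eps < enorm x ->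
  min_time A B eps x = (Rintegral mu `[eps, enorm x] (fun xi => (b - a * xi)^-1))%:E.
Proof.
move=> x0 er; have [e0 ex] := andP er.
have [T0] := descent_time a_le0 b_gt0 er.
set T1 := Rintegral _ _ _ in T0 * => xE.
have c0 : 0 < enorm x by rewrite enorm_gt0.
apply/eqP; rewrite eq_le; apply/andP; split.
  apply: (min_time_le (bang_control A B x)) => //.
  rewrite steering_isotropic// -{1}(scale1r x) -scalerDl -scalemxAr enormZ.
  rewrite enorm_expmx ?(ltW T0)//.
  have -> : 1 - b / enorm x * P T1 = (enorm x)^-1 * (enorm x - b * P T1).
    by field; rewrite gt_eqF.
  have -> : enorm x - b * P T1 = eps * expR (- a * T1) by rewrite {1}xE /P addrK.
  rewrite ger0_norm; last by rewrite mulr_ge0 ?invr_ge0 ?enorm_ge0// mulr_ge0 ?expR_ge0.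
  set u := expR (a * T1); have u0 : u != 0 by rewrite gt_eqF ?expR_gt0.
  have -> : expR (- a * T1) = u^-1 by rewrite mulNr expRN.
  by rewrite le_eqVlt; apply/orP; left; apply/eqP; field; rewrite u0 gt_eqF.
apply: min_time_ge => T u T0' cu H; rewrite lee_fin leNgt; apply/negP => TT1.
pose y := expmx A T *m (x + steering A B u T).
have yE : x + steering A B u T = expmx A (- T) *m y.
  by rewrite /y mulmxA (mulmx1C (expmxN A T)) mul1mx.
have := dotmx_steering_ge A B x cu (ltW T0').
have -> : steering A B u T = expmx A (- T) *m y - x by rewrite -yE addrC addKr.
rewrite dotmxBr -sqr_enorm dotmx_mulr support_isotropic expmxN_tr ?(ltW T0')//.
have := dotmx_le ((expR (- (2 * a) * T) *: expmx A T) *m x) y.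
set d := dotmx _ _ => d1 d2.
have {}d1 : d <= enorm x * expR (- a * T) * eps.
  rewrite (le_trans d1)// -scalemxAl enormZ ger0_norm ?expR_ge0// enorm_expmx ?(ltW T0')//.
  have -> : - a * T = - (2 * a) * T + a * T by ring.
  rewrite expRD [leLHS](_ : _ =
    enorm x * (expR (- (2 * a) * T) * expR (a * T)) * enorm y); last by ring.
  by rewrite ler_wpM2l// !mulr_ge0 ?enorm_ge0 ?expR_ge0.
(* For T < T1 this contradicts [descent_time], because the right-hand side is strictly increasing in
   T: by e^(- a T) = 1 - a P(T), it is affine in P(T) with slope b - a eps > 0. *)
have {d1 d2} : enorm x <= eps * expR (- a * T) + b * P T.
  rewrite -(ler_pM2l c0) -expr2; rewrite -/(P T) in d2 *; lra.
rewrite leNgt => /negP; apply; rewrite [ltRHS]xE.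
rewrite -subr_gt0.
have [lE HE] := expR_is_primitive (- a).
have lE' := is_primitive_locally_bounded (expR_is_primitive (- a)).
have PE t : 0 <= t -> expR (- a * t) = 1 + - a * P t.
  by move=> t0; rewrite HE// mulr0 expR0 primitive0Z.
have TT : 0 <= T <= T1 by rewrite !ltW.
have := @primitive0_le _ _ _ T T1 (locally_bounded_cst 1) lE' TT.
rewrite !primitive0_cst ?(ltW T0) ?(ltW T0')// -/(P T) -/(P T1) !mul1r => PT.
have {}PT : T1 - T <= P T1 - P T.
  apply: PT => r /andP[Tr _]; rewrite -expR0 ler_expR mulr_ge0 ?oppr_ge0//.
  by rewrite (le_trans _ (ltW Tr))// ltW.
rewrite !PE ?ltW//.
have -> : eps * (1 + - a * P T1) + b * P T1 - (eps * (1 + - a * P T) + b * P T) =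
  (b + eps * - a) * (P T1 - P T) by ring.
rewrite mulr_gt0//; last by lra.
by rewrite ltr_pwDl// mulr_ge0// oppr_ge0.
Qed.

End isotropic.

(** * Radial value function *)

Section scalar_matrices.
Context {R : realType} {n : nat}.
Implicit Types (M W : 'M[R]_n) (p q : 'cV[R]_n).

Lemma dotmx_mul_delta M i j : dotmx (delta_mx i 0) (M *m delta_mx j 0) = M i j.
Proof.
rewrite dotmxC dotmx_delta mxE (bigD1 j)//= big1 => [|k kj]; rewrite mxE ?eqxx ?mulr1 ?addr0//.
by rewrite (negbTE kj) mulr0.
Qed.

(** Basis vectors kill the off-diagonal entries, and e_i + e_j against e_i - e_j equates the
    diagonal ones. The isotropy of B B^T and of A + A^T is reduced to this test on orthogonal
    pairs. *)
Lemma scalar_mx_perp M :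
  (forall p q, dotmx p q = 0 -> dotmx p (M *m q) = 0) -> exists c, M = c%:M.
Proof.
move=> H.
have dd i j : dotmx (delta_mx i 0) (delta_mx j 0 : 'cV[R]_n) = (i == j)%:R.
  by rewrite -[delta_mx j 0]mul1mx dotmx_mul_delta mxE.
have M0 i j : i != j -> M i j = 0.
  by move=> ij; rewrite -dotmx_mul_delta H// dd (negbTE ij).
have Md i j : M i i = M j j.
  have [->//|ij] := eqVneq i j.
  have ji : j != i by rewrite eq_sym.
  have pq0 : dotmx (delta_mx i 0 + delta_mx j 0) (delta_mx i 0 - delta_mx j 0 : 'cV[R]_n) = 0.
    rewrite !(dotmxDl, dotmxBr) !dd !eqxx (negbTE ij) (negbTE ji) /=; ring.
  have := H _ _ pq0.
  rewrite mulmxBr !(dotmxDl, dotmxBr) !dotmx_mul_delta (M0 _ _ ij) (M0 _ _ ji); lra.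
case: (pickP 'I_n) => [i0 _|none].
  exists (M i0 i0); apply/matrixP => i j; rewrite mxE.
  by have [->|/M0->] := eqVneq i j; rewrite ?mulr1n ?mulr0n.
by exists 0; apply/matrixP => i; have := none i.
Qed.

(** For orthogonal p and q, the vectors p + q and p - q have equal norms, and the difference of the
    quadratic forms is 4 <p, W q>. *)
Lemma scalar_mx_norm W : W^T = W ->
  (forall p q, enorm p = enorm q -> dotmx p (W *m p) = dotmx q (W *m q)) ->
  exists c, W = c%:M.
Proof.
move=> WT H; apply: scalar_mx_perp => p q pq.
have /H : enorm (p + q) = enorm (p - q).
  rewrite !enormE !(dotmxDl, dotmxDr, dotmxNl, dotmxNr) (dotmxC q p) pq.
  by congr Num.sqrt; ring.
rewrite !(mulmxDr, mulmxN) !(dotmxDl, dotmxDr, dotmxNl, dotmxNr).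
have -> : dotmx q (W *m p) = dotmx p (W *m q).
  by rewrite dotmx_mulr WT dotmxC.
by move=> ?; lra.
Qed.

End scalar_matrices.

(** * Consequences of the rank condition *)

Section controllability.
Context {R : realType} {n m : nat}.
Variables (A : 'M[R]_n) (B : 'M[R]_(n, m)).
Hypothesis hrank : \rank (controllability_mx A B) = n.

(** The rows of the controllability matrix are independent, and the hypothesis says blockwise that
    v^T annihilates it. *)
Lemma controllability_inj (v : 'cV[R]_n) :
  (forall k, (k < n)%N -> B^T *m ((A ^+ k)^T *m v) = 0) -> v = 0.
Proof.
move=> H; apply: trmx_inj; rewrite trmx0; apply/eqP.
have rf : row_free (controllability_mx A B) by rewrite /row_free hrank.
rewrite -(mulmx_free_eq0 _ rf) /controllability_mx mul_mxrow.
apply/eqP; rewrite -[RHS](mxrow0 (q_ := fun=> m)); apply: eq_mxrow => k.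
by apply: trmx_inj; rewrite trmx0 !trmx_mul trmxK -mulmxA H.
Qed.

(** From |B^T v|^2 = c |v|^2 follows c >= 0, and c = 0 would give B = 0, against controllability. *)
Lemma isotropic_gt0 c : (0 < n)%N -> B *m B^T = c%:M -> 0 < c.
Proof.
move=> n0 Bc; pose i0 := Ordinal n0.
have cE (v : 'cV[R]_n) : dotmx (B^T *m v) (B^T *m v) = c * dotmx v v.
  by rewrite dotmx_mulr trmxK mulmxA Bc mul_scalar_mx dotmxZl.
have d1 : dotmx (delta_mx i0 0) (delta_mx i0 0) = 1 :> R.
  by rewrite dotmx_delta mxE !eqxx.
have c0 : 0 <= c by rewrite -[c]mulr1 -d1 -cE dotmx_ge0.
rewrite lt_def c0 andbT; apply/eqP => c00.
have B0 : B^T = 0.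
  apply/matrixP => i j; rewrite [RHS]mxE.
  have /eqP : dotmx (B^T *m delta_mx j 0) (B^T *m delta_mx j 0) = 0 by rewrite cE c00 mul0r.
  rewrite dotmx_eq0 => /eqP/matrixP/(_ i 0); rewrite [RHS]mxE => <-.
  rewrite [RHS]mxE (bigD1 j)//= big1 => [|k kj];
    rewrite [delta_mx _ _ _ _]mxE ?eqxx ?mulr1 ?addr0//.
  by rewrite (negbTE kj) mulr0.
have /matrixP/(_ i0 0) : (delta_mx i0 0 : 'cV[R]_n) = 0.
  by apply: controllability_inj => k _; rewrite B0 mul0mx.
by rewrite !mxE !eqxx => /eqP; rewrite oner_eq0.
Qed.

End controllability.

(** * The sign of the constant a *)

Section spectrum.
Context {R : realType} {n : nat}.

(** For a left eigenvector p + i q with eigenvalue l, the cross terms cancel in <p A, p> + <q A, q>,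
    which is Re l (|p|^2 + |q|^2); the scalar symmetric part makes it a (|p|^2 + |q|^2). *)
Lemma isotropic_le0 (A : 'M[R]_n) a : (0 < n)%N -> spectrum_re_le0 A ->
  A + A^T = (2 * a)%:M -> a <= 0.
Proof.
move=> n0 hspec AE.
have quad (p : 'rV[R]_n) : \sum_j (p *m A) 0 j * p 0 j = a * \sum_j p 0 j ^+ 2.
  have H1 : \sum_j (p *m A) 0 j * p 0 j = (p *m A *m p^T) 0 0.
    by rewrite [RHS]mxE; apply: eq_bigr => j _; rewrite [p^T _ _]mxE.
  have H2 : (p *m A *m p^T) 0 0 = (p *m A^T *m p^T) 0 0.
    transitivity ((p *m A *m p^T)^T 0 0); first by rewrite [RHS]mxE.
    by rewrite !trmx_mul trmxK mulmxA.
  have H3 : (p *m A *m p^T) 0 0 + (p *m A^T *m p^T) 0 0 = (2 * a) * \sum_j p 0 j ^+ 2.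
    transitivity ((p *m A *m p^T + p *m A^T *m p^T) 0 0); first by rewrite [RHS]mxE.
    rewrite -mulmxDl -mulmxDr AE mul_mx_scalar -scalemxAl mxE; congr (_ * _).
    by rewrite mxE; apply: eq_bigr => j _; rewrite mxE expr2.
  rewrite H1; rewrite -H2 in H3; lra.
pose Ac := map_mx (real_complex R) A.
have [l rl] : exists l : R[i], root (char_poly Ac) l.
  by apply/closed_rootP; rewrite size_char_poly eqSS -lt0n.
have ev : eigenvalue Ac l by rewrite eigenvalue_root_char.
have lre := hspec _ ev.
have [v vA v0] := eigenvalueP ev.
pose p := map_mx (@complex.Re R) v; pose q := map_mx (@complex.Im R) v.
have Resum (F : 'I_n -> R[i]) : complex.Re (\sum_k F k) = \sum_k complex.Re (F k).
  by apply: (big_morph (@complex.Re R)) => [[? ?] [? ?]|].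
have Imsum (F : 'I_n -> R[i]) : complex.Im (\sum_k F k) = \sum_k complex.Im (F k).
  by apply: (big_morph (@complex.Im R)) => [[? ?] [? ?]|].
have pA j : (p *m A) 0 j = complex.Re l * p 0 j - complex.Im l * q 0 j.
  have /matrixP/(_ 0 j)/(congr1 (@complex.Re R)) := vA.
  rewrite !mxE Resum => H.
  transitivity (complex.Re (l * v 0 j)); last by clear; case: l (v 0 j) => [? ?] [? ?].
  rewrite -H; apply: eq_bigr => k _; rewrite !mxE.
  by case: (v 0 k) => x y /=; rewrite mulr0 subr0.
have qA j : (q *m A) 0 j = complex.Re l * q 0 j + complex.Im l * p 0 j.
  have /matrixP/(_ 0 j)/(congr1 (@complex.Im R)) := vA.
  rewrite !mxE Imsum => H.
  transitivity (complex.Im (l * v 0 j)); last by clear; case: l (v 0 j) => [? ?] [? ?].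
  rewrite -H; apply: eq_bigr => k _; rewrite !mxE.
  by case: (v 0 k) => x y /=; rewrite mulr0 add0r mulrC.
have S : a * (\sum_j p 0 j ^+ 2 + \sum_j q 0 j ^+ 2) =
    complex.Re l * (\sum_j p 0 j ^+ 2 + \sum_j q 0 j ^+ 2).
  rewrite mulrDr -!quad -!big_split/= mulr_sumr.
  by apply: eq_bigr => j _; rewrite pA qA; ring.
have sq0 (w : 'rV[R]_n) : 0 <= \sum_j w 0 j ^+ 2 by apply: sumr_ge0 => j _; exact: sqr_ge0.
have pq : 0 < \sum_j p 0 j ^+ 2 + \sum_j q 0 j ^+ 2.
  rewrite lt_def addr_ge0// andbT; apply: contra v0.
  rewrite paddr_eq0// !psumr_eq0 => [/andP[/allP p0 /allP q0]|i _|i _]; try exact: sqr_ge0.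
  apply/eqP/matrixP => i j; rewrite (ord1 i) mxE.
  have := p0 j (mem_index_enum _); have := q0 j (mem_index_enum _).
  by rewrite !sqrf_eq0 !mxE; case: (v 0 j) => x y /= /eqP -> /eqP ->.
by rewrite (mulIf (lt0r_neq0 pq) S).
Qed.

End spectrum.

(** * Isotropy from a radial value function *)

Section radial_value.
Context {R : realType}.
Notation mu := (@lebesgue_measure R).

(** If f - g were nonzero at t, its integral over a short interval to the right of t could not
    vanish. Looking to the right includes t = 0, where [radial_isotropic] needs the conclusion. *)
Lemma primitive0_inj (f g : R -> R) : continuous f -> continuous g ->
  (forall t, 0 <= t -> primitive0 f t = primitive0 g t) ->
  forall t, 0 <= t -> f t = g t.
Proof.
move=> cf cg fg t t0; apply/eqP; rewrite -subr_eq0; apply/negPn/negP => d0.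
pose h s := f s - g s.
have ch : continuous h by move=> s; apply: cvgB; [exact: cf|exact: cg].
have lf := continuous_locally_bounded cf; have lg := continuous_locally_bounded cg.
have lh := continuous_locally_bounded ch.
have e0 : 0 < `|h t| / 2 by rewrite divr_gt0// normr_gt0.
have /cvgrPdist_lt/(_ _ e0)/nbhs_ballP[d /= dgt0 H] := ch t.
pose s := t + d / 2.
have ts : t < s by rewrite ltrDl divr_gt0.
have tsE : 0 <= t <= s by rewrite t0 ltW.
have s0 : 0 <= s by rewrite (le_trans t0)// ltW.
have lc := locally_bounded_cst (h t).
have lhc : locally_bounded (fun r => h r - h t).
  by apply: locally_boundedD => //; exact: locally_boundedN.
have := @primitive0_dist _ _ (`|h t| / 2) t s lhc tsE.
have h0 r : 0 <= r -> primitive0 h r = 0 by move=> r0; rewrite primitive0B// fg// subrr.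
rewrite (primitive0B s lh lc) (primitive0B t lh lc) !primitive0_cst// !h0// !sub0r opprK => P.
move: P.
have -> : - (h t * s) + h t * t = - (h t * (s - t)) by ring.
rewrite normrN normrM (gtr0_norm (_ : 0 < s - t)) ?subr_gt0//.
rewrite ler_pM2r ?subr_gt0// => P.
have : `|h t| <= `|h t| / 2.
  apply: P => r /andP[tr rs]; rewrite distrC ltW// H//.
  rewrite /ball/= distrC gtr0_norm ?subr_gt0// ltrBlDl (le_lt_trans rs)//.
  by rewrite ltrD2l ltr_pdivrMr// ltr_pMr// ltr1n.
by apply/negP; rewrite -ltNge; lra.
Qed.

Context {n m : nat}.
Variables (A : 'M[R]_n) (B : 'M[R]_(n, m)).

(* y is the image of x under the reflection that exchanges p and q. *)
Lemma enorm_reflection (p q x : 'cV[R]_n) : enorm p = enorm q ->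
  exists2 y, enorm y = enorm x & dotmx q y = dotmx p x.
Proof.
move=> pq; pose w := p - q.
have [w0|w0] := eqVneq w 0.
  by exists x => //; move/eqP: w0; rewrite subr_eq0 => /eqP ->.
have ww : dotmx w w != 0 by rewrite dotmx_eq0.
pose k := 2 * dotmx w x / dotmx w w.
exists (x - k *: w).
  rewrite !enormE !(dotmxBl, dotmxBr) !(dotmxZl, dotmxZr) (dotmxC x w) /k.
  by congr Num.sqrt; field.
have qw : dotmx q w = - (dotmx w w / 2).
  have : dotmx p p = dotmx q q by rewrite -!sqr_enorm pq.
  by rewrite /w !(dotmxBl, dotmxBr) (dotmxC q p) => ->; field.
rewrite dotmxBr dotmxZr qw /k.
have -> : 2 * dotmx w x / dotmx w w * - (dotmx w w / 2) = - dotmx w x by field.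
by rewrite opprK {1}/w dotmxBl addrCA subrr addr0.
Qed.

Variable Psi : R -> R.
Hypothesis value_radial : forall x : 'cV[R]_n, value0 A B x = (Psi (enorm x))%:E.

(** The left-hand side is <p, x> for a point x driven to 0 in time S. Its mirror image y has the
    same value, hence is driven to 0 before T, and <q, y> = <p, x> is bounded by the support of q.
    The margin between S and T makes up for attainment of the infimum. *)
Lemma support_radial_le p q S T : enorm p = enorm q -> 0 < S < T ->
  support A B p S <= support A B q T.
Proof.
move=> pq /andP[S0 ST]; have T0 := lt_trans S0 ST.
pose x := - steering A B (bang A B p) S.
have px : dotmx p x = support A B p S by rewrite dotmxNr dotmx_steering_bang opprK.
have vx : (value0 A B x <= S%:E)%E.
  rewrite /value0; case: eqP => _; first by rewrite lee_fin ltW.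
  apply: (min_time_le (bang_control A B p)) => //.
  by rewrite addNr mulmx0 enorm0.
have [y yx qy] := enorm_reflection x pq.
have : (value0 A B y <= S%:E)%E by rewrite value_radial yx -value_radial.
rewrite -px -qy /value0; case: eqVneq => [-> _|y0 yS].
  by rewrite dotmx0r /support -(primitive0_at0 (fun s => enorm (adjoint A B q s)))
    support_le// lexx ltW.
have /min_time_lt[S' [u [/andP[S'0 S'T] cu H]]] : (min_time A B 0 y < T%:E)%E.
  by rewrite (le_lt_trans yS)// lte_fin.
have : expmx A S' *m (y + steering A B u S') = 0.
  by apply/eqP; rewrite -enorm_eq0 eq_le H enorm_ge0.
move=> /(congr1 (mulmx (expmx A (- S')))).
rewrite mulmxA (mulmx1C (expmxN A S')) mul1mx mulmx0 => /eqP.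
rewrite addr_eq0 => /eqP ->; rewrite dotmxNr lerNl.
rewrite (le_trans _ (dotmx_steering_ge A B q cu (ltW S'0)))// lerN2.
by rewrite support_le// !ltW.
Qed.

(** Lipschitz continuity of the support in time closes the margin between S and T. *)
Lemma support_radial p q S : enorm p = enorm q -> 0 <= S ->
  support A B p S = support A B q S.
Proof.
suff le p' q' : enorm p' = enorm q' -> 0 < S -> support A B p' S <= support A B q' S.
  move=> pq; rewrite le_eqVlt => /predU1P[<-|S0]; first by rewrite /support !primitive0_at0.
  by apply/eqP; rewrite eq_le !le.
move=> pq S0.
have [C C0 lip] := is_primitive_Lipschitz (S + 1)
  (primitive0_is_primitive (locally_bounded_enorm_adjoint A B q')).
apply/ler_addgt0Pr => e e0.
pose d := Num.min 1 (e / (C + 1)).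
have d0 : 0 < d by rewrite lt_min ltr01 divr_gt0// ltr_wpDl.
have d1 : d <= 1 by rewrite ge_min lexx.
have SSd : 0 < S < S + d by rewrite S0 ltrDl.
rewrite (le_trans (support_radial_le pq SSd))// -lerBlDl.
rewrite (le_trans (ler_norm _))// (le_trans (lip _ _ _ _))//.
- by rewrite (ltW S0) lerDl ler01.
- by rewrite addr_ge0 ?(ltW S0) ?(ltW d0)//= lerD2l.
rewrite addrC addKr gtr0_norm//.
have : d <= e / (C + 1) by rewrite ge_min lexx orbT.
rewrite ler_pdivlMr ?ltr_wpDl// => /(le_trans _); apply.
by rewrite mulrC ler_wpM2l ?(ltW d0)// lerDl.
Qed.

(** The integrand of a controllability Gramian; its quadratic form at p is |f_p(t)|^2. *)
Let gramian t : 'M[R]_n := expmx A (- t) *m (B *m B^T) *m (expmx A (- t))^T.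

Lemma gramian_scalar t : 0 <= t -> exists c, gramian t = c%:M.
Proof.
move=> t0; apply: scalar_mx_norm.
  by rewrite /gramian !trmx_mul !trmxK !mulmxA.
move=> p q pq.
have W p' : dotmx p' (gramian t *m p') = enorm (adjoint A B p' t) ^+ 2.
  by rewrite sqr_enorm !dotmxE /adjoint /gramian !trmx_mul !trmxK !mulmxA.
rewrite !W; congr (_ ^+ 2).
have ce p' : continuous (fun s => enorm (adjoint A B p' s)).
  by move=> s; apply: cvg_enorm; exact: adjoint_continuous.
by apply: (primitive0_inj (ce p) (ce q) _ t0) => s s0; exact: support_radial.
Qed.

(** At 0 the derivative of [gramian] is - (A B B^T + B B^T A^T) = - b (A + A^T). For orthogonal p
    and q, <p, gramian(t) q> vanishes for all t >= 0, hence so does its derivative, 0 included. That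
    b is nonzero is left to controllability. *)
Lemma radial_isotropic : exists b a : R, [/\ B *m B^T = b%:M &
  b != 0 -> A + A^T = (2 * a)%:M].
Proof.
have [b Wb] := gramian_scalar (lexx 0).
rewrite /gramian oppr0 expmx0 trmx1 mul1mx mulmx1 in Wb.
have HE := expmxN_is_primitive A.
have HET : mx_is_primitive (fun t => (expmx A (- t))^T) (fun t => - ((expmx A (- t))^T *m A^T)).
  move=> i j; apply: eq_is_primitive (HE j i) => s _; first by rewrite [RHS]mxE.
  by rewrite -trmx_mul [LHS]mxE [RHS]mxE [_^T _ _]mxE.
pose V t := - (A *m gramian t + gramian t *m A^T).
have HG : mx_is_primitive gramian V.
  apply: eq_mx_is_primitive (mx_is_primitiveM
    (mx_is_primitiveM HE (mx_is_primitive_cst (B *m B^T))) HET) => // s _.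
  by rewrite mulmx0 addr0 /V /gramian mulNmx mulmxN opprD !mulNmx !mulmxA.
suff [c Vc] : exists c, V 0 = c%:M.
  exists b, (- c / b / 2); split=> // b0.
  move: Vc; rewrite /V /gramian oppr0 expmx0 trmx1 mul1mx mulmx1 Wb.
  rewrite mul_mx_scalar mul_scalar_mx -scalerDr => /(congr1 (fun M => (- b^-1) *: M)).
  rewrite scalerN scaleNr opprK scalerA mulVf// scale1r => ->.
  by rewrite scale_scalar_mx; congr _%:M; field.
apply: scalar_mx_perp => p q pq.
have HD := mx_is_primitiveM (mx_is_primitive_cst p^T)
  (mx_is_primitiveM HG (mx_is_primitive_cst q)).
have D0 t : 0 <= t -> (p^T *m (gramian t *m q)) 0 0 = 0.
  by move=> /gramian_scalar[c ->]; rewrite mul_scalar_mx -dotmxE dotmxZr pq mulr0.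
have cg t : gramian s @[s --> t] --> gramian t.
  apply: cvg_mulmx; last by apply: cvg_trmx; apply: expmx_cvg; apply: cvgN; exact: cvg_id.
  apply: cvg_mulmx; last exact: cvg_cst.
  by apply: expmx_cvg; apply: cvgN; exact: cvg_id.
have cV : continuous (fun t => (p^T *m (V t *m q)) 0 0).
  move=> t; apply: cvg_mx_entry; apply: cvg_mulmx; first exact: cvg_cst.
  apply: cvg_mulmx; last exact: cvg_cst.
  apply: cvgN; apply: cvgD; apply: cvg_mulmx; by [exact: cvg_cst|exact: cg].
rewrite dotmxE.
apply: (primitive0_inj cV (g := fun=> 0)) => //; first by move=> t; exact: cvg_cst.
move=> t t0; rewrite primitive0_cst// mul0r.
have [_ /(_ t t0)] := HD 0 0; rewrite !D0// add0r => E; rewrite [RHS]E.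
by apply: eq_primitive0 => s _; rewrite mul0mx add0r mulmx0 addr0.
Qed.

End radial_value.

(** * Coinciding optimal controls *)

Section real_analysis.
Context {R : realType}.
Notation mu := (@lebesgue_measure R).
Implicit Types (f g F : R -> R) (s t T S : R).

Lemma ae_eq_continuous f g T : 0 < T -> continuous f -> continuous g ->
  {ae mu, forall s, 0 < s <= T -> f s = g s} -> forall t, 0 <= t <= T -> f t = g t.
Proof.
move=> T0 cf cg fg t /andP[t0 tT]; apply/eqP; rewrite -subr_eq0; apply/negPn/negP => d0.
pose h s := f s - g s.
have ch : continuous h by move=> s; apply: cvgB; [exact: cf|exact: cg].
have e0 : 0 < `|h t| by rewrite normr_gt0.
have /cvgrPdist_lt/(_ _ e0)/nbhs_ballP[d /= dgt0 H] := ch t.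
pose a := Num.max 0 (t - d); pose b := Num.min T (t + d).
have ab : a < b.
  by rewrite lt_min !gt_max T0 ltr_wpDl//= ltrBlDr; apply/andP; split; lra.
have Hab s : a < s < b -> f s != g s /\ 0 < s <= T.
  rewrite gt_max lt_min => /andP[/andP[s0 ts] /andP[sT st]].
  split; last by rewrite s0 ltW.
  have : `|h t - h s| < `|h t|.
    by apply: H; rewrite /ball/= ltr_distl; apply/andP; split; lra.
  by rewrite /h -[f s == _]subr_eq0; apply: contraTneq => ->; rewrite subr0 ltxx.
have : mu.-negligible (`]a, b[ : set R).
  apply: negligibleS fg => s /=; rewrite in_itv/= => /Hab[/eqP fgs s0T] /(_ s0T).
  exact: fgs.
move=> N; have : mu (`]a, b[ : set R) = 0%E by exact: measure_negligible N.
rewrite lebesgue_measure_itv/= lte_fin ab -EFinB => -[/eqP].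
by rewrite subr_eq0 => /eqP ba; rewrite ba ltxx in ab.
Qed.

(** Under (i), equalities are known only at times accumulating at S from the left, not on a left
    neighbourhood. *)
Lemma frequently_eq_cvg_left f g (a b : R) S :
  f t @[t --> S^'-] --> a -> g t @[t --> S^'-] --> b ->
  (forall d, 0 < d -> exists2 T, S - d < T < S & f T = g T) -> a = b.
Proof.
move=> fa gb H; apply/eqP; rewrite -subr_eq0; apply/negPn/negP => d0.
have hab : (f t - g t) @[t --> S^'-] --> a - b by exact: cvgB.
have e0 : 0 < `|a - b| by rewrite normr_gt0.
have /cvgrPdist_lt/(_ _ e0) := hab.
rewrite near_withinE => /nbhs_ballP[d /= dgt0 Hd].
have [T /andP[T1 T2] fgT] := H d dgt0.
have := Hd T; rewrite /ball/= gtr0_norm ?subr_gt0// => /(_ _ T2).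
by rewrite fgT subrr subr0 ltxx => /(_ _)/notF; apply; lra.
Qed.

(** Strict differentiability at t0: both ends of the increment may move. *)
Lemma is_primitive_near F f t0 e : is_primitive F f -> {for t0, continuous f} -> 0 < e ->
  exists2 d, 0 < d & forall s t, 0 <= s -> t0 - d < s -> s <= t -> t < t0 + d ->
    `|F t - F s - f t0 * (t - s)| <= e * (t - s).
Proof.
move=> [lf FE] cf e0.
have /cvgrPdist_lt/(_ _ e0)/nbhs_ballP[d /= dgt0 H] := cf.
exists d => // s t s0 ds st td; have tt0 := le_trans s0 st.
rewrite (FE t)// (FE s)// opprD addrACA subrr add0r.
have lc := locally_bounded_cst (f t0).
have lfc : locally_bounded (fun r => f r - f t0).
  by apply: locally_boundedD => //; exact: locally_boundedN.
have stP : 0 <= s <= t by rewrite s0.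
have := @primitive0_dist _ _ e s t lfc stP.
rewrite (primitive0B t lf lc) (primitive0B s lf lc) !primitive0_cst//.
rewrite [X in `|X|](_ : _ = primitive0 f t - primitive0 f s - f t0 * (t - s)); last by ring.
apply=> r /andP[sr rt]; rewrite distrC ltW// H//.
by rewrite /ball/= ltr_distl; apply/andP; split; lra.
Qed.

Lemma cvg_left_difference F f S : 0 < S -> is_primitive F f -> {for S, continuous f} ->
  (S - T)^-1 * (F S - F T) @[T --> S^'-] --> f S.
Proof.
move=> S0 Ff cf; apply/cvgrPdist_le => e e0.
have [d d0 H] := is_primitive_near Ff cf e0.
rewrite near_withinE; apply/nbhs_ballP.
exists (Num.min d S); first by rewrite /= lt_min d0.
move=> T; rewrite /ball/= lt_min => /andP[]; rewrite !ltr_distl => /andP[_ Td] /andP[_ T0] TS.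
have ST : 0 < S - T by rewrite subr_gt0.
rewrite distrC.
have -> : (S - T)^-1 * (F S - F T) - f S = (S - T)^-1 * (F S - F T - f S * (S - T)).
  by field; rewrite gt_eqF.
rewrite normrM normfV (gtr0_norm ST) [leLHS]mulrC ler_pdivrMr//.
by apply: H; lra.
Qed.

(** The integral over [T, S] of k (S - t) is k (S - T)^2 / 2; this factor 1/2 decides
    [coincide_symmetric]. *)
Lemma cvg_left_half f (k : R) S : 0 < S -> locally_bounded f -> f S = 0 ->
  (S - T)^-1 * f T @[T --> S^'-] --> k ->
  (S - T) ^- 2 * (primitive0 f S - primitive0 f T) @[T --> S^'-] --> k / 2.
Proof.
move=> S0 lf fS fk; apply/cvgrPdist_le => e e0.
have /cvgrPdist_le/(_ _ e0) := fk.
rewrite near_withinE => /nbhs_ballP[d /= dgt0 Hd].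
rewrite near_withinE; apply/nbhs_ballP.
exists (Num.min d S); first by rewrite /= lt_min dgt0.
move=> T; rewrite /ball/= lt_min => /andP[]; rewrite !ltr_distl => /andP[_ Td] /andP[_ T0] TS.
have ST : 0 < S - T by rewrite subr_gt0.
have quad : is_primitive (fun t => - k / 2 * (S - t) ^+ 2) (fun t => k * (S - t)).
  have cl : is_primitive (fun t : R => S - t) (fun=> -1).
    apply: derive_is_primitive; first by move=> t; exact: cvg_cst.
    by move=> t; have := is_deriveB (is_derive_cst S t 1) (is_derive_id t 1); rewrite sub0r.
  apply: eq_is_primitive (is_primitiveM (is_primitive_cst (- k / 2)) (is_primitiveM cl cl)) => t _.
  - by rewrite expr2.
  - by field.
have [lq qE] := quad.
pose g t := f t - k * (S - t).
have lg : locally_bounded g by apply: locally_boundedD => //; exact: locally_boundedN.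
have TSP : 0 <= T <= S by apply/andP; split; lra.
have := @primitive0_dist _ g (e * (S - T)) T S lg TSP.
rewrite (primitive0B S lf lq) (primitive0B T lf lq).
have qS := qE S (ltW S0); have qT := qE T (andP TSP).1.
have -> : primitive0 f S - primitive0 (fun t => k * (S - t)) S -
    (primitive0 f T - primitive0 (fun t => k * (S - t)) T) =
    primitive0 f S - primitive0 f T - k / 2 * (S - T) ^+ 2.
  by rewrite (_ : primitive0 (fun t => k * (S - t)) S =
     - k / 2 * (S - S) ^+ 2 - - k / 2 * (S - 0) ^+ 2); [|lra];
  rewrite (_ : primitive0 (fun t => k * (S - t)) T =
     - k / 2 * (S - T) ^+ 2 - - k / 2 * (S - 0) ^+ 2); [field|lra].
move=> H; rewrite distrC.
have -> : (S - T) ^- 2 * (primitive0 f S - primitive0 f T) - k / 2 =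
    (S - T) ^- 2 * (primitive0 f S - primitive0 f T - k / 2 * (S - T) ^+ 2).
  by field; rewrite gt_eqF.
rewrite normrM normfV [X in X^-1]ger0_norm ?sqr_ge0// [leLHS]mulrC ler_pdivrMr ?exprn_gt0//.
rewrite [leRHS](_ : _ = e * (S - T) * (S - T)); last by ring.
apply: H => r /andP[Tr]; rewrite le_eqVlt => /predU1P[->|rS].
  by rewrite /g fS subrr mulr0 subr0 normr0 mulr_ge0// ltW.
have Sr : 0 < S - r by rewrite subr_gt0.
have := Hd r; rewrite /ball/= ltr_distl => /(_ _ rS) H1.
have {}H1 : `|k - (S - r)^-1 * f r| <= e by apply: H1; apply/andP; split; lra.
have -> : g r = (S - r) * - (k - (S - r)^-1 * f r) by rewrite /g; field; rewrite gt_eqF.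
rewrite normrM normrN (gtr0_norm Sr) [leLHS]mulrC ler_pM// ?normr_ge0// ?ltW//; lra.
Qed.

(** By compactness finitely many isolating balls cover [0, S], and each contains at most one point
    of P in [0, S], its center. *)
Lemma isolated_finite (P : set R) S :
  (forall t, 0 <= t <= S -> exists2 d : R, 0 < d & forall h, 0 < `|h| < d -> ~ P (t + h)) ->
  exists D : seq R, forall t, 0 <= t <= S -> P t -> t \in D.
Proof.
move=> iso.
have /choice[d dP] : forall t : R, exists d : R, 0 <= t <= S ->
    0 < d /\ forall h, 0 < `|h| < d -> ~ P (t + h).
  move=> t; have [tS|ntS] := boolP (0 <= t <= S); last by exists 0.
  by have [d d0 H] := iso t tS; exists d.
have : cover_compact (`[0, S] : set R) by rewrite -compact_cover; exact: segment_compact.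
move=> /(_ R `[0, S]%classic (fun t => ball t (d t))) [].
- by move=> t _; exact: ball_open.
- move=> t tS; exists t => //; apply: ballxx.
  by move: tS; rewrite /= in_itv/= => /dP[].
move=> D DS Dcov; exists (finmap.enum_fset D) => t tS Pt.
have [|s /= sD] := Dcov t; first by rewrite /= in_itv.
have := DS s sD.
move=> /set_mem; rewrite /= in_itv/= => /dP[ds0 H] st.
have [<-//|ts] := eqVneq s t.
exfalso; apply: (H (t - s)); last by rewrite addrC subrK.
by rewrite normr_gt0 subr_eq0 eq_sym ts/= distrC.
Qed.

Lemma measurable_fun_eq_off (D : set R) f g (s : seq R) : measurable D ->
  measurable_fun D f -> (forall t, t \notin s -> f t = g t) -> measurable_fun D g.
Proof.
move=> mD; elim: s f => [|a s IH] f mf fg.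
  by rewrite (_ : g = f)//; apply/funext => t; rewrite fg.
apply: (IH (fun t => if t == a then g a else f t)).
  apply: measurable_fun_if => //.
  - apply: measurable_fun_eqr => //; exact: measurable_cst.
  - apply: measurable_funS mf => //; exact: subIsetl.
move=> t ts; case: eqP => [->//|/eqP ta].
by rewrite fg// inE negb_or ta.
Qed.

Lemma ae_notin_seq (s : seq R) : {ae mu, forall t, t \notin s}.
Proof.
have Fmu := ae_filter_ringOfSetsType mu.
elim: s => [|a s IH]; first exact: aeW.
have ae0 : {ae mu, forall t, t != a}.
  exists [set a]; split => //; first exact: lebesgue_measure_set1.
  by move=> t/= /negP; rewrite negbK => /eqP.
by apply: (filterS2 _ _ IH ae0) => t ts ta; rewrite inE negb_or ta.
Qed.

End real_analysis.

(** * Zeros of the switching function and the left-continuous extremal control *)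

Section left_representative.
Context {R : realType} {n m : nat}.
Notation mu := (@lebesgue_measure R).
Variables (A : 'M[R]_n) (B : 'M[R]_(n, m)).
Hypothesis hrank : \rank (controllability_mx A B) = n.
Implicit Types (u v : R -> 'cV[R]_m) (x p q : 'cV[R]_n) (T S t s : R).

Lemma normalizeN (u : 'cV[R]_m) : normalize (- u) = - normalize u.
Proof. by rewrite /normalize enormN scalerN. Qed.

Lemma adjointB p s t : adjoint A B p (s + t) = adjoint A B ((expmx A (- s))^T *m p) t.
Proof. by rewrite /adjoint opprD expmxD trmx_mul !mulmxA. Qed.

(** k is the first order at which the Taylor expansion of f_p at t does not vanish, given by the
    rank condition, and g is the remainder divided by h^k. Isolated zeros and one-sided limits of
    the direction of f_p follow. *)
Lemma adjoint_factor p t : p != 0 -> exists k (g : R -> 'cV[R]_m),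
  [/\ continuous g, g 0 != 0 & forall h, adjoint A B p (t + h) = h ^+ k *: g h].
Proof.
move=> p0; set v := (expmx A (- t))^T *m p.
have v0 : v != 0.
  apply: contra p0 => /eqP/(congr1 (mulmx (expmx A t)^T)).
  by rewrite /v mulmxA -trmx_mul (mulmx1C (expmxN A t)) trmx1 mul1mx mulmx0 => ->.
pose c k := B^T *m ((A ^+ k)^T *m v).
have exc : exists k, c k != 0.
  apply/not_existsP => H; move/eqP: v0; apply.
  apply: (controllability_inj hrank) => k _; apply/eqP/negPn/negP; exact: H.
pose k := ex_minn exc.
have [ck0 kmin] : c k != 0 /\ forall j, (j < k)%N -> c j = 0.
  rewrite /k; case: ex_minnP => k' ck' km; split=> // j jk.
  by apply/eqP/negPn/negP => /km; rewrite leqNgt jk.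
pose g h := (-1) ^+ k *: (B^T *m ((expmx_tail A k (- h))^T *m v)).
have gE j h : (j <= k)%N ->
    adjoint A B v h = (- h) ^+ j *: (B^T *m ((expmx_tail A j (- h))^T *m v)).
  elim: j => [|j IH] jk; first by rewrite expr0 scale1r.
  rewrite IH ?(ltnW jk)// expmx_tail_recl linearD !linearZ/= mulmxDl mulmxDr.
  rewrite -!scalemxAl -!scalemxAr -/(c j) kmin// scaler0 add0r scalerA.
  by rewrite -exprSr.
exists k, g; split.
- move=> h; apply: cvgZr; apply: cvg_mulmx; first exact: cvg_cst.
  apply: cvg_mulmx; last exact: cvg_cst.
  apply: cvg_trmx; apply: cvg_mx => i j.
  apply: (cvg_comp _ (fun t => expmx_tail A k t i j) (cvgN cvg_id)).
  exact: expmx_tail_continuous.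
- rewrite /g oppr0 expmx_tail0 linearZ/= -scalemxAl -scalemxAr !scaler_eq0.
  rewrite -/(c k) (negbTE ck0) orbF signr_eq0/= invr_eq0 pnatr_eq0.
  by rewrite (gtn_eqF (fact_gt0 k)).
- by move=> h; rewrite adjointB -/v (gE k)// /g scalerA -exprMn mulrN1.
Qed.

Lemma adjoint_isolated p t : p != 0 ->
  exists2 d : R, 0 < d & forall h, 0 < `|h| < d -> adjoint A B p (t + h) != 0.
Proof.
move=> /(adjoint_factor t)[k [g [cg g0 gE]]].
have e0 : 0 < enorm (g 0) by rewrite enorm_gt0.
have ce : enorm (g s) @[s --> (0 : R)] --> enorm (g 0) by apply: cvg_enorm; exact: cg.
have /cvgrPdist_lt/(_ _ e0)/nbhs_ballP[d /= d0 H] := ce.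
exists d => // h /andP[h0 hd]; rewrite gE scaler_eq0 negb_or.
rewrite expf_eq0 negb_and -normr_gt0 h0 orbT/=.
have := H h; rewrite /ball/= sub0r normrN => /(_ hd).
by apply: contraTneq => ->; rewrite enorm0 subr0 gtr0_norm// ltxx.
Qed.

Lemma bang_cvg_right p t : p != 0 -> cvg (bang A B p s @[s --> t^'+]).
Proof.
move=> /(adjoint_factor t)[k [g [cg g0 gE]]].
have H : - normalize (g (s - t)) @[s --> t^'+] --> - normalize (g 0).
  apply: cvgN; apply: (cvg_normalize g0).
  apply: (cvg_comp (fun s => s - t) g _ (cg 0)).
  have /cvg_within_filter : (fun s => s - t) @ t --> t - t.
    by apply: cvgB; [exact: cvg_id|exact: cvg_cst].
  by rewrite subrr; apply.
apply/cvg_ex; exists (- normalize (g 0)); apply: cvg_trans H.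
apply: near_eq_cvg; rewrite near_withinE; near=> s => ts.
have sE : s = t + (s - t) by ring.
rewrite /bang [in adjoint _ _ _ s]sE gE normalizeZ//.
by rewrite exprn_gt0// subr_gt0.
Unshelve. all: by end_near. Qed.

(** For h < 0 the factor h^k has sign (-1)^k: compared with the right limit, the direction flips
    when k is odd. *)
Lemma bang_cvg_left p t : p != 0 -> cvg (bang A B p s @[s --> t^'-]).
Proof.
move=> /(adjoint_factor t)[k [g [cg g0 gE]]].
have H : - ((-1) ^+ k *: normalize (g (s - t))) @[s --> t^'-] -->
    - ((-1) ^+ k *: normalize (g 0)).
  apply: cvgN; apply: cvgZr; apply: (cvg_normalize g0).
  apply: (cvg_comp (fun s => s - t) g _ (cg 0)).
  have /cvg_within_filter : (fun s => s - t) @ t --> t - t.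
    by apply: cvgB; [exact: cvg_id|exact: cvg_cst].
  by rewrite subrr; apply.
apply/cvg_ex; exists (- ((-1) ^+ k *: normalize (g 0))); apply: cvg_trans H.
apply: near_eq_cvg; rewrite near_withinE; near=> s => ts.
have sE : s = t + (s - t) by ring.
rewrite /bang [in adjoint _ _ _ s]sE gE.
have -> : (s - t) ^+ k = (-1) ^+ k * (t - s) ^+ k by rewrite -exprMn; congr (_ ^+ _); ring.
rewrite mulrC -scalerA normalizeZ ?exprn_gt0 ?subr_gt0//.
by rewrite -signr_odd; case: odd; rewrite ?expr0 ?expr1 ?scale1r ?scaleN1r ?normalizeN.
Unshelve. all: by end_near. Qed.

Lemma bang_continuous p t : adjoint A B p t != 0 -> {for t, continuous (bang A B p)}.
Proof.
by move=> a0; apply: cvgN; apply: (cvg_normalize a0); exact: adjoint_continuous.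
Qed.

(** The normalized optimal control must be left-continuous, whereas [bang] is 0 at the zeros of the
    switching function; the left limit repairs these values. *)
Definition left_bang p S t : 'cV[R]_m :=
  if 0 < t <= S then lim (bang A B p s @[s --> t^'-]) else 0.

Lemma left_bangE p S t : 0 < t <= S -> adjoint A B p t != 0 ->
  left_bang p S t = bang A B p t.
Proof.
move=> tS a0; rewrite /left_bang tS; apply/cvg_lim => //.
exact: cvg_within_filter (bang_continuous a0).
Qed.

Lemma adjoint_zeros p S : p != 0 -> exists D : seq R, forall t, 0 <= t <= S ->
  t \notin D -> adjoint A B p t != 0.
Proof.
move=> p0.
have [|D DP] := @isolated_finite _ [set t | adjoint A B p t = 0] S.
  by move=> t _; have [d d0 H] := adjoint_isolated t p0; exists d => // h /H/eqP.
by exists D => t tS; apply: contraNneq => /DP; apply.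
Qed.

Lemma adjoint_near_neq0 p t : p != 0 -> \forall s \near t^', adjoint A B p s != 0.
Proof.
move=> /(adjoint_isolated t)[d d0 H]; rewrite near_withinE.
apply/nbhs_ballP; exists d => // s; rewrite /ball/= => st ts.
rewrite -(subrK t s) addrC H// -normrN opprB st andbT.
by rewrite normr_gt0 subr_eq0 eq_sym.
Qed.

Lemma left_bang_control p S : p != 0 -> control (left_bang p S).
Proof.
move=> p0; have [D DP] := adjoint_zeros S p0.
have [mb _] := bang_control A B p.
split=> [i|t t0].
  apply: (@measurable_fun_eq_off _ _
    (fun t => if 0 < t <= S then bang A B p t i 0 else 0) _ D).
  - exact: measurable_0y.
  - apply: measurable_fun_if => //.
    + apply: measurable_and; [apply: measurable_fun_ltr|apply: measurable_fun_ler] => //;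
      exact: measurable_cst.
    + by apply: measurable_funS (mb i) => // t [].
  - move=> t tD; case: ifPn => [tS|ntS]; last by rewrite /left_bang (negbTE ntS) mxE.
    by rewrite left_bangE ?DP//; case/andP: tS => /ltW ->.
rewrite /left_bang; case: ifPn => [tS|_]; last by rewrite enorm0.
have ce : enorm (bang A B p s) @[s --> t^'-] --> enorm (lim (bang A B p s @[s --> t^'-])).
  by apply: cvg_enorm; exact: bang_cvg_left.
rewrite -(cvg_lim _ ce)//; apply: limr_le; first exact: (cvgP _ ce).
by apply: nearW => s; rewrite /= enormN enorm_normalize_le1.
Qed.

Lemma left_bang_piecewise p S : p != 0 -> left_piecewise_continuous S (left_bang p S).
Proof.
move=> p0; have [D DP] := adjoint_zeros S p0.
split.
- exists D => t /andP[t0 tS] tD.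
  have a0 : adjoint A B p t != 0 by rewrite DP// !ltW.
  have near_a : \forall s \near t, left_bang p S s = bang A B p s.
    have e0 : 0 < enorm (adjoint A B p t) by rewrite enorm_gt0.
    have ce : enorm (adjoint A B p s) @[s --> t] --> enorm (adjoint A B p t).
      by apply: cvg_enorm; exact: adjoint_continuous.
    have /cvgrPdist_lt/(_ _ e0) H := ce.
    near=> s; apply: left_bangE.
      by apply/andP; split; [|apply/ltW]; near: s;
        [exact: lt_nbhsr|exact: lt_nbhsl].
    have : `|enorm (adjoint A B p t) - enorm (adjoint A B p s)| < enorm (adjoint A B p t).
      by near: s.
    by apply: contraTneq => ->; rewrite enorm0 subr0 gtr0_norm// ltxx.
  rewrite /prop_for /continuous_at (nbhs_singleton near_a).
  apply: cvg_trans (bang_continuous a0); apply: near_eq_cvg.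
  by apply: filterS near_a => s ->.
- move=> t tS; rewrite {2}/left_bang tS; apply: cvg_trans (bang_cvg_left (t := t) p0).
  apply: near_eq_cvg; case/andP: tS => t0 tS.
  have H : \forall s \near t^'-, adjoint A B p s != 0.
    move: (adjoint_near_neq0 t p0); rewrite !near_withinE.
    by apply: filterS => s Hs st; apply: Hs; rewrite lt_eqF.
  near=> s; rewrite left_bangE//; last by near: s.
  have st : s < t by near: s; exact: nbhs_left_lt.
  have s0 : 0 < s by near: s; exact: nbhs_left_gt.
  by rewrite s0 (le_trans (ltW st)).
- move=> t /andP[t0 tS]; apply/cvg_ex.
  exists (lim (bang A B p s @[s --> t^'+])).
  apply: cvg_trans (bang_cvg_right (t := t) p0).
  apply: near_eq_cvg.
  have H : \forall s \near t^'+, adjoint A B p s != 0.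
    move: (adjoint_near_neq0 t p0); rewrite !near_withinE.
    by apply: filterS => s Hs st; apply: Hs; rewrite gt_eqF.
  near=> s; rewrite left_bangE//; last by near: s.
  have st : t < s by near: s; exact: nbhs_right_gt.
  have sS : s < S by near: s; exact: nbhs_right_lt.
  by rewrite (lt_trans t0)//= ltW.
Unshelve. all: by end_near. Qed.

End left_representative.

(** * Extremal controls and the maximum principle *)

Section extremals.
Context {R : realType} {n m : nat}.
Notation mu := (@lebesgue_measure R).
Variables (A : 'M[R]_n) (B : 'M[R]_(n, m)).
Implicit Types (u v w : R -> 'cV[R]_m) (x p q y : 'cV[R]_n) (T S t s eps : R).

Lemma steering_ae_eq u v T : control u -> control v ->
  {ae mu, forall s, 0 < s <= T -> u s = v s} -> steering A B u T = steering A B v T.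
Proof.
move=> cu cv uv; apply/matrixP => i j; rewrite !mxE.
have mI w : control w -> measurable_fun (`]0, +oo[ : set R)
    (fun s => (expmx A (- s) *m (B *m w s)) i j).
  move=> cw; have [mw _] := @mx_locally_bounded_steering _ _ _ A B w cw i j.
  apply: (measurable_funS measurable_0y _ mw) => s/=.
  by rewrite !in_itv/= !andbT => /ltW.
have Fmu := ae_filter_ringOfSetsType mu.
apply: primitive0_ae_eq; [exact: mI|exact: mI|].
by apply: filterS uv => s uvs sT; rewrite uvs.
Qed.

Lemma support_lt p T S : 0 <= T < S -> adjoint A B p S != 0 ->
  support A B p T < support A B p S.
Proof.
move=> /andP[T0 TS] a0; have e0 : 0 < enorm (adjoint A B p S) by rewrite enorm_gt0.
have e2 : 0 < enorm (adjoint A B p S) / 2 by rewrite divr_gt0.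
have ce : {for S, continuous (fun s => enorm (adjoint A B p s))}.
  by apply: cvg_enorm; exact: adjoint_continuous.
have [d d0 H] := is_primitive_near
  (primitive0_is_primitive (locally_bounded_enorm_adjoint A B p)) ce e2.
pose T' := Num.max T (S - d / 2).
have TT' : T <= T' by rewrite le_max lexx.
have T'S : T' < S by rewrite gt_max TS ltrBlDr ltrDl divr_gt0.
have dT' : S - d < T'.
  by rewrite lt_max; apply/orP; right; rewrite ltrD2l ltrN2 ltr_pdivrMr// ltr_pMr// ltr1n.
apply: (@le_lt_trans _ _ (support A B p T')); first by rewrite support_le// T0.
have := H T' S (le_trans T0 TT') dT' (ltW T'S); rewrite ltrDl d0 => /(_ isT).
rewrite ler_norml => /andP[+ _]; rewrite /support.
have : 0 < enorm (adjoint A B p S) / 2 * (S - T') by rewrite mulr_gt0// subr_gt0.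
lra.
Qed.

(** Arrival at 0 at some T < S would give <p, c(u)> = - h_S(p) < - h_T(p), below the least possible
    value. *)
Lemma min_time_target p S : 0 < S -> adjoint A B p S != 0 ->
  min_time A B 0 (- steering A B (bang A B p) S) = S%:E.
Proof.
move=> S0 a0; apply/eqP; rewrite eq_le; apply/andP; split.
  apply: (min_time_le (bang_control A B p)) => //.
  by rewrite addNr mulmx0 enorm0.
apply: min_time_ge => T u T0 cu H; rewrite lee_fin leNgt; apply/negP => TS.
have : expmx A T *m (- steering A B (bang A B p) S + steering A B u T) = 0.
  by apply/eqP; rewrite -enorm_eq0 eq_le H enorm_ge0.
move=> /(congr1 (mulmx (expmx A (- T)))).
rewrite mulmxA (mulmx1C (expmxN A T)) mul1mx mulmx0 => /eqP.
rewrite addrC subr_eq0 => /eqP/(congr1 (dotmx p)); rewrite dotmx_steering_bang => E.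
have := dotmx_steering_ge A B p cu (ltW T0); rewrite E lerN2 leNgt => /negP; apply.
by apply: support_lt; rewrite ?(ltW T0).
Qed.

Lemma target_neq0 p S : 0 < S -> adjoint A B p S != 0 ->
  - steering A B (bang A B p) S != 0.
Proof.
move=> S0 a0; apply/eqP => /(congr1 (dotmx p)).
rewrite dotmxNr dotmx_steering_bang opprK dotmx0r => E.
have := @support_lt p 0 S; rewrite lexx S0 E => /(_ isT a0).
by rewrite /support primitive0_at0 ltxx.
Qed.

(** The inequality <f_p, v> >= - |f_p| holds at each time and is an equality after integration,
    hence an equality almost everywhere. *)
Lemma ae_extremal p v T : control v -> 0 <= T ->
  dotmx p (steering A B v T) <= - support A B p T ->
  {ae mu, forall s, 0 <= s <= T ->
    adjoint A B p s = - enorm (adjoint A B p s) *: v s}.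
Proof.
move=> cv T0; rewrite dotmx_steering// => H.
have l1 := locally_bounded_dotmx_adjoint A B p cv.
have l2 := locally_bounded_enorm_adjoint A B p.
have ge0 s : 0 <= s <= T ->
    0 <= dotmx (adjoint A B p s) (v s) + enorm (adjoint A B p s).
  by move=> /andP[s0 _]; rewrite -lerBlDr sub0r dotmx_adjoint_ge.
have := primitive0_eq0 (locally_boundedD l1 l2) T0 ge0.
rewrite primitive0D// -lerBrDr sub0r => /(_ H).
have Fmu := ae_filter_ringOfSetsType mu.
apply: filterS => s Hs sT; apply: dotmx_eq_oppr.
  by case: cv => _; apply; case/andP: sT.
by apply/eqP; rewrite -addr_eq0 Hs.
Qed.

Lemma control_convex v w (l : R) : control v -> control w -> 0 <= l <= 1 ->
  control (fun s => v s + l *: (w s - v s)).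
Proof.
move=> cv cw /andP[l0 l1]; have lv := control_locally_bounded cv.
have lw := control_locally_bounded cw; apply: controlP.
  move=> i j; apply: eq_locally_bounded (locally_boundedD (lv i j)
    (locally_boundedM (locally_bounded_cst l)
      (locally_boundedD (lw i j) (locally_boundedN (lv i j))))) => t _.
  by rewrite !mxE.
move=> t t0; have -> : v t + l *: (w t - v t) = (1 - l) *: v t + l *: w t.
    by apply/matrixP => i j; rewrite !mxE; ring.
rewrite (le_trans (ler_enormD _ _))// !enormZ (ger0_norm l0) ger0_norm ?subr_ge0//.
have h1 : (1 - l) * enorm (v t) <= 1 - l by rewrite ler_piMr ?subr_ge0 ?cv.2.
have h2 : l * enorm (w t) <= l by rewrite ler_piMr ?cw.2.
by lra.
Qed.

Lemma steering_convex v w (l : R) T : control v -> control w ->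
  steering A B (fun s => v s + l *: (w s - v s)) T =
  steering A B v T + l *: (steering A B w T - steering A B v T).
Proof.
move=> cv cw; have lv := mx_locally_bounded_steering A B cv.
have lw := mx_locally_bounded_steering A B cw.
apply/matrixP => i j; rewrite !mxE.
rewrite -(primitive0B T (lw i j) (lv i j)) -primitive0Z -?primitive0D//.
- by apply: eq_primitive0 => s _; rewrite !(mulmxDr, mulmxN) -!scalemxAr !(mulmxDr, mulmxN) !mxE.
- apply: locally_boundedM; first exact: locally_bounded_cst.
  by apply: locally_boundedD => //; exact: locally_boundedN.
- by apply: locally_boundedD => //; exact: locally_boundedN.
Qed.

Definition arrival x u T : 'cV[R]_n := expmx A T *m (x + steering A B u T).

(* The end point of an optimal trajectory is the projection of the origin on
   the convex set of the points reachable at the optimal time. *)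
Lemma arrival_variational x eps T v w : 0 <= eps ->
  (forall w, control w -> eps <= enorm (arrival x w T)) ->
  control v -> enorm (arrival x v T) <= eps -> control w ->
  dotmx (arrival x v T) (arrival x v T) <= dotmx (arrival x v T) (arrival x w T).
Proof.
move=> e0 Hmin cv yv cw; set y := arrival x v T; set z := arrival x w T.
rewrite -subr_ge0 -dotmxBr leNgt; apply/negP => d0.
set d := dotmx y (z - y) in d0; pose N := dotmx (z - y) (z - y).
have N0 : 0 <= N := dotmx_ge0 _.
(* The squared norm of y + l (z - y) is |y|^2 + l (2 d + l N), and l (N + 1) <= - d makes the
   bracket negative. *)
pose l := Num.min 1 (- d / (N + 1)).
have l0 : 0 < l by rewrite lt_min ltr01 divr_gt0 ?oppr_gt0// ltr_wpDl.
have l1 : l <= 1 by rewrite ge_min lexx.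
have ld : l * (N + 1) <= - d by rewrite -ler_pdivlMr ?ltr_wpDl// ge_min lexx orbT.
have cl : control (fun s => v s + l *: (w s - v s)).
  by apply: control_convex => //; rewrite (ltW l0).
have := Hmin _ cl; rewrite /arrival steering_convex// addrA mulmxDr -scalemxAr mulmxBr.
have -> : expmx A T *m steering A B w T - expmx A T *m steering A B v T = z - y.
  by rewrite /z /y /arrival !mulmxDr opprD addrACA subrr add0r.
rewrite -/(arrival x v T) -/y => H.
have : enorm y ^+ 2 <= enorm (y + l *: (z - y)) ^+ 2.
  by rewrite lerXn2r ?nnegrE ?enorm_ge0// (le_trans yv).
have expand (a b : 'cV[R]_n) k : dotmx (a + k *: b) (a + k *: b) =
    dotmx a a + k * (2 * dotmx a b + k * dotmx b b).
  by rewrite !(dotmxDl, dotmxDr, dotmxZl, dotmxZr) (dotmxC b a); ring.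
rewrite !sqr_enorm expand -/d -/N.
have : l * (2 * d + l * N) < 0.
  by rewrite pmulr_rlt0//; nra.
lra.
Qed.

(** A trajectory in the open ball at time T is, by continuity, in the ball slightly earlier. *)
Lemma arrival_ge x eps T w : 0 < T -> min_time A B eps x = T%:E -> control w ->
  eps <= enorm (arrival x w T).
Proof.
move=> T0 mt cw; rewrite leNgt; apply/negP => He.
have [cz _] := steering_trajectory A B x cw.
have /subspace_continuousP/(_ T) := cz.
rewrite /= in_itv/= andbT => /(_ (ltW T0)) czT.
have ce : enorm (arrival x w s) @[s --> within `[0, +oo[%classic (nbhs T)] -->
    enorm (arrival x w T) by exact: cvg_enorm czT.
have e0 : 0 < eps - enorm (arrival x w T) by rewrite subr_gt0.
have /cvgrPdist_lt/(_ _ e0) := ce.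
rewrite near_withinE => /nbhs_ballP[d /= d0 H].
pose T' := Num.max (T / 2) (T - d / 2).
have T'0 : 0 < T' by rewrite lt_max divr_gt0.
have T'T : T' < T by rewrite gt_max; apply/andP; split; lra.
have dT' : T - d < T' by rewrite lt_max; apply/orP; right; lra.
have := H T'; rewrite /ball/= ltr_distl in_itv/= andbT (ltW T'0) => /(_ _ isT) H1.
have {}H1 : enorm (arrival x w T') <= eps.
  have {}H1 : `|enorm (arrival x w T) - enorm (arrival x w T')| <
      eps - enorm (arrival x w T) by apply: H1; apply/andP; split; lra.
  move: (enorm _) (enorm _) H1 => c c'; rewrite ltr_distlC => /andP[_ ?]; lra.
by have := min_time_le cw T'0 H1; rewrite mt lee_fin leNgt T'T.
Qed.

(** Testing with p = x gives |x|^2 <= |exp(- T A^T) x| eps + h_T(x), whose right-hand side tends to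
    |x| eps as T -> 0; each of the two errors is kept below half of [gap]. The bound provides an
    initial interval on which (i) applies. *)
Lemma min_time_gt0 x eps : 0 <= eps < enorm x ->
  exists2 tau : R, 0 < tau & (tau%:E <= min_time A B eps x)%E.
Proof.
move=> /andP[e0 ex]; have x0 := le_lt_trans e0 ex.
pose gap := enorm x * (enorm x - eps).
have gap0 : 0 < gap by rewrite mulr_gt0// subr_gt0.
have ce : enorm ((expmx A (- s))^T *m x) @[s --> (0 : R)] --> enorm x.
  rewrite -{2}[x]mul1mx -trmx1 -(expmx0 A) -{2}oppr0.
  apply: cvg_enorm; apply: cvg_mulmx; last exact: cvg_cst.
  by apply: cvg_trmx; apply: expmx_cvg; apply: cvgN; exact: cvg_id.
pose e1 := gap / (2 * (eps + 1)).
have e10 : 0 < e1 by rewrite divr_gt0// mulr_gt0// ltr_wpDl.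
have /cvgrPdist_lt/(_ _ e10)/nbhs_ballP[d /= d0 H] := ce.
have [C C0 lip] := is_primitive_Lipschitz 1
  (primitive0_is_primitive (locally_bounded_enorm_adjoint A B x)).
pose tau := Num.min (Num.min d 1) (gap / (2 * (C + 1))).
have tau0 : 0 < tau.
  by rewrite !lt_min d0 ltr01/= divr_gt0// mulr_gt0// ltr_wpDl.
exists tau => //; apply: min_time_ge => T u T0 cu Hy.
rewrite lee_fin leNgt; apply/negP; rewrite !lt_min => /andP[/andP[Td T1] TC].
have s1 : support A B x T <= C * T.
  have := lip 0 T; rewrite lexx ler01 ltW//= (ltW T1) primitive0_at0 !subr0 => /(_ isT isT).
  by rewrite (gtr0_norm T0) => /(le_trans (ler_norm _)).
have s2 : enorm ((expmx A (- T))^T *m x) <= enorm x + e1.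
  have := H T; rewrite /ball/= sub0r normrN (gtr0_norm T0) => /(_ Td).
  by rewrite ltr_distl => /andP[? _]; lra.
have yE : x + steering A B u T = expmx A (- T) *m arrival x u T.
  by rewrite /arrival mulmxA (mulmx1C (expmxN A T)) mul1mx.
have := dotmx_steering_ge A B x cu (ltW T0).
have -> : steering A B u T = expmx A (- T) *m arrival x u T - x.
  by rewrite -yE addrC addKr.
rewrite dotmxBr -sqr_enorm dotmx_mulr => H1.
have := dotmx_le ((expmx A (- T))^T *m x) (arrival x u T).
have : enorm ((expmx A (- T))^T *m x) * enorm (arrival x u T) <= (enorm x + e1) * eps.
  by rewrite ler_pM ?enorm_ge0.
have : e1 * eps < gap / 2.
  have -> : gap / 2 = e1 * (eps + 1) by rewrite /e1; field; rewrite gt_eqF// ltr_wpDl.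
  by rewrite ltr_pM2l// ltrDl.
have : C * T < gap / 2.
  rewrite ltr_pdivlMr ?mulr_gt0 ?ltr_wpDl// in TC.
  by nra.
rewrite /gap in gap0 *; nra.
Qed.

End extremals.

(** * Two costates for one optimal control *)

Section coincidence.
Context {R : realType} {n m : nat}.
Notation mu := (@lebesgue_measure R).
Variables (A : 'M[R]_n) (B : 'M[R]_(n, m)).
Hypothesis hrank : \rank (controllability_mx A B) = n.
Implicit Types (u v w : R -> 'cV[R]_m) (x p q y : 'cV[R]_n) (T S t s eps : R).

Lemma adjoint_neq0 p t : adjoint A B p t != 0 -> p != 0.
Proof. by apply: contraNneq => ->; rewrite /adjoint !mulmx0. Qed.

Lemma ae_adjoint_neq0 p T : p != 0 ->
  {ae mu, forall s, 0 < s <= T -> adjoint A B p s != 0}.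
Proof.
move=> p0; have [D DP] := adjoint_zeros hrank T p0.
have Fmu := ae_filter_ringOfSetsType mu.
apply: filterS (ae_notin_seq D) => s sD /andP[s0 sT].
by rewrite DP// sT ltW.
Qed.

Lemma extremal_bang p v T : p != 0 ->
  {ae mu, forall s, 0 < s <= T -> adjoint A B p s = - enorm (adjoint A B p s) *: v s} ->
  {ae mu, forall s, 0 < s <= T -> v s = bang A B p s}.
Proof.
move=> p0 H; have Fmu := ae_filter_ringOfSetsType mu.
apply: (filterS2 _ _ H (ae_adjoint_neq0 T p0)) => s Hs ns sT.
move: (Hs sT) (ns sT) => {}Hs; rewrite -enorm_eq0 => {}ns.
rewrite /bang /normalize {2}Hs scalerA mulrN mulVf// scaleN1r opprK//.
Qed.

Lemma steering_left_bang p S : p != 0 ->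
  steering A B (left_bang A B p S) S = steering A B (bang A B p) S.
Proof.
move=> p0; apply: steering_ae_eq; [exact: left_bang_control|exact: bang_control|].
have Fmu := ae_filter_ringOfSetsType mu.
by apply: filterS (ae_adjoint_neq0 S p0) => s ns sS; rewrite left_bangE// ns.
Qed.

Lemma optimal_target p S : 0 < S -> adjoint A B p S != 0 ->
  optimal_representative A B 0 (- steering A B (bang A B p) S) (left_bang A B p S).
Proof.
move=> S0 a0; have p0 := adjoint_neq0 a0; exists S; split.
- exact: min_time_target.
- split; first exact/control_admissible/left_bang_control.
  apply/reachesE; [exact: left_bang_control|exact: ltW|].
  by rewrite steering_left_bang// addNr mulmx0 enorm0.
- exact: left_bang_piecewise.
- by move=> t; rewrite /left_bang => /negbTE ->.
Qed.

Lemma optimal_controlP eps x : (exists u, optimal_representative A B eps x u) ->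
  optimal_representative A B eps x (optimal_control A B eps x).
Proof. by move=> /(xgetPex (fun=> 0)). Qed.

Lemma optimal_control_none eps x : ~ (exists u, optimal_representative A B eps x u) ->
  optimal_control A B eps x = fun=> 0.
Proof. by move=> H; apply: xgetPN => u Hu; apply: H; exists u. Qed.

(** Whichever representative the description selects, it drives the point to 0 at time S, so its
    pairing with p attains the minimum [- support A B p S]. *)
Lemma optimal_extremal p S : 0 < S -> adjoint A B p S != 0 ->
  {ae mu, forall s, 0 < s <= S -> adjoint A B p s = - enorm (adjoint A B p s) *:
    optimal_control A B 0 (- steering A B (bang A B p) S) s}.
Proof.
move=> S0 a0; set x := - _; set u := optimal_control _ _ _ _.
have [T [mt [au ru] _ _]] : optimal_representative A B 0 x u.
  by apply: optimal_controlP; exists (left_bang A B p S); exact: optimal_target.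
move: mt; rewrite min_time_target// => -[ST]; rewrite -{}ST in ru.
have [v [cv rv vu]] := admissible_reaches au ru.
have : expmx A S *m (x + steering A B v S) = 0.
  apply/eqP; rewrite -enorm_eq0 eq_le enorm_ge0 andbT.
  by apply/(reachesE A B 0 x cv) => //; exact: ltW.
move=> /(congr1 (mulmx (expmx A (- S)))).
rewrite mulmxA (mulmx1C (expmxN A S)) mul1mx mulmx0 => /eqP.
rewrite addrC subr_eq0 => /eqP E.
have /(ae_extremal cv (ltW S0)) H : dotmx p (steering A B v S) <= - support A B p S.
  by rewrite E dotmx_steering_bang.
have [_ u1] := au; have Fmu := ae_filter_ringOfSetsType mu.
apply: (filterS2 _ _ H u1) => s Hs us /andP[s0 sS].
by rewrite -vu// ?us// -Hs// sS ltW.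
Qed.

Hypothesis coincide : forall x : 'cV[R]_n, x != 0 -> exists2 epsx : R, 0 < epsx < enorm x &
  forall eps : R, 0 < eps < epsx -> forall t : R, 0 < t -> (t%:E <= min_time A B eps x)%E ->
    optimal_control A B eps x t = optimal_control A B 0 x t.

Definition chord p T S := steering A B (bang A B p) T - steering A B (bang A B p) S.

(* For small eps, T is the optimal time of (P_eps), exp(T A) (chord p T S) is the
   point where the optimal trajectory of (P_0) enters the ball of radius eps,
   and p' is the costate given by the maximum principle for (P_eps). Both
   switching functions are negatively proportional to the same control. *)
Lemma frequent_extremals p S d : 0 < S -> adjoint A B p S != 0 -> 0 < d ->
  exists2 T, (S - d < T < S) && (0 < T) & forall t, 0 <= t <= T ->
    let p' := (expmx A T)^T *m (expmx A T *m chord p T S) in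
    enorm (adjoint A B p' t) *: adjoint A B p t =
    enorm (adjoint A B p t) *: adjoint A B p' t.
Proof.
move=> S0 a0 d0; have p0 := adjoint_neq0 a0.
have Fmu := ae_filter_ringOfSetsType mu.
pose x := - steering A B (bang A B p) S.
have x0 : x != 0 by exact: target_neq0.
pose u0 := optimal_control A B 0 x.
have ext0 : {ae mu, forall s, 0 < s <= S ->
    adjoint A B p s = - enorm (adjoint A B p s) *: u0 s} by exact: optimal_extremal.
have [epsx /andP[epsx0 epsxx] coin] := coincide x0.
pose S' := Num.max 0 (S - d).
have S'S : 0 <= S' < S by rewrite le_max lexx gt_max S0/= ltrBlDr ltrDl.
pose k := support A B p S - support A B p S'.
have k0 : 0 < k by rewrite subr_gt0 support_lt.
have [C CP] : exists C : R, forall t, 0 <= t <= S -> enorm ((expmx A (- t))^T *m p) <= C.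
  have lE : mx_locally_bounded (fun t => (expmx A (- t))^T *m p).
    apply: mx_locally_boundedM; last exact: mx_locally_bounded_cst.
    apply: mx_locally_bounded_tr.
    exact: mx_is_primitive_locally_bounded (expmxN_is_primitive A).
  have [_ /(_ S)[C CP]] := locally_bounded_enorm lE.
  by exists C => t tS; rewrite (le_trans (ler_norm _))// CP.
have C0 : 0 <= C by rewrite (le_trans (enorm_ge0 _) (CP 0 _))// lexx ltW.
(* The first bound makes (i) applicable, the second gives C eps < k, which will force T beyond
   [S']. *)
pose eps := Num.min (epsx / 2) (k / (2 * (C + 1))).
have eps0 : 0 < eps.
  by rewrite lt_min !divr_gt0// mulr_gt0// ltr_wpDl.
have epsE : eps < epsx.
  by rewrite gt_min ltr_pdivrMr// ltr_pMr// ltr1n.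
have epsC : C * eps < k.
  have : eps <= k / (2 * (C + 1)) by rewrite ge_min lexx orbT.
  rewrite ler_pdivlMr; last by rewrite mulr_gt0// ltr_wpDl.
  move=> H.
  by have Ce : 0 <= C * eps by [rewrite mulr_ge0 ?(ltW eps0)]; lra.
have epsx' : 0 <= eps < enorm x by rewrite ltW//= (lt_trans epsE).
have [tau tau0 mtau] := min_time_gt0 A B epsx'.
have coin' t : 0 < t -> (t%:E <= min_time A B eps x)%E -> optimal_control A B eps x t = u0 t.
  by apply: coin; rewrite eps0.
(* Otherwise the default control 0 would, through (i) and [ext0], annihilate the switching function
   on an initial interval. *)
have [T [mt [aue rue] _ _]] : optimal_representative A B eps x (optimal_control A B eps x).
  apply: optimal_controlP; apply: contrapT => /optimal_control_none none.
  have tS0 : 0 < Num.min tau S by rewrite lt_min tau0.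
  have az t : 0 <= t <= Num.min tau S -> adjoint A B p t = 0.
    move=> tt; apply/matrixP => i j; rewrite [RHS]mxE.
    apply: (ae_eq_continuous tS0 (g := fun=> 0) (f := fun s => adjoint A B p s i j)) => //.
    - by move=> s; apply: cvg_mx_entry; exact: adjoint_continuous.
    - by move=> s; exact: cvg_cst.
    - apply: filterS ext0 => s Hs /andP[s0]; rewrite le_min => /andP[stau sS].
      rewrite Hs ?s0// -coin'// ?none ?scaler0 ?mxE//.
      by rewrite (le_trans _ mtau)// lee_fin.
  have [h h0 hP] := adjoint_isolated hrank 0 p0.
  pose r := Num.min (h / 2) (Num.min tau S).
  have r0 : 0 < r by rewrite lt_min divr_gt0.
  have := hP r; rewrite add0r az ?eqxx; last by rewrite (ltW r0) ge_min lexx orbT.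
  rewrite gtr0_norm// r0 gt_min ltr_pdivrMr// ltr_pMr// ltr1n => /(_ isT) //.
have T0 : 0 < T by rewrite (lt_le_trans tau0)// -lee_fin -mt.
have TS : T <= S.
  rewrite -lee_fin -mt; apply: (min_time_le (bang_control A B p)) => //.
  by rewrite addNr mulmx0 enorm0 ltW.
have [v [cv rv vu]] := admissible_reaches aue rue.
have vu0 : {ae mu, forall s, 0 < s <= T -> v s = u0 s}.
  have [_ ue1] := aue; apply: filterS ue1 => s us /andP[s0 sT].
  by rewrite vu ?us// coin'// mt lee_fin.
have extv : {ae mu, forall s, 0 < s <= T ->
    adjoint A B p s = - enorm (adjoint A B p s) *: v s}.
  apply: (filterS2 _ _ ext0 vu0) => s Hs vs sT; rewrite vs// -Hs//.
  by case/andP: sT => -> /le_trans->.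
have vb : steering A B v T = steering A B (bang A B p) T.
  by apply: steering_ae_eq => //; [exact: bang_control|exact: extremal_bang].
pose y := expmx A T *m (x + steering A B v T).
have yE : y = expmx A T *m chord p T S by rewrite /y vb /chord addrC.
have yeps : enorm y <= eps by apply/reachesE => //; exact: ltW.
have epsy : eps <= enorm y by exact: arrival_ge.
pose p' := (expmx A T)^T *m y.
have extp' : {ae mu, forall s, 0 <= s <= T ->
    adjoint A B p' s = - enorm (adjoint A B p' s) *: v s}.
  apply: ae_extremal => //; first exact: ltW.
  have H : dotmx y y <= dotmx y (expmx A T *m (x + steering A B (bang A B p') T)).
    apply: (arrival_variational (ltW eps0)
      (fun w cw => arrival_ge T0 mt cw) cv yeps (bang_control A B p')).
  move: H; rewrite {2}/y !dotmx_mulr -/p' !dotmxDr lerD2l.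
  by rewrite dotmx_steering_bang.
(* As |y| <= eps, this difference is at most C eps < k, whence T > [S']. *)
have hk : dotmx p (expmx A (- T) *m y) = support A B p S - support A B p T.
  rewrite yE mulmxA (mulmx1C (expmxN A T)) mul1mx dotmxBr !dotmx_steering_bang.
  by rewrite opprK addrC.
have hC : support A B p S - support A B p T < k.
  rewrite -hk dotmx_mulr (le_lt_trans (dotmx_le _ _))// (le_lt_trans _ epsC)//.
  by rewrite ler_pM ?enorm_ge0// CP// TS ltW.
have ST' : S' < T.
  rewrite ltNge; apply/negP => TS'; move: hC; rewrite /k ltrD2l ltrN2.
  by rewrite ltNge support_le// TS' ltW.
have TltS : T < S.
  rewrite lt_neqAle TS andbT; apply/eqP => TES.
  move: epsy; rewrite yE /chord TES subrr mulmx0 enorm0 leNgt eps0//.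
exists T.
  by rewrite TltS T0 !andbT; move: ST'; rewrite gt_max => /andP[].
move=> t tT; rewrite -yE -/p'; apply/matrixP => i j.
have ce r s : enorm (adjoint A B r s') @[s' --> s] --> enorm (adjoint A B r s).
  by apply: cvg_enorm; exact: adjoint_continuous.
have ca r s : adjoint A B r s' i j @[s' --> s] --> adjoint A B r s i j.
  by apply: cvg_mx_entry; exact: adjoint_continuous.
rewrite [LHS]mxE [RHS]mxE.
apply: (ae_eq_continuous T0
  (f := fun s => enorm (adjoint A B p' s) * adjoint A B p s i j)
  (g := fun s => enorm (adjoint A B p s) * adjoint A B p' s i j)) => //.
- by move=> s; apply: cvgM; [exact: ce|exact: ca].
- by move=> s; apply: cvgM; [exact: ce|exact: ca].
apply: (filterS2 _ _ extv extp') => s Hs Hs' /andP[s0 sT].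
have {}Hs : adjoint A B p s i j = - enorm (adjoint A B p s) * v s i j.
  by have /matrixP/(_ i j) := Hs (introT andP (conj s0 sT)); rewrite [RHS]mxE.
have {}Hs' : adjoint A B p' s i j = - enorm (adjoint A B p' s) * v s i j.
  by have /matrixP/(_ i j) := Hs' (introT andP (conj (ltW s0) sT)); rewrite [RHS]mxE.
by rewrite Hs Hs'; ring.
Qed.

End coincidence.

(** * Isotropy from coinciding controls *)

Section coincidence_isotropic.
Context {R : realType} {n m : nat}.
Variables (A : 'M[R]_n) (B : 'M[R]_(n, m)).
Hypothesis n_gt0 : (0 < n)%N.
Hypothesis hrank : \rank (controllability_mx A B) = n.
Hypothesis coincide : forall x : 'cV[R]_n, x != 0 -> exists2 epsx : R, 0 < epsx < enorm x &
  forall eps : R, 0 < eps < epsx -> forall t : R, 0 < t -> (t%:E <= min_time A B eps x)%E ->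
    optimal_control A B eps x t = optimal_control A B 0 x t.
Implicit Types (p q r : 'cV[R]_n) (T S t s : R).

Let costate q : 'cV[R]_n := (expmx A 1)^T *m q.

Lemma adjoint_costate q t : adjoint A B (costate q) t = adjoint A B q (t - 1).
Proof. by rewrite addrC adjointB opprK. Qed.

Lemma adjoint0 q : adjoint A B q 0 = B^T *m q.
Proof. by rewrite /adjoint oppr0 expmx0 trmx1 mul1mx. Qed.

Lemma adjoint_costate1 q : adjoint A B (costate q) 1 = B^T *m q.
Proof. by rewrite adjoint_costate subrr adjoint0. Qed.

(** B^T q is the final value of the switching function, so the extremal control is continuous at 1
    and the quotient tends to minus the integrand of [steering] there. *)
Lemma cvg_chord q : B^T *m q != 0 ->
  (1 - T)^-1 *: chord A B (costate q) T 1 @[T --> 1^'-] -->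
  expmx A (-1) *m (B *m normalize (B^T *m q)).
Proof.
move=> q0; have a0 : adjoint A B (costate q) 1 != 0 by rewrite adjoint_costate1.
set u := bang A B (costate q).
have cu : control u := bang_control A B _.
have cf : {for 1, continuous (fun s => expmx A (- s) *m (B *m u s))}.
  apply: cvg_mulmx; first by apply: expmx_cvg; apply: cvgN; exact: cvg_id.
  by apply: cvg_mulmx; [exact: cvg_cst|exact: bang_continuous].
apply: cvg_mx => i j.
have Fp := mx_primitive0_is_primitive (mx_locally_bounded_steering A B cu) i j.
have cij : {for 1, continuous (fun s => (expmx A (- s) *m (B *m u s)) i j)}.
  by apply: cvg_mx_entry; exact: cf.
have := cvg_left_difference ltr01 Fp cij.
rewrite [u 1]/bang adjoint_costate1 !mulmxN [(- (_ *m _)) i j]mxE => /cvgN.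
rewrite opprK; apply: cvg_trans; apply: near_eq_cvg; apply: nearW => T /=.
by rewrite fctE /chord !mxE -mulrN opprB.
Qed.

(** At fixed t = s + 1 < 1, the relation of [frequent_extremals] is homogeneous in the chord;
    divided by 1 - T it passes to the limit T -> 1. The case s = 0 follows by continuity, since T
    has to reach t. *)
Lemma adjoint_parallel q s : B^T *m q != 0 -> -1 <= s <= 0 ->
  enorm (adjoint A B (B *m (B^T *m q)) s) *: adjoint A B q s =
  enorm (adjoint A B q s) *: adjoint A B (B *m (B^T *m q)) s.
Proof.
move=> q0; wlog s0 : s / s < 0 => [H /andP[s1 s0]|/andP[s1 _]].
  have [/H|s0'] := ltP s 0; first by apply; rewrite s1.
  have -> : s = 0 by apply/eqP; rewrite eq_le s0.
  apply/matrixP => i j; rewrite [LHS]mxE [RHS]mxE.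
  have ce p : enorm (adjoint A B p t) @[t --> 0^'-] --> enorm (adjoint A B p 0).
    by apply: cvg_enorm; apply: cvg_within_filter; exact: adjoint_continuous.
  have ca p : adjoint A B p t i j @[t --> 0^'-] --> adjoint A B p 0 i j.
    by apply: cvg_mx_entry; apply: cvg_within_filter; exact: adjoint_continuous.
  apply: (frequently_eq_cvg_left (cvgM (ce _) (ca _)) (cvgM (ce _) (ca _))) => d d0.
  have dm : 0 < Num.min d 1 by rewrite lt_min d0 ltr01.
  pose t := - (Num.min d 1 / 2).
  have [d1 d2] : Num.min d 1 <= d /\ Num.min d 1 <= 1 by rewrite !ge_min !lexx orbT.
  exists t; first by rewrite /t; apply/andP; split; lra.
  have /matrixP/(_ i j) := H t (ltac:(rewrite /t; lra)) (ltac:(rewrite /t; apply/andP; split; lra)).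
  by rewrite !mxE.
have a0 : adjoint A B (costate q) 1 != 0 by rewrite adjoint_costate1.
pose t := s + 1; have tE : t - 1 = s by rewrite /t addrK.
have t0 : 0 <= t by rewrite /t; lra.
have t1 : t < 1 by rewrite /t; lra.
pose P T := (expmx A T)^T *m (expmx A T *m ((1 - T)^-1 *: chord A B (costate q) T 1)).
pose r := costate (B *m normalize (B^T *m q)).
have cP : P T @[T --> 1^'-] --> r.
  have cE : expmx A T @[T --> 1^'-] --> expmx A 1.
    by apply: cvg_within_filter; apply: expmx_cvg; exact: cvg_id.
  rewrite /r /costate -[B *m _]mul1mx -(expmxN A 1) -mulmxA.
  by apply: cvg_mulmx (cvg_trmx cE) _; apply: cvg_mulmx cE (cvg_chord q0).
have cA : adjoint A B (P T) t @[T --> 1^'-] --> adjoint A B r t.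
  by apply: adjoint_cvg => //; exact: cvg_cst.
have H : enorm (adjoint A B r t) *: adjoint A B (costate q) t =
    enorm (adjoint A B (costate q) t) *: adjoint A B r t.
  apply/matrixP => i j; rewrite [LHS]mxE [RHS]mxE.
  have cAij : adjoint A B (P T) t i j @[T --> 1^'-] --> adjoint A B r t i j.
    exact: cvg_mx_entry cA.
  apply: (frequently_eq_cvg_left
    (cvgM (cvg_enorm cA) (cvg_cst (adjoint A B (costate q) t i j)))
    (cvgM (cvg_cst (enorm (adjoint A B (costate q) t))) cAij)) => d d0.
  have dm : 0 < Num.min d (1 - t) by rewrite lt_min d0 subr_gt0.
  have [T /andP[/andP[Td T1] T0] /(_ t) HT] := frequent_extremals hrank coincide ltr01 a0 dm.
  have [d1 d2] : Num.min d (1 - t) <= d /\ Num.min d (1 - t) <= 1 - t.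
    by rewrite !ge_min !lexx orbT.
  exists T; first by rewrite T1 andbT; lra.
  have {}HT := HT (ltac:(rewrite t0/=; lra)).
  have PE : adjoint A B (P T) t = (1 - T)^-1 *: adjoint A B
      ((expmx A T)^T *m (expmx A T *m chord A B (costate q) T 1)) t.
    by rewrite -adjointZ /P -!scalemxAr.
  have /matrixP/(_ i j) := HT; rewrite /= PE enormZ !mxE => E.
  by rewrite gtr0_norm ?invr_gt0 ?subr_gt0// -mulrA E mulrCA.
have q1 : enorm (B^T *m q) != 0 by rewrite enorm_eq0.
have rE : adjoint A B r t = (enorm (B^T *m q))^-1 *: adjoint A B (B *m (B^T *m q)) s.
  by rewrite /r adjoint_costate tE /normalize -scalemxAr adjointZ.
have e0 : 0 < (enorm (B^T *m q))^-1 by rewrite invr_gt0 enorm_gt0.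
move: H; rewrite rE enormZ gtr0_norm// adjoint_costate tE.
move=> /(congr1 (fun v => enorm (B^T *m q) *: v)) /=.
by rewrite !scalerA mulVKf// mulrAC divff// mul1r.
Qed.

Lemma controllability_tr_neq0 : exists q, B^T *m q != 0.
Proof.
apply/not_existsP => H.
have B0 q : B^T *m q = 0 by apply/eqP/negPn/negP; exact: H.
have /matrixP/(_ (Ordinal n_gt0) 0) : (delta_mx (Ordinal n_gt0) 0 : 'cV[R]_n) = 0.
  by apply: (controllability_inj hrank) => k _; exact: B0.
by rewrite !mxE !eqxx => /eqP; rewrite oner_eq0.
Qed.

(* Adding a multiple M q2 to q1 leaves B B^T q1 unchanged, hence
   adjoint q1 + M adjoint q2 points in the same direction for every real M. *)
Lemma coincide_tr_inj q2 : B^T *m q2 = 0 -> q2 = 0.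
Proof.
move=> Bq2; have [q1 Bq1] := controllability_tr_neq0.
pose h := B *m (B^T *m q1).
have h0 : 0 < enorm (adjoint A B h 0).
  rewrite enorm_gt0 adjoint0 /h; apply: contra Bq1 => /eqP E.
  have Bw : B *m (B^T *m q1) = 0 by apply/eqP; rewrite -dotmx_eq0 dotmx_mulr E dotmx0l.
  by rewrite -dotmx_eq0 -dotmx_mulr Bw dotmx0r.
have /cvgrPdist_lt/(_ _ h0)/nbhs_ballP[d /= d0 Hd] :
    enorm (adjoint A B h s) @[s --> (0 : R)] --> enorm (adjoint A B h 0).
  by apply: cvg_enorm; exact: adjoint_continuous.
have z s : -1 <= s <= 0 -> `|s| < d -> adjoint A B q2 s = 0.
  move=> s1 sd; set v := adjoint A B h s.
  have v0 : 0 < enorm v.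
    have := Hd s; rewrite /ball/= sub0r normrN => /(_ sd); rewrite -/v.
    by have := enorm_ge0 v; rewrite ltr_norml => ? /andP[_]; lra.
  set f1 := adjoint A B q1 s; set f2 := adjoint A B q2 s.
  have par (M : R) : enorm v *: (f1 + M *: f2) = enorm (f1 + M *: f2) *: v.
    have E : B^T *m (q1 + M *: q2) = B^T *m q1 by rewrite mulmxDr -scalemxAr Bq2 scaler0 addr0.
    have := @adjoint_parallel (q1 + M *: q2) s.
    by rewrite E adjointD adjointZ; apply.
  have pos (M : R) : 0 <= dotmx f1 v + M * dotmx f2 v.
    have := congr1 (fun a => dotmx a v) (par M); rewrite /= !dotmxZl dotmxDl dotmxZl => E.
    by rewrite -(pmulr_rge0 _ v0) E mulr_ge0 ?enorm_ge0 ?dotmx_ge0.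
  (* An affine function of M that is nonnegative for all M has slope 0; the M tried would give the
     value -1. *)
  have f2v : dotmx f2 v = 0.
    apply/eqP/negPn/negP => n0.
    have := pos (- (1 + dotmx f1 v) / dotmx f2 v).
    by rewrite mulrAC mulfK//; lra.
  (* With [f2] orthogonal to [v], the difference of the cases M = 1 and M = 0 is |f2|^2 = 0. *)
  have E1 := congr1 (fun a => dotmx a f2) (par 1); have E0 := congr1 (fun a => dotmx a f2) (par 0).
  move: E1 E0; rewrite /= !dotmxZl (dotmxC v) f2v !mulr0 scale1r scale0r addr0 dotmxDl.
  move=> /eqP; rewrite mulf_eq0 (gt_eqF v0)/= => /eqP E1 /eqP.
  rewrite mulf_eq0 (gt_eqF v0)/= => /eqP E0; move: E1; rewrite E0 add0r => /eqP.
  by rewrite dotmx_eq0 => /eqP.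
apply/eqP/negPn/negP => q20.
have [e e0 He] := adjoint_isolated hrank 0 q20.
pose c := Num.min (Num.min d e) 1 / 2.
have cm : 0 < Num.min (Num.min d e) 1 by rewrite !lt_min d0 e0 ltr01.
have [c1 [c2 c3]] : Num.min (Num.min d e) 1 <= d /\ Num.min (Num.min d e) 1 <= e /\
    Num.min (Num.min d e) 1 <= 1 by rewrite !ge_min !lexx !orbT.
have c0 : 0 < c by rewrite /c; lra.
have cz : adjoint A B q2 (- c) = 0.
  apply: z; last by rewrite normrN gtr0_norm// /c; lra.
  by rewrite /c; apply/andP; split; lra.
have := He (- c); rewrite add0r cz eqxx normrN gtr0_norm// c0 => /(_ _)/notF; apply.
by rewrite /c/=; lra.
Qed.

(** At s = 0 the two switching functions are B^T q and B^T (B B^T q); cancelling the injective B^T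
    makes B B^T q parallel to q. *)
Lemma coincide_BBT : exists c, B *m B^T = c%:M.
Proof.
apply: scalar_mx_perp => r q rq.
have [->|q0] := eqVneq q 0; first by rewrite mulmx0 dotmx0r.
have Bq : B^T *m q != 0 by apply: contra q0 => /eqP/coincide_tr_inj ->.
have := @adjoint_parallel q 0 Bq; rewrite !adjoint0 lexx lerN10 => /(_ isT) E.
have {}E : enorm (B^T *m (B *m (B^T *m q))) *: q = enorm (B^T *m q) *: (B *m (B^T *m q)).
  apply/eqP; rewrite -subr_eq0; apply/eqP/coincide_tr_inj.
  by rewrite mulmxBr -!scalemxAr E subrr.
have := congr1 (dotmx r) E; rewrite !dotmxZr rq mulr0 mulmxA => /esym/eqP.
by rewrite mulf_eq0 enorm_eq0 (negbTE Bq) => /eqP.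
Qed.

Section symmetric_part.
Variable b : R.
Hypothesis b_gt0 : 0 < b.
Hypothesis BBT : B *m B^T = (b ^+ 2)%:M.

Lemma dotmx_mul_tr q r : dotmx (B^T *m q) (B^T *m r) = b ^+ 2 * dotmx q r.
Proof. by rewrite dotmxC dotmx_mulr trmxK mulmxA BBT mul_scalar_mx dotmxZl dotmxC. Qed.

(** The solution of the adjoint equation p' = - A^T p with value q at time 1. *)
Let flow q t : 'cV[R]_n := (expmx A (1 - t))^T *m q.

Lemma adjoint_flow q t : adjoint A B (costate q) t = B^T *m flow q t.
Proof. by rewrite adjoint_costate /adjoint opprB. Qed.

Lemma flow_neq0 q t : q != 0 -> flow q t != 0.
Proof.
apply: contra => /eqP/(congr1 (mulmx (expmx A (- (1 - t)))^T)).
by rewrite mulmxA -trmx_mul expmxN trmx1 mul1mx mulmx0 => ->.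
Qed.

Lemma flow_continuous q : continuous (flow q).
Proof.
move=> t; apply: cvg_mulmx; last exact: cvg_cst.
apply: cvg_trmx; apply: expmx_cvg; apply: cvgB; [exact: cvg_cst|exact: cvg_id].
Qed.

Lemma flow1 q : flow q 1 = q.
Proof. by rewrite /flow subrr expmx0 trmx1 mul1mx. Qed.

(** The pairing of the two flows vanishes at 1 and has derivative - <r, (A + A^T) q> there. *)
Lemma cvg_dotmx_flow q r : dotmx r q = 0 ->
  (1 - T)^-1 * dotmx (flow r T) (flow q T) @[T --> 1^'-] -->
  dotmx r ((A + A^T) *m q).
Proof.
move=> rq.
have HE : mx_is_primitive (fun t => expmx A (1 - t)) (fun t => - (A *m expmx A (1 - t))).
  apply: eq_mx_is_primitive (expmx_is_primitive A (-1) 1) => t _;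
    by rewrite mulN1r addrC ?scaleN1r.
have HET : mx_is_primitive (fun t => (expmx A (1 - t))^T)
    (fun t => - ((expmx A (1 - t))^T *m A^T)).
  move=> i j; apply: eq_is_primitive (HE j i) => s _; first by rewrite [RHS]mxE.
  by rewrite -trmx_mul [LHS]mxE [RHS]mxE [_^T _ _]mxE.
have H := mx_is_primitiveM (mx_is_primitive_cst r^T) (mx_is_primitiveM
  (mx_is_primitiveM HE HET) (mx_is_primitive_cst q)).
pose g t := (r^T *m ((- (A *m expmx A (1 - t)) *m (expmx A (1 - t))^T +
  expmx A (1 - t) *m (- ((expmx A (1 - t))^T *m A^T))) *m q)) 0 0.
have Hg : is_primitive (fun t => dotmx (flow r t) (flow q t)) g.
  apply: eq_is_primitive (H 0 0) => t _.
    by rewrite dotmxE /flow trmx_mul trmxK !mulmxA.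
  by rewrite /g mul0mx add0r mulmx0 addr0.
have cE s : expmx A (1 - t) @[t --> s] --> expmx A (1 - s).
  by apply: expmx_cvg; apply: cvgB; [exact: cvg_cst|exact: cvg_id].
have cg : {for 1, continuous g}.
  apply: cvg_mx_entry; apply: cvg_mulmx; first exact: cvg_cst.
  apply: cvg_mulmx; last exact: cvg_cst.
  apply: cvgD; apply: cvg_mulmx.
  - by apply: cvgN; apply: cvg_mulmx; [exact: cvg_cst|exact: cE].
  - by apply: cvg_trmx; exact: cE.
  - exact: cE.
  - by apply: cvgN; apply: cvg_mulmx; [apply: cvg_trmx; exact: cE|exact: cvg_cst].
have := cvg_left_difference ltr01 Hg cg; rewrite !flow1 rq => /cvgN.
have -> : - g 1 = dotmx r ((A + A^T) *m q).
  rewrite /g subrr expmx0 trmx1 !mulmx1 mul1mx mul1mx -opprD mulNmx mulmxN mxE opprK.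
  by rewrite -dotmxE.
apply: cvg_trans; apply: near_eq_cvg; apply: nearW => T.
by rewrite fctE sub0r mulrN opprK.
Qed.

(** With B B^T scalar, the pairing of the switching functions of r and q reduces to that of their
    costates. *)
Lemma chord_dotmx q r T : dotmx (expmx A 1 *m chord A B (costate q) T 1) r =
  primitive0 (fun t => b * (enorm (flow q t))^-1 * dotmx (flow r t) (flow q t)) 1 -
  primitive0 (fun t => b * (enorm (flow q t))^-1 * dotmx (flow r t) (flow q t)) T.
Proof.
rewrite dotmxC dotmx_mulr -/(costate r) /chord dotmxBr.
have cu := bang_control A B (costate q).
rewrite !dotmx_steering//.
have E t : dotmx (adjoint A B (costate r) t) (bang A B (costate q) t) =
    - (b * (enorm (flow q t))^-1 * dotmx (flow r t) (flow q t)).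
  rewrite /bang dotmxNr /normalize dotmxZr !adjoint_flow dotmx_mul_tr.
  rewrite (enorm_mulmx_tr BBT b_gt0) invfM; congr (- _).
  have b0 := lt0r_neq0 b_gt0.
  by move: ((enorm (flow q t))^-1) (dotmx _ _) => c d; field.
have lE := locally_bounded_dotmx_adjoint A B (costate r) cu.
have lN := locally_boundedN lE.
have EN t : primitive0 (fun t => dotmx (adjoint A B (costate r) t) (bang A B (costate q) t)) t =
    - primitive0 (fun t => b * (enorm (flow q t))^-1 * dotmx (flow r t) (flow q t)) t.
  rewrite -[LHS]opprK -primitive0N//; congr (- _).
  by apply: eq_primitive0 => s _; rewrite E opprK.
by rewrite !EN opprK addrC.
Qed.

(* With phi_p(t) = <flow p t, flow q t>, the parallelism of the two costates at
   time T reads I_r(T) phi_q(T) = I_q(T) phi_r(T), where I_p(T) is the integral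
   of b phi_p / |flow q| over [T, 1]. Since phi_r(t) = k (1 - t) + o(1 - t), the
   two sides are equivalent to k/2 and k times b |q| (1 - T)^2. *)
Lemma coincide_symmetric : exists c, A + A^T = c%:M.
Proof.
apply: scalar_mx_perp => r q rq.
have [->|q0] := eqVneq q 0; first by rewrite mulmx0 dotmx0r.
have b0 := lt0r_neq0 b_gt0.
have Bq : B^T *m q != 0.
  by rewrite -enorm_eq0 (enorm_mulmx_tr BBT b_gt0) mulf_neq0// enorm_eq0.
have a0 : adjoint A B (costate q) 1 != 0 by rewrite adjoint_costate1.
set k := dotmx r _.
have cr := cvg_dotmx_flow rq; rewrite -/k in cr.
have cf p : flow p T @[T --> 1^'-] --> p.
  by rewrite -{2}[p]flow1; apply: cvg_within_filter; exact: flow_continuous.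
have cn : enorm (flow q T) @[T --> 1^'-] --> enorm q by apply: cvg_enorm; exact: cf.
have cq : dotmx (flow q T) (flow q T) @[T --> 1^'-] --> dotmx q q.
  by apply: cvg_dotmx; exact: cf.
have q1 : enorm q != 0 by rewrite enorm_eq0.
pose psi p t := b * (enorm (flow q t))^-1 * dotmx (flow p t) (flow q t).
have cpsi p : continuous (psi p).
  move=> t; apply: cvgM; last by apply: cvg_dotmx; exact: flow_continuous.
  apply: cvgM; first exact: cvg_cst.
  apply: cvgV; first by rewrite enorm_eq0 flow_neq0.
  by apply: cvg_enorm; exact: flow_continuous.
have lpsi p : locally_bounded (psi p) by exact: continuous_locally_bounded.
pose I p T := primitive0 (psi p) 1 - primitive0 (psi p) T.
have cIr : (1 - T) ^- 2 * I r T @[T --> 1^'-] --> b * (enorm q)^-1 * k / 2.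
  apply: cvg_left_half => //; first by rewrite /psi !flow1 rq mulr0.
  have H : b * (enorm (flow q T))^-1 * ((1 - T)^-1 * dotmx (flow r T) (flow q T))
      @[T --> 1^'-] --> b * (enorm q)^-1 * k.
    by apply: cvgM => //; apply: cvgM; [exact: cvg_cst|exact: cvgV].
  apply: cvg_trans H; apply: near_eq_cvg; apply: nearW => T.
  by rewrite /psi mulrCA.
have cIq : (1 - T)^-1 * I q T @[T --> 1^'-] --> psi q 1.
  apply: cvg_left_difference => //; first exact: primitive0_is_primitive.
  exact: cpsi.
have psi1 : psi q 1 = b * (enorm q)^-1 * dotmx q q by rewrite /psi !flow1.
have : b * (enorm q)^-1 * k / 2 * dotmx q q = psi q 1 * k.
  apply: (frequently_eq_cvg_left (cvgM cIr cq) (cvgM cIq cr)) => d d0.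
  have [T /andP[/andP[Td T1] T0] /(_ T)] := frequent_extremals hrank coincide ltr01 a0 d0.
  rewrite (ltW T0) lexx => /(_ isT); set y := expmx A T *m _ => /= H.
  exists T; first by rewrite Td.
  have yE : adjoint A B ((expmx A T)^T *m y) T = B^T *m y.
    by rewrite /adjoint (mulmxA (expmx A (- T))^T) -trmx_mul expmxN trmx1 mul1mx.
  (* Multiplication by B removes B^T at the cost of b^2, and |B^T v| = b |v| supplies the third
     factor b. *)
  have {}H : enorm y *: flow q T = enorm (flow q T) *: y.
    move: H; rewrite yE adjoint_flow !(enorm_mulmx_tr BBT b_gt0).
    move=> /(congr1 (mulmx B)); rewrite -!scalemxAr !(mulmxA B) BBT !mul_scalar_mx.
    rewrite !scalerA => /(congr1 (fun v => (b ^+ 3)^-1 *: v)) /=; rewrite !scalerA.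
    have -> : (b ^+ 3)^-1 * (b * enorm y * b ^+ 2) = enorm y by field.
    by have -> : (b ^+ 3)^-1 * (b * enorm (flow q T) * b ^+ 2) = enorm (flow q T) by field.
  (* After transport to time 1, pairing with p produces phi_p(T) on the left and I_p(T) on the
     right. *)
  have {}H : enorm y *: (expmx A (1 - T) *m flow q T) =
      enorm (flow q T) *: (expmx A 1 *m chord A B (costate q) T 1).
    rewrite scalemxAr H -scalemxAr /y mulmxA -expmxD subrK//.
  have Hp p : enorm y * dotmx (flow p T) (flow q T) = enorm (flow q T) * I p T.
    have := congr1 (fun v => dotmx v p) H; rewrite /= !dotmxZl chord_dotmx -/(psi p) -/(I p T).
    by move=> <-; congr (_ * _); rewrite [RHS]dotmxC [RHS]dotmx_mulr.
  have fn : enorm (flow q T) != 0 by rewrite enorm_eq0 flow_neq0.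
  have T1' : 1 - T != 0 by rewrite subr_eq0 gt_eqF.
  have H1 : I r T * dotmx (flow q T) (flow q T) = I q T * dotmx (flow r T) (flow q T).
    apply: (mulfI fn); rewrite mulrA -Hp mulrAC Hp; ring.
  have -> : (1 - T) ^- 2 * I r T * dotmx (flow q T) (flow q T) =
    (1 - T) ^- 2 * (I r T * dotmx (flow q T) (flow q T)) by rewrite mulrA.
  by rewrite H1; field.
(* The same nonzero coefficient multiplies k / 2 and k, so k = 0. *)
rewrite psi1 => E.
have : b * (enorm q)^-1 * dotmx q q * k = 0 by lra.
move=> /eqP; rewrite !mulf_eq0 (negbTE b0) invr_eq0 (negbTE q1) dotmx_eq0 (negbTE q0)/=.
by move=> /eqP.
Qed.

End symmetric_part.

End coincidence_isotropic.

Lemma isotropic_trace (R : realType) (n m : nat) (A : 'M[R]_n) (B : 'M[R]_(n, m))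
    (b a : R) : (0 < n)%N -> B *m B^T = b%:M -> A + A^T = (2 * a)%:M ->
  \tr (B *m B^T) / n%:R = b /\ \tr A / n%:R = a.
Proof.
move=> n0 BBT AAT; have nR : n%:R != 0 :> R by rewrite pnatr_eq0 -lt0n.
split; first by rewrite BBT mxtrace_scalar -(mulr_natr b) mulfK.
have := congr1 mxtrace AAT; rewrite raddfD/= mxtrace_tr mxtrace_scalar -(mulr_natr (2 * a)) => H.
have -> : \tr A = a * n%:R by lra.
by rewrite mulfK.
Qed.

Theorem corollary1p3 (R : realType) (n m : nat) (hn : (0 < n)%N)
    (hm : (0 < m)%N) (A : 'M[R]_n) (B : 'M[R]_(n, m))
    (hspec : spectrum_re_le0 A)
    (hrank : \rank (controllability_mx A B) = n)
    (hcond :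
      [\/ forall x : 'cV[R]_n, x != 0 ->
            exists2 epsx : R, 0 < epsx < enorm x &
              forall eps : R, 0 < eps < epsx ->
              forall t : R, 0 < t -> (t%:E <= min_time A B eps x)%E ->
                optimal_control A B eps x t = optimal_control A B 0 x t,
          exists beta' a' : R,
            [/\ 0 < beta', a' <= 0, B *m B^T = beta'%:M
              & A + A^T = (2 * a')%:M]
        | exists Psi : R -> R,
            [/\ forall r, 0 <= r -> 0 <= Psi r, Psi 0 = 0
              & forall x : 'cV[R]_n, value0 A B x = (Psi (enorm x))%:E]]) :
  let beta := \tr (B *m B^T) / n%:R in
  let a := \tr A / n%:R in
  [/\ 0 < beta, a <= 0
    & forall x : 'cV[R]_n, x != 0 ->
      forall eps : R, 0 <= eps < enorm x ->
        min_time A B eps x =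
          (Rintegral lebesgue_measure `[eps, enorm x]
             (fun xi => (Num.sqrt beta - a * xi)^-1))%:E].
Proof.
move=> beta a0.
suff [b [a [b_gt0 a_le0 BBT AAT]]] : exists b a : R,
    [/\ 0 < b, a <= 0, B *m B^T = b%:M & A + A^T = (2 * a)%:M].
  have [bE aE] := isotropic_trace hn BBT AAT.
  rewrite /beta /a0 bE aE; split=> // x x0 eps epsx.
  have sb_gt0 : 0 < Num.sqrt b by rewrite sqrtr_gt0.
  have BBT' : B *m B^T = (Num.sqrt b ^+ 2)%:M by rewrite sqr_sqrtr ?ltW.
  exact: (min_time_isotropic AAT BBT' a_le0 sb_gt0).
case: hcond => [coincide|[b [a [b_gt0 a_le0 BBT AAT]]]|[Psi [_ _ radial]]].
- have [b BBT] := coincide_BBT hn hrank coincide.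
  have b_gt0 := isotropic_gt0 hrank hn BBT.
  have BBT' : B *m B^T = (Num.sqrt b ^+ 2)%:M by rewrite sqr_sqrtr ?ltW.
  have [c AAT] : exists c, A + A^T = c%:M.
    by apply: (coincide_symmetric hrank coincide _ BBT'); rewrite sqrtr_gt0.
  have AAT' : A + A^T = (2 * (c / 2))%:M by rewrite mulrC divfK.
  by exists b, (c / 2); split=> //; exact: isotropic_le0 hspec AAT'.
- by exists b, a.
- have [b [a [BBT AAT]]] := radial_isotropic radial.
  have b_gt0 := isotropic_gt0 hrank hn BBT; have {}AAT := AAT (lt0r_neq0 b_gt0).
  by exists b, a; split=> //; exact: isotropic_le0 hspec AAT.
Qed.
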